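(* Let $r,n$ be integers with $3\le r<n$. For any $s\ge 1$ and any $\mathbf a=(a_1,\dots,a_s)\in\mathbb Z_{>0}^s$ with $\sum_{i=1}^s a_i=n$, the generating set $\{\det(\mathbf x_I): I\in\mathbf I_{r,n}\}$ of the Plücker algebra $\mathcal A_{r,n}$ forms a SAGBI basis for $\mathcal A_{r,n}$ with respect to the $(\mathbf a,3)$-block diagonal matching field $\Lambda_{\mathbf a,3}$. In particular, $\Lambda_{\mathbf a,3}$ gives rise to a toric degeneration of the Grassmannian $\mathrm{Gr}(r,n)$.
   Context: Let $\mathbb K$ be a field, $\mathbf I_{r,n}$ the collection of all $r$-element subsets of $[n]=\{1,\dots,n\}$, $\mathbf x=(x_{ij})_{1\le i\le r,\,1\le j\le n}$ an $r\times n$ matrix of variables, and $R=\mathbb K[\mathbf x]$ the polynomial ring in these $rn$ variables. For $I\in\mathbf I_{r,n}$, $\mathbf x_I$ is the $r\times r$ submatrix of $\mathbf x$ with columns indexed by $I$. The Plücker algebra is the subalgebra $\mathcal A_{r,n}=\mathbb K[\det(\mathbf x_I): I\in\mathbf I_{r,n}]\subset R$; it is the homogeneous coordinate ring of $\mathrm{Gr}(r,n)$ in its Plücker embedding. Initial forms. For a weight matrix $M=(M_{ij})\in\mathbb R^{r\times n}$, the weight of a monomial $\prod x_{ij}^{u_{ij}}$ is $\sum M_{ij}u_{ij}$. For $f\in R$, the initial form $\mathrm{in}_M(f)$ is the sum of all terms of $f$ of lowest weight. Put $\mathrm{in}_M(\mathcal A_{r,n})=\mathbb K[\mathrm{in}_M(f):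 f\in\mathcal A_{r,n}]$. SAGBI basis. The set $\{\det(\mathbf x_I): I\in\mathbf I_{r,n}\}$ is a SAGBI basis for $\mathcal A_{r,n}$ with respect to $M$ if $\mathrm{in}_M(\mathcal A_{r,n})=\mathbb K[\mathrm{in}_M(\det(\mathbf x_I)): I\in\mathbf I_{r,n}]$. Block diagonal matching fields. Let $\mathbf a=(a_1,\dots,a_s)\in\mathbb Z_{>0}^s$ with $\sum a_i=n$, and let $2\le\ell\le r$ (here $\ell=3$). Put $\alpha_0=0$, $\alpha_k=\sum_{i=1}^k a_i$, and $I_k=\{\alpha_{k-1}+1,\dots,\alpha_k\}$ for $1\le k\le s$. Let $M_{\mathbf a,\ell}\in\mathbb R^{r\times n}$ be the matrix whose entry in row $i$ and column $j$ is - $0$ if $i=1$; - $(n-j+1)\beta^{i-2}$ if $i\ge 2$ and $i\ne\ell$; - $(\alpha_{k-1}+\alpha_k+1-j)\beta^{\ell-2}$ if $i=\ell$ and $j\in I_k$ (so within the block $I_k$ the entries of row $\ell$ are, from left to right, $\alpha_k\beta^{\ell-2},\dots,(\alpha_{k-1}+1)\beta^{\ell-2}$). Here $\beta\gg 0$ is sufficiently large. For each $I\in\mathbf I_{r,n}$, $\mathrm{in}_{M_{\mathbf a,\ell}}(\det(\mathbf x_I))$ is then a single term, which corresponds to a bijection between the rows and the columns of $\mathbf x_I$. The $(\mathbf a,\ell)$-block diagonal matching field $\Lambda_{\mathbf a,\ell}$ is the assignment of this bijection (viewed as a permutation in $\mathfrak S_r$) to each $I$, i.e. the coherent matching field induced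 by $M_{\mathbf a,\ell}$. ''SAGBI basis with respect to $\Lambda_{\mathbf a,\ell}$'' means SAGBI basis with respect to $M_{\mathbf a,\ell}$. $\Lambda_{\mathbf a,\ell}$ is said to give rise to a toric degeneration of $\mathrm{Gr}(r,n)$ if $\{\det(\mathbf x_I): I\in\mathbf I_{r,n}\}$ forms a SAGBI basis for $\mathcal A_{r,n}$ with respect to $\Lambda_{\mathbf a,\ell}$. *)

(* Defs.v *)
From HB Require Import structures.
From mathcomp Require Import all_boot all_order all_fingroup all_algebra.
From mathcomp Require Import reals.
From mathcomp Require Import mpoly.

Set Implicit Arguments.
Unset Strict Implicit.
Unset Printing Implicit Defensive.

Import Order.TTheory GRing.Theory Num.Theory.
Local Open Scope ring_scope.

(* K[S]: the K-subalgebra generated by a (possibly infinite) set S. *)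
Inductive subalgebra_gen (K : fieldType) (A : algType K) (S : A -> Prop) :
  A -> Prop :=
| subalgebra_gen_mem p : S p -> subalgebra_gen S p
| subalgebra_gen_scalar c : subalgebra_gen S (c%:A)
| subalgebra_gen_add p q :
    subalgebra_gen S p -> subalgebra_gen S q -> subalgebra_gen S (p + q)
| subalgebra_gen_mul p q :
    subalgebra_gen S p -> subalgebra_gen S q -> subalgebra_gen S (p * q).

Definition rsubset (r n : nat) : Type := {I : {set 'I_n} | #|I| == r}.

(* The i-th smallest element of I; [enum_val] lists a subset of 'I_n in
   increasing order. *)
Definition rsubset_col (r n : nat) (I : rsubset r n) (i : 'I_r) : 'I_n :=
  enum_val (cast_ord (esym (eqP (valP I))) i).

(* The variable x_ij is the one of index [mxvec_index i j] among r * n. *)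
Definition varmx (K : fieldType) (r n : nat) : 'M[{mpoly K[r * n]}]_(r, n) :=
  \matrix_(i, j) 'X_(mxvec_index i j).

Definition plucker_det (K : fieldType) (r n : nat) (I : rsubset r n) :
  {mpoly K[r * n]} := \det (colsub (rsubset_col I) (varmx K r n)).

Definition plucker_algebra (K : fieldType) (r n : nat) :
  {mpoly K[r * n]} -> Prop :=
  subalgebra_gen (fun p => exists I : rsubset r n, p = plucker_det K I).

Definition mweight (R : realType) (r n : nat) (M : 'M[R]_(r, n))
    (m : 'X_{1..r * n}) : R :=
  \sum_(i < r) \sum_(j < n) M i j * (m (mxvec_index i j))%:R.

Definition initial_form (K : fieldType) (R : realType) (r n : nat)
    (M : 'M[R]_(r, n)) (f : {mpoly K[r * n]}) : {mpoly K[r * n]} :=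
  \sum_(m <- msupp f | all (fun m' => mweight M m <= mweight M m') (msupp f))
     f@_m *: 'X_[m].

Definition initial_algebra (K : fieldType) (R : realType) (r n : nat)
    (M : 'M[R]_(r, n)) (A : {mpoly K[r * n]} -> Prop) :
  {mpoly K[r * n]} -> Prop :=
  subalgebra_gen (fun p => exists2 f, A f & p = initial_form M f).

Definition plucker_sagbi (K : fieldType) (R : realType) (r n : nat)
    (M : 'M[R]_(r, n)) : Prop :=
  forall p : {mpoly K[r * n]},
    initial_algebra M (@plucker_algebra K r n) p <->
    subalgebra_gen
      (fun q => exists I : rsubset r n, q = initial_form M (plucker_det K I)) p.

(* Row i of x_I is matched with the column of I in position [L I i]. *)
Definition matching_field (r n : nat) : Type := rsubset r n -> 'S_r.

Definition induces_matching_field (K : fieldType) (R : realType) (r n : nat)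
    (M : 'M[R]_(r, n)) (L : matching_field r n) : Prop :=
  forall I : rsubset r n,
    initial_form M (plucker_det K I) =
    (-1) ^+ (L I : bool) *: \prod_(i < r) varmx K r n i (rsubset_col I (L I i)).

Definition toric_degeneration (K : fieldType) (R : realType) (r n : nat)
    (M : 'M[R]_(r, n)) (L : matching_field r n) : Prop :=
  induces_matching_field K M L /\ plucker_sagbi K M.

Definition alpha (a : seq nat) (k : nat) : nat := sumn (take k a).

(* The least k such that j <= alpha_k, i.e. the 1-based index k of the block
   I_k containing the 1-based column j. *)
Definition block_index (a : seq nat) (j : nat) : nat :=
  find (fun k => j <= alpha a k)%N (iota 0 (size a).+1).

Lemma block_indexP (a : seq nat) (j : nat) :
  (0 < j <= sumn a)%N ->
  [/\ (0 < block_index a j <= size a)%N,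
      (alpha a (block_index a j).-1 < j)%N
    & (j <= alpha a (block_index a j))%N].
Proof.
case/andP=> j_gt0 le_ja; rewrite /block_index.
set P := fun k => _; set s := iota _ _.
have hasP : has P s.
  apply/hasP; exists (size a); first by rewrite mem_iota /= add0n.
  by rewrite /P /alpha take_size.
have lt_f : (find P s < (size a).+1)%N by rewrite -[X in (_ < X)%N](size_iota 0) -has_find.
have Pf : P (find P s) by have := nth_find 0%N hasP; rewrite nth_iota.
have f_gt0 : (0 < find P s)%N.
  by rewrite lt0n; apply: contraTneq Pf => ->; rewrite /P /alpha take0 -ltnNge.
split=> //; first by rewrite f_gt0 -ltnS.
rewrite ltnNge; apply/negP => Pf1.
have lt_f1 : ((find P s).-1 < find P s)%N by rewrite prednK.
by have := before_find 0%N lt_f1; rewrite nth_iota ?(ltn_trans lt_f1) // /P Pf1.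
Qed.

(* Rows i and columns j are numbered from 1 here; the natural-number
   subtractions do not truncate for i, j in range. *)
Definition block_weight (R : realType) (n : nat) (a : seq nat) (l : nat)
    (beta : R) (i j : nat) : R :=
  if i == 1%N then 0
  else if i != l then (n - j + 1)%:R * beta ^+ (i - 2)
  else let k := block_index a j in
       (alpha a k.-1 + alpha a k + 1 - j)%:R * beta ^+ (l - 2).

Definition block_weight_mx (R : realType) (r n : nat) (a : seq nat) (l : nat)
    (beta : R) : 'M[R]_(r, n) :=
  \matrix_(i, j) block_weight n a l beta i.+1 j.+1.

(* Main.v *)
(* Products of d maximal minors span the degree d part A_d of the Plücker algebra, and for
   a weight picking one term of every minor the products with distinct initial terms are
   independent.  So it suffices to show that the target field has at least dim A_d distinct
   sums of d of its monomials: then products of minors with these initial terms span A_d and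
   every initial form is a combination of their initial terms.
   For the upper bound, Laplace expansion along two rows writes an element of A_d as a
   combination of monomials times products of 2-minors; straightening these shows that its
   initial monomial for the antidiagonal weight has the two rows interlaced.  Thus dim A_d is
   at most the number of contents of semistandard arrays, that is of sums of d monomials of a
   diagonal matching field, for any order of the rows.
   From the diagonal field with rows ordered 3 < 1 < 2 < 4 < ... one reaches the target field
   by crossing two walls, each concerning two rows only.  The products of 2-minors in the two
   rows that satisfy suitable blockwise bounds are independent by their initial terms on one
   side of the wall and straighten to one product for each initial term on the other side,
   so that the number of contents does not decrease.  The bounds are those for which Hall's
   theorem reassembles a content into columns of the matching field. *)
Require Import Defs.
From mathcomp Require Import all_boot all_order all_fingroup all_algebra.
From mathcomp Require Import reals.
From mathcomp Require Import mpoly.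
From mathcomp Require Import ring lra zify.
From Stdlib Require Import Classical ClassicalEpsilon.

Set Implicit Arguments.
Unset Strict Implicit.
Unset Printing Implicit Defensive.

Import Order.TTheory GRing.Theory Num.Theory.
Local Open Scope ring_scope.

(** * Spans and initial terms *)

Inductive spanned (K : fieldType) (V : lmodType K) (G : V -> Prop) : V -> Prop :=
| spanned0 : spanned G 0
| spannedS c g v : G g -> spanned G v -> spanned G (c *: g + v).

Section Span.
Variables (K : fieldType) (V : lmodType K).
Implicit Types (G : V -> Prop) (v w : V).

Lemma spanned_gen G g : G g -> spanned G g.
Proof. by move=> Gg; rewrite -[g]scale1r -[_ *: _]addr0; apply: spannedS => //; apply: spanned0. Qed.

Lemma spannedD G v w : spanned G v -> spanned G w -> spanned G (v + w).
Proof.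
move=> sv sw; elim: sv => [|c g u Gg _ IH]; first by rewrite add0r.
by rewrite -addrA; apply: spannedS.
Qed.

Lemma spannedZ G c v : spanned G v -> spanned G (c *: v).
Proof.
elim=> [|k g u Gg _ IH]; first by rewrite scaler0; apply: spanned0.
by rewrite scalerDr scalerA; apply: spannedS.
Qed.

Lemma spannedN G v : spanned G v -> spanned G (- v).
Proof. by move=> sv; rewrite -scaleN1r; apply: spannedZ. Qed.

Lemma spannedB G v w : spanned G v -> spanned G w -> spanned G (v - w).
Proof. by move=> sv sw; apply: spannedD => //; apply: spannedN. Qed.

Lemma spanned_sum G (I : Type) (s : seq I) (P : pred I) (F : I -> V) :
  (forall i, P i -> spanned G (F i)) -> spanned G (\sum_(i <- s | P i) F i).
Proof. by move=> sF; apply: (big_ind (spanned G)) => //; [apply: spanned0 | move=> *; apply: spannedD]. Qed.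

Lemma spanned_trans G G' v :
  (forall g, G g -> spanned G' g) -> spanned G v -> spanned G' v.
Proof.
move=> GG'; elim=> [|c g u Gg _ IH]; first exact: spanned0.
by apply: spannedD => //; apply: spannedZ; apply: GG'.
Qed.

Lemma spanned_sub G G' v : (forall g, G g -> G' g) -> spanned G v -> spanned G' v.
Proof. by move=> GG'; apply: spanned_trans => g /GG'; apply: spanned_gen. Qed.

Definition independent (a : nat) (g : 'I_a -> V) :=
  forall c : 'rV[K]_a, \sum_i c 0 i *: g i = 0 -> c = 0.

Lemma independent_le (a b : nat) (g : 'I_a -> V) (v : 'I_b -> V) (A : 'M[K]_(a, b)) :
  independent g -> (forall i, g i = \sum_j A i j *: v j) -> (a <= b)%N.
Proof.
move=> indg gE; rewrite leqNgt; apply/negP => lt_ba.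
have kerN0 : kermx A != 0.
  rewrite kermx_eq0 /row_free neq_ltn; apply/orP; left.
  exact: leq_ltn_trans (rank_leq_col A) lt_ba.
have [i rowN0] : exists i, row i (kermx A) != 0.
  by apply/existsP; rewrite -negb_forall; apply: contraNN kerN0 => /forallP H;
     apply/eqP/row_matrixP => i; rewrite row0; apply/eqP.
case/eqP: rowN0; apply: indg.
have /sub_kermxP kA0 : (row i (kermx A) <= kermx A)%MS by apply: row_sub.
transitivity (\sum_j (row i (kermx A) *m A) 0 j *: v j); last first.
  by rewrite kA0 big1 // => j _; rewrite mxE scale0r.
under eq_bigr => j _ do rewrite gE scaler_sumr.
rewrite exchange_big; apply: eq_bigr => j _.
by rewrite mxE scaler_suml; apply: eq_bigr => k _; rewrite scalerA.
Qed.

Lemma spanned_coef (b : nat) (v : 'I_b -> V) w :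
  spanned (fun g => exists j, g = v j) w ->
  exists c : 'rV[K]_b, w = \sum_j c 0 j *: v j.
Proof.
elim=> [|k g u [j ->] _ [c ->]].
  by exists 0; rewrite big1 // => j _; rewrite mxE scale0r.
exists (k *: delta_mx 0 j + c).
under [RHS]eq_bigr => i _ do rewrite !mxE scalerDl.
rewrite big_split /=; congr (_ + _).
rewrite (bigD1 j) //= !eqxx mulr1 big1 ?addr0 // => i /negbTE->.
by rewrite mulr0 scale0r.
Qed.

Lemma independent_spanned_le (a b : nat) (g : 'I_a -> V) (v : 'I_b -> V) :
  independent g -> (forall i, spanned (fun w => exists j, w = v j) (g i)) ->
  (a <= b)%N.
Proof.
move=> indg spg; have [f fE] := fin_all_exists (fun i => spanned_coef (spg i)).
apply: (independent_le (A := \matrix_(i, j) f i 0 j) indg) => i.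
by rewrite fE; apply: eq_bigr => j _; rewrite mxE.
Qed.

Lemma straighten (T : Type) (L : eqType) (good : T -> Prop) (P : T -> V)
    (lab : T -> L) (om : L -> nat) (rep : T -> Prop) :
  (forall i j, good i -> good j -> lab i = lab j ->
     spanned (fun v => exists k, [/\ good k, (om (lab k) < om (lab i))%N & v = P k])
       (P i - P j)) ->
  (forall i, good i -> exists j, [/\ rep j, good j & lab j = lab i]) ->
  forall i, good i -> spanned (fun v => exists2 j, rep j & v = P j) (P i).
Proof.
move=> H R i; have [m] := ubnP (om (lab i)); elim: m i => // m IH i le_m gi.
have [j [rj gj lj]] := R i gi; rewrite -[P i](subrK (P j)); apply: spannedD.
  apply: spanned_trans (H i j gi gj (esym lj)) => _ [k [gk lt_k ->]].
  by apply: IH => //; apply: leq_trans lt_k _.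
by apply: spanned_gen; exists j.
Qed.

End Span.

Lemma mxvec_index_inj (r n : nat) (i i' : 'I_r) (j j' : 'I_n) :
  (mxvec_index i j == mxvec_index i' j') = (i == i') && (j == j').
Proof.
by rewrite /mxvec_index (inj_eq (@cast_ord_inj _ _ _)) (inj_eq enum_rank_inj) xpair_eqE.
Qed.

Section Lead.
Variables (K : fieldType) (R : realType) (r n : nat) (M : 'M[R]_(r, n)).
Local Notation mon := 'X_{1..r * n}.
Local Notation poly := {mpoly K[r * n]}.
Local Notation w := (Defs.mweight M).
Implicit Types (u v m : mon) (p q : poly) (c : K).

Lemma mweight0 : w 0%MM = 0.
Proof. by rewrite /Defs.mweight big1 // => i _; rewrite big1 // => j _; rewrite mnm0E mulr0. Qed.

Lemma mweightD u v : w (u + v)%MM = w u + w v.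
Proof.
rewrite /Defs.mweight -big_split; apply: eq_bigr => i _ /=.
by rewrite -big_split; apply: eq_bigr => j _ /=; rewrite mnmDE natrD mulrDr.
Qed.

Lemma mweightU i j : w U_(mxvec_index i j)%MM = M i j.
Proof.
rewrite /Defs.mweight (bigD1 i) //= (bigD1 j) //= mnm1E eqxx mulr1 !big1 ?addr0 // => k nk.
  by rewrite big1 // => l _; rewrite mnm1E mxvec_index_inj eq_sym (negbTE nk) mulr0.
by rewrite mnm1E mxvec_index_inj eqxx eq_sym (negbTE nk) mulr0.
Qed.

Lemma mweight_sum (I : Type) (s : seq I) (F : I -> mon) :
  w (\sum_(x <- s) F x)%MM = \sum_(x <- s) w (F x).
Proof. by elim/big_rec2: _ => [|x a b _ <-]; rewrite ?mweight0 ?mweightD. Qed.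

Definition heavier (a : R) (p : poly) := forall m, m \in msupp p -> a < w m.

Definition has_lead p u c := exists2 p', p = c *: 'X_[u] + p' & heavier (w u) p'.

Lemma heavierD a p q : heavier a p -> heavier a q -> heavier a (p + q).
Proof. by move=> hp hq m /msuppD_le; rewrite mem_cat => /orP[/hp|/hq]. Qed.

Lemma heavierM a b p q :
  heavier a p -> (forall m, m \in msupp q -> b <= w m) -> heavier (a + b) (p * q).
Proof.
move=> hp hq m /msuppM_le /allpairsP[[m1 m2] /= [/hp h1 /hq h2 ->]].
by rewrite mweightD ltr_leD.
Qed.

Lemma has_lead_ge p u c : has_lead p u c -> forall m, m \in msupp p -> w u <= w m.
Proof.
move=> [p' -> hp'] m /msuppD_le; rewrite mem_cat => /orP[/msuppZ_le|/hp'/ltW //].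
by rewrite msuppX inE => /eqP->.
Qed.

Lemma has_lead_coef p u c : has_lead p u c -> p@_u = c.
Proof.
move=> [p' -> hp']; rewrite mcoeffD mcoeffZ mcoeffX eqxx mulr1.
rewrite (memN_msupp_eq0 (p := p')) ?addr0 //.
by apply/negP => /hp'; rewrite ltxx.
Qed.

Lemma has_lead_lt p u c m : has_lead p u c -> m \in msupp p -> m != u -> w u < w m.
Proof.
move=> [p' -> hp'] /msuppD_le; rewrite mem_cat => /orP[/msuppZ_le|/hp' //].
by rewrite msuppX inE => ->.
Qed.

Lemma has_leadX u : has_lead 'X_[u] u 1.
Proof. by exists 0; [rewrite scale1r addr0 | move=> m; rewrite msupp0]. Qed.

Lemma has_leadM p q u v c d :
  has_lead p u c -> has_lead q v d -> has_lead (p * q) (u + v) (c * d).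
Proof.
move=> lp lq; have geq := has_lead_ge lq; case: lp lq => p' -> hp' [q' qE hq'].
exists (p' * q + (c *: 'X_[u]) * q'); last first.
  rewrite mweightD; apply: heavierD; first exact: heavierM.
  rewrite mulrC addrC; apply: heavierM => // m /msuppZ_le.
  by rewrite msuppX inE => /eqP->.
rewrite mulrDl {1}qE mulrDr -scalerAl -scalerAr scalerA -mpolyXD.
by rewrite -!addrA; congr (_ + _); rewrite addrC.
Qed.

Lemma has_lead_prod (I : Type) (s : seq I) (F : I -> poly) (U : I -> mon) (C : I -> K) :
  (forall x, has_lead (F x) (U x) (C x)) ->
  has_lead (\prod_(x <- s) F x) (\sum_(x <- s) U x)%MM (\prod_(x <- s) C x).
Proof.
move=> H; elim: s => [|x s IH]; last by rewrite !big_cons; apply: has_leadM.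
by rewrite !big_nil -mpolyX0; apply: has_leadX.
Qed.

Lemma has_lead_prod_in (I : eqType) (s : seq I) (F : I -> poly) (U : I -> mon) (C : I -> K) :
  {in s, forall x, has_lead (F x) (U x) (C x)} ->
  has_lead (\prod_(x <- s) F x) (\sum_(x <- s) U x)%MM (\prod_(x <- s) C x).
Proof.
elim: s => [|x s IH] H; first by rewrite !big_nil -mpolyX0; apply: has_leadX.
rewrite !big_cons; apply: has_leadM; first by apply: H; rewrite mem_head.
by apply: IH => y ys; apply: H; rewrite inE ys orbT.
Qed.

Lemma initial_form_lead p u c : c != 0 -> has_lead p u c -> initial_form M p = c *: 'X_[u].
Proof.
move=> c0 lp; have pu := has_lead_coef lp.
have usupp : u \in msupp p by rewrite mcoeff_msupp pu.
rewrite /initial_form big_mkcond /= (bigD1_seq u) ?msupp_uniq //=.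
have -> : all (fun m' => w u <= w m') (msupp p) by apply/allP => m; apply: has_lead_ge lp _.
rewrite pu big_seq_cond big1 ?addr0 // => m /andP[ms nm].
case: allP => // /(_ u usupp); rewrite leNgt.
by rewrite (has_lead_lt lp ms nm).
Qed.

Lemma independent_leads (a : nat) (g : 'I_a -> poly) (u : 'I_a -> mon) (c : 'I_a -> K) :
  injective u -> (forall i, c i != 0) -> (forall i, has_lead (g i) (u i) (c i)) ->
  independent g.
Proof.
move=> uI c0 lg k sum0; apply/rowP => i; rewrite mxE; apply/eqP/negPn/negP => ki.
case: (@arg_minP _ _ _ i (fun i => k 0 i != 0) (fun i => w (u i)) ki) => i0 ki0 min_i0.
have /(congr1 (mcoeff (u i0))) := sum0; rewrite raddf_sum mcoeff0 /= (bigD1 i0) //=.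
rewrite big1 ?addr0 => [|j nj].
  by rewrite mcoeffZ (has_lead_coef (lg i0)) => /eqP; rewrite mulf_eq0 (negbTE ki0) (negbTE (c0 _)).
rewrite mcoeffZ; case: (eqVneq (k 0 j) 0) => [->|kj]; first by rewrite mul0r.
rewrite [X in _ * X]memN_msupp_eq0 ?mulr0 //; apply/negP => sj.
have := has_lead_lt (lg j) sj; rewrite (inj_eq uI) eq_sym nj => /(_ isT).
by rewrite ltNge min_i0.
Qed.

End Lead.

(** * Words with matched letters *)

Section Height.
Variable kd : nat -> bool.
Implicit Types (m : nat -> nat) (i k : nat).

Fixpoint height m i : int :=
  if i is k.+1 then height m k + (if kd k then (m k)%:Z else - (m k)%:Z) else 0.

Lemma height_eq m m' i : (forall k, (k < i)%N -> m k = m' k) -> height m i = height m' i.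
Proof.
elim: i => //= i IH H; rewrite IH => [|k lt_k]; last by apply: H; lia.
by rewrite (H i).
Qed.

Lemma height_le m m' j i : (j <= i)%N -> (height m j <= height m' j)%R ->
  (forall k, (j <= k < i)%N -> if kd k then (m k <= m' k)%N else (m' k <= m k)%N) ->
  height m i <= height m' i.
Proof.
move=> le_ji h0; elim: i le_ji => [|i IH] le_ji H.
  by have -> : 0%N = j by lia.
case: (eqVneq j i.+1) => [<- //|nj].
have {IH} : height m i <= height m' i by apply: IH => [|k hk]; [lia | apply: H; lia].
have /= := H i; case: (kd i) => H'; have := H' _; lia.
Qed.

Definition mark_add m (q t : nat) k := (m k + (k == q) + (k == t))%N.
Definition mark_sub m (q t : nat) k := (m k - (k == q) - (k == t))%N.

Lemma height_add m q t i : kd q -> ~~ kd t -> (q < t)%N ->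
  height (mark_add m q t) i = height m i + (q < i <= t)%N%:Z.
Proof.
move=> kq kt lt_qt; elim: i => [|i IH] /=; first by lia.
rewrite IH /mark_add; case: (eqVneq i q) => [->|nq]; first by rewrite kq; lia.
case: (eqVneq i t) => [->|nt]; first by rewrite (negbTE kt); lia.
by case: (kd i); lia.
Qed.

Lemma height_sub m q t i : kd q -> ~~ kd t -> (q < t)%N -> (0 < m q)%N -> (0 < m t)%N ->
  height (mark_sub m q t) i = height m i - (q < i <= t)%N%:Z.
Proof.
move=> kq kt lt_qt mq mt; elim: i => [|i IH] /=; first by lia.
rewrite IH /mark_sub; case: (eqVneq i q) => [->|nq]; first by rewrite kq; lia.
case: (eqVneq i t) => [->|nt]; first by rewrite (negbTE kt); lia.
by case: (kd i); lia.
Qed.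

End Height.

Lemma first_such (P : pred nat) k : P k ->
  exists j, [/\ P j, (j <= k)%N & forall i, (i < j)%N -> ~~ P i].
Proof.
move=> Pk; have exP : exists i, P i by exists k.
exists (ex_minn exP); case: ex_minnP => j Pj minj; split=> // [|i lt_i]; first exact: minj.
by apply/negP => /minj; lia.
Qed.

Lemma last_such (P : pred nat) p t : P p -> (p < t)%N ->
  exists q, [/\ P q, (p <= q < t)%N & forall i, (q < i < t)%N -> ~~ P i].
Proof.
move=> Pp lt_pt; pose Q i := P (t.-1 - i)%N.
have [|j [Qj le_j minj]] := @first_such Q (t.-1 - p)%N.
  by rewrite /Q (_ : (_ - _)%N = p) //; lia.
exists (t.-1 - j)%N; split=> //; first by lia.
move=> i hi; have := minj (t.-1 - i)%N; rewrite /Q (_ : (t.-1 - (t.-1 - i))%N = i); last lia.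
by apply; lia.
Qed.

Section Marks.
(* Keys [k < N] are the letters of a word, [kd k] telling opening letters from
   closing ones; [a k] is the multiplicity of the key and [m k <= a k] the number
   of its copies that are matched. *)
Variables (N : nat) (kd bd : nat -> bool) (a : nat -> nat).
Hypotheses (bd0 : bd 0) (bdN : bd N).
Implicit Types (m : nat -> nat) (i k : nat).

Local Notation height := (height kd).

Definition valid m :=
  [/\ forall k, (m k <= a k)%N, forall i, (i <= N)%N -> 0 <= height m i
    & forall i, (i <= N)%N -> bd i -> height m i = 0].

Definition tight m := forall k, (k < N)%N -> (m k < a k)%N ->
  if kd k then height m k = 0 else height m k.+1 = 0.

Lemma valid_add m q t : kd q -> ~~ kd t -> (q < t)%N ->
  (m q < a q)%N -> (m t < a t)%N -> (forall i, (q < i <= t)%N -> ~~ bd i) ->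
  valid m -> valid (mark_add m q t).
Proof.
move=> kq kt lt_qt mq mt nbd [le_ma h0 hb]; split=> [k|i le_i|i le_i bi].
- have := le_ma k; rewrite /mark_add; case: (eqVneq k q) => [->|_]; case: (eqVneq _ t) => [E|_]; try lia.
  by rewrite E in mt *; lia.
- by rewrite height_add //; have := h0 i le_i; lia.
- rewrite height_add // hb //; case: (boolP (q < i <= t)%N) => // /nbd.
  by rewrite bi.
Qed.

Lemma tight_add m q t : kd q -> ~~ kd t -> (q < t)%N ->
  (m q < a q)%N -> (m t < a t)%N -> (forall k, (q < k < t)%N -> m k = a k) ->
  tight m -> tight (mark_add m q t).
Proof.
move=> kq kt lt_qt mq mt full tm k lt_k lt_m.
have lt_mk : (m k < a k)%N by move: lt_m; rewrite /mark_add; lia.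
have nk : ~~ (q < k < t)%N by apply/negP => /full; lia.
have := tm k lt_k lt_mk; rewrite !height_add //; case: ifP => kk -> .
  have nt : k != t by apply: contraNneq kt => <-.
  by lia.
have nq : k != q by apply: contraFneq kk => ->.
by lia.
Qed.

Lemma valid_sub m q t : kd q -> ~~ kd t -> (q < t)%N -> (0 < m q)%N -> (0 < m t)%N ->
  (forall i, (q < i <= t)%N -> 0 < height m i) -> valid m -> valid (mark_sub m q t).
Proof.
move=> kq kt lt_qt mq mt hpos [le_ma h0 hb]; split=> [k|i le_i|i le_i bi].
- by have := le_ma k; rewrite /mark_sub; lia.
- rewrite height_sub //; have := h0 i le_i; case: (boolP (q < i <= t)%N) => [/hpos|]; lia.
- rewrite height_sub // hb //; case: (boolP (q < i <= t)%N) => // /hpos.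
  by rewrite hb.
Qed.

Lemma tight_full m k : valid m -> tight m -> (k < N)%N ->
  0 < (if kd k then height m k else height m k.+1) -> m k = a k.
Proof.
move=> [le_ma _ _] tm lt_k; have := tm k lt_k; have := le_ma k.
by case: (kd k) => H1 H2 H3; case: (ltnP (m k) (a k)) => [/H2|]; lia.
Qed.

Lemma tight_sub m q t : kd q -> ~~ kd t -> (q < t < N)%N -> (0 < m q)%N -> (0 < m t)%N ->
  height m q = 0 -> height m t.+1 = 0 ->
  (forall i, (q < i <= t)%N -> 0 < height m i) -> valid m -> tight m ->
  tight (mark_sub m q t).
Proof.
move=> kq kt /andP[lt_qt lt_tN] mq mt hq ht hpos vm tm k lt_k lt_m.
rewrite !height_sub //; case: (eqVneq k q) => [->|nq]; first by rewrite kq hq; lia.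
case: (eqVneq k t) => [->|nt]; first by rewrite (negbTE kt) ht; lia.
have lt_mk : (m k < a k)%N by move: lt_m; rewrite /mark_sub; lia.
have := tm k lt_k lt_mk; case: ifP => kk hk; rewrite hk.
  by case: (boolP (q < k <= t)%N) => // /hpos; rewrite hk.
by case: (boolP (q < k.+1 <= t)%N) => // /hpos; rewrite hk.
Qed.

Lemma missing_arc m m' p : valid m -> valid m' -> tight m -> tight m' ->
  (p < N)%N -> (forall k, (k < p)%N -> m k = m' k) -> (m p < m' p)%N ->
  exists q t, [/\ kd q, ~~ kd t & (p <= q < t)%N] /\
    [/\ (t < N)%N, (m q < m' q)%N, (m t < m' t)%N,
        forall k, (q < k < t)%N -> m k = a k
      & forall i, (p < i <= t)%N -> [/\ height m i + 1 <= height m' i, ~~ bd i &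
          (i < t)%N -> m' i = a i] ].
Proof.
move=> vm vm' tm tm' lt_p eq_p lt_mp.
have [le_ma h0 hb] := vm; have [le_ma' h0' hb'] := vm'.
have hp := height_eq kd eq_p.
have mp_a : (m p < a p)%N by have := le_ma' p; lia.
have := tm p lt_p mp_a; case: ifP => kp hp0; last first.
  by have := h0' p.+1 lt_p; move: hp0; rewrite /= kp -hp; lia.
have [|r [/andP[/eqP hr le_pr] le_rN minr]] :=
    @first_such (fun r => (height m' r.+1 == 0) && (p <= r)%N) N.-1.
  by rewrite prednK ?hb' //; [rewrite eqxx; lia | lia].
have hpos i : (p < i <= r)%N -> 0 < height m' i.
  move=> hi; have := minr i.-1; have := h0' i; rewrite prednK; last lia.
  case: (eqVneq (height m' i) 0) => [_ _|? ? _]; last by lia.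
  by move=> H; have := H _; rewrite /=; lia.
have lt_pr : (p < r)%N.
  rewrite ltn_neqAle le_pr andbT; apply/eqP => eq_pr.
  by move: hr; rewrite -eq_pr /= kp -hp hp0; lia.
have lt_rN : (r < N)%N by lia.
have kr : ~~ kd r.
  apply/negP => kr; have := hpos r; move: hr; rewrite /= kr; lia.
have full' k : (p < k < r)%N -> m' k = a k.
  move=> hk; apply: (tight_full vm' tm'); first by lia.
  by case: (kd k); apply: hpos; lia.
have [t [/and3P[kt pt lt_t] le_t mint]] :
    exists t, [/\ [&& ~~ kd t, (p < t)%N & (m t < m' t)%N], (t <= r)%N &
      forall i, (i < t)%N -> ~~ [&& ~~ kd i, (p < i)%N & (m i < m' i)%N] ].
  case: (boolP (has (fun t => [&& ~~ kd t, (p < t)%N & (m t < m' t)%N]) (iota 0 r.+1))).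
    move=> /hasP[t]; rewrite mem_iota => ht Pt.
    have [j [Pj le_j minj]] :=
      @first_such (fun t => [&& ~~ kd t, (p < t)%N & (m t < m' t)%N]) t Pt.
    by exists j; split=> //; lia.
  move/hasPn => H; have : height m r.+1 + 1 <= height m' r.+1.
    pose m1 k := (m k + (k == p))%N.
    have h1 i : height m1 i = height m i + (p < i)%N%:Z.
      elim: i => //= i ->; rewrite /m1; case: eqP => [->|]; first by rewrite kp; lia.
      by case: (kd i); lia.
    have := @height_le kd m1 m' p r.+1; rewrite !h1 ltnn (_ : (p < r.+1)%N); last lia.
    apply; [lia | lia |] => k hk; rewrite /m1.
    case: (eqVneq k p) => [->|nk]; first by rewrite kp; lia.
    have := H k; rewrite mem_iota; case: ifP => kk Hk; last by have := Hk _; lia.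
    have nkr : k != r by apply: contraNneq kr => <-.
    by have := full' k; have := le_ma k; lia.
  by have := h0 r.+1 lt_rN; lia.
have [|q [/andP[kq mq] hq maxq]] := @last_such (fun q => kd q && (m q < a q)%N) p t _ pt.
  by rewrite kp.
have hcmp i : (p < i <= t)%N -> height m i + 1 <= height m' i.
  move=> hi; pose m1 k := (m k + (k == p))%N.
  have h1 j : height m1 j = height m j + (p < j)%N%:Z.
    elim: j => //= j ->; rewrite /m1; case: eqP => [->|]; first by rewrite kp; lia.
    by case: (kd j); lia.
  have := @height_le kd m1 m' p i; rewrite !h1 ltnn (_ : (p < i)%N); last lia.
  apply; [lia | lia |] => k hk; rewrite /m1.
  case: (eqVneq k p) => [->|nk]; first by rewrite kp; lia.
  have := mint k; case: ifP => kk Hk; last by have := Hk _; rewrite /=; lia.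
  by have := full' k; have := le_ma k; lia.
exists q, t; split; first by split.
have mqq : (m q < m' q)%N.
  case: (eqVneq q p) => [->//|nq]; rewrite full'; lia.
split=> //; first by lia.
  move=> k hk; have := maxq k hk; have := le_ma k.
  case: (boolP (kd k)) => kk /=; first by lia.
  have := mint k; rewrite kk /= => H; have := H _; have := full' k; lia.
move=> i hi; split; [exact: hcmp | | by move=> lt_it; apply: full'; lia].
apply/negP => bi; have := hb' i; rewrite bi => H; have := hpos i; rewrite H //; lia.
Qed.

Lemma excess_arc m m' p2 : valid m -> valid m' -> tight m -> tight m' ->
  (p2 < N)%N -> (m' p2 < m p2)%N -> (forall k, (k < p2)%N -> (m k <= m' k)%N) ->
  kd p2 /\ height m p2 = 0 /\
  exists r2, [/\ ~~ kd r2, (p2 < r2 < N)%N, (0 < m r2)%N, height m r2.+1 = 0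
    & forall i, (p2 < i <= r2)%N -> 0 < height m i].
Proof.
move=> vm vm' tm tm' lt_p2 lt_m le_m.
have [le_ma h0 hb] := vm; have [le_ma' h0' hb'] := vm'.
have m'a : (m' p2 < a p2)%N by have := le_ma p2; lia.
have cmp : 0 < height m p2 -> height m p2 <= height m' p2.
  move=> hpos; have p20 : (0 < p2)%N by case: (p2) hpos => //=; lia.
  have [s [/eqP hs lt_s maxs]] := @last_such (fun i => height m i == 0) 0 p2.+1 isT isT.
  have lt_sp : (s < p2)%N.
    by rewrite ltn_neqAle; apply/andP; split; [apply/eqP => E; move: hpos; rewrite -E; lia | lia].
  apply: (@height_le kd m m' s); [lia | by rewrite hs; apply: h0'; lia |] => k hk.
  case: ifP => kk; first by apply: le_m; lia.
  rewrite (tight_full vm tm (k := k)) //; first by lia.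
  by rewrite kk; have := maxs k.+1; have := h0 k.+1; lia.
have := tm' p2 lt_p2 m'a; case: ifP => k2 h'; last first.
  have := h0 p2.+1 lt_p2; move: h'; rewrite /= k2 => h' hh.
  by have := cmp; lia.
have hp2 : height m p2 = 0 by have := h0 p2; lia.
split=> //; split=> //.
have [|r [/andP[/eqP hr le_pr] le_rN minr]] :=
    @first_such (fun r => (height m r.+1 == 0) && (p2 <= r)%N) N.-1.
  by rewrite prednK ?hb //; [rewrite eqxx; lia | lia].
have hpos i : (p2 < i <= r)%N -> 0 < height m i.
  move=> hi; have := minr i.-1; have := h0 i; rewrite prednK; last lia.
  case: (eqVneq (height m i) 0) => [_ _|? ? _]; last by lia.
  by move=> H; have := H _; rewrite /=; lia.
have lt_pr : (p2 < r)%N.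
  rewrite ltn_neqAle le_pr andbT; apply/eqP => eq_pr.
  by move: hr; rewrite -eq_pr /= k2 hp2; lia.
have := hpos r; move: hr; rewrite /=; case: ifP => kr hr hr1; first by lia.
by exists r; split; rewrite ?kr //=; lia.
Qed.

End Marks.

(** * Straightening two rows *)

Ltac blia := repeat (match goal with
  | |- context [nat_of_bool ?b] => generalize (nat_of_bool b) end); clear; lia.

Ltac natvars := repeat (match goal with
  | |- context [nat_of_bool ?b] => generalize (nat_of_bool b)
  | |- context [count ?p ?l] => generalize (count p l) end); clear; intros.

(* Two rows [u < v] of a product of minors: an arc [(q, t)] stands for the 2-minor on
   the columns [q < t], a single letter of [us] or [vs] for a variable of row [u] or [v]. *)
Record config (n : nat) := Config
  { arcs : seq ('I_n * 'I_n); us : seq 'I_n; vs : seq 'I_n }.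

Section TwoRows.
Variables (n : nat) (blk : nat -> nat).
Hypothesis blk_mono : forall i j : nat, (i <= j)%N -> (blk i <= blk j)%N.
Implicit Types (A C : seq ('I_n * 'I_n)) (s l : seq 'I_n) (M : config n).

Definition qs M := unzip1 (arcs M).
Definition ts M := unzip2 (arcs M).

Definition arc_ok (a : 'I_n * 'I_n) := (a.1 < a.2)%N && (blk a.1 == blk a.2).

Definition upto (c : nat) (j : 'I_n) : bool := (blk j == blk c) && (j <= c)%N.
Definition inblk (c : nat) (j : 'I_n) : bool := blk j == blk c.

Lemma upto_mono c (i j : 'I_n) :
  (i <= j)%N -> blk i = blk j -> (upto c j <= upto c i)%N.
Proof. by rewrite /upto => le_ij ->; case: eqP => //= _; case: leqP => //; lia. Qed.

Lemma inblk_eq c (i j : 'I_n) : blk i = blk j -> inblk c i = inblk c j.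
Proof. by rewrite /inblk => ->. Qed.

Lemma blk_between (i j k : nat) : (i <= j <= k)%N -> blk i = blk k -> blk j = blk i.
Proof. by move=> /andP[/blk_mono h1 /blk_mono h2] h; lia. Qed.

(* [e], [b], [lo], [up] bound the cumulative counts of left ends, right ends, and
   of the two possible contents of the first row; [kap] and [nu] fix the total
   content and the number of first-row letters in each block. *)
Variables (kap : pred 'I_n -> nat) (nu e b lo up : nat -> nat).

Definition good M :=
  [/\ all arc_ok (arcs M),
      forall p : pred 'I_n,
        (count p (us M) + count p (vs M) + count p (qs M) + count p (ts M) = kap p)%N
    & forall c, (c < n)%N ->
      [/\ (count (upto c) (qs M) <= e c)%N, (b c <= count (upto c) (ts M))%N,
          (lo c <= count (upto c) (us M) + count (upto c) (ts M))%N,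
          (count (upto c) (us M) + count (upto c) (qs M) <= up c)%N
        & (count (inblk c) (us M) + count (inblk c) (qs M) = nu c)%N]].

Lemma good_mono M M' :
  all arc_ok (arcs M') ->
  (forall p : pred 'I_n,
    (count p (us M) + count p (vs M) + count p (qs M) + count p (ts M) =
     count p (us M') + count p (vs M') + count p (qs M') + count p (ts M'))%N) ->
  (forall c, [/\ (count (upto c) (qs M') <= count (upto c) (qs M))%N,
     (count (upto c) (ts M) <= count (upto c) (ts M'))%N,
     (count (upto c) (us M) + count (upto c) (ts M) <=
      count (upto c) (us M') + count (upto c) (ts M'))%N,
     (count (upto c) (us M') + count (upto c) (qs M') <=
      count (upto c) (us M) + count (upto c) (qs M))%N
     & (count (inblk c) (us M') + count (inblk c) (qs M') =
        count (inblk c) (us M) + count (inblk c) (qs M))%N]) ->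
  good M -> good M'.
Proof.
move=> ok' tot H [_ ktot G]; split=> // [p|c lt_cn]; first by rewrite -tot.
by have [? ? ? ? ?] := G c lt_cn; have [? ? ? ? ?] := H c; split; lia.
Qed.

Definition vsum M := (\sum_(j <- vs M) (j : nat) + \sum_(j <- ts M) (j : nat))%N.

Definition same_content M M' :=
  perm_eq (us M ++ qs M) (us M' ++ qs M') /\ perm_eq (vs M ++ ts M) (vs M' ++ ts M').

Lemma vsum_cat M : vsum M = (\sum_(j <- vs M ++ ts M) (j : nat))%N.
Proof. by rewrite big_cat. Qed.

Lemma same_content_vsum M M' : same_content M M' -> vsum M = vsum M'.
Proof. by case=> _ h; rewrite !vsum_cat (perm_big _ h). Qed.

Lemma same_content_trans M1 M2 M3 :
  same_content M1 M2 -> same_content M2 M3 -> same_content M1 M3.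
Proof.
by case=> h1 h2 [h3 h4]; split; [apply: perm_trans h1 h3 | apply: perm_trans h2 h4].
Qed.

Lemma same_content_sym M1 M2 : same_content M1 M2 -> same_content M2 M1.
Proof. by case=> h1 h2; split; rewrite perm_sym. Qed.

Variables (K : fieldType) (X : comAlgType K) (U V : 'I_n -> X).

Definition minor2 (a : 'I_n * 'I_n) : X := U a.1 * V a.2 - U a.2 * V a.1.

Definition cpoly M : X :=
  (\prod_(a <- arcs M) minor2 a) * (\prod_(j <- us M) U j) * (\prod_(j <- vs M) V j).

Lemma cpoly_perm A A' l l' s s' :
  perm_eq A A' -> perm_eq l l' -> perm_eq s s' ->
  cpoly (Config A l s) = cpoly (Config A' l' s').
Proof. by move=> hA hl hs; rewrite /cpoly /= (perm_big _ hA) (perm_big _ hl) (perm_big _ hs). Qed.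

Definition low k (p : X) := exists M, [/\ good M, (vsum M < k)%N & p = cpoly M].

Definition eqv M M' := spanned (low (vsum M)) (cpoly M - cpoly M').

Lemma eqv_refl M : eqv M M.
Proof. by rewrite /eqv subrr; apply: spanned0. Qed.

Lemma eqv_sym M M' : vsum M = vsum M' -> eqv M M' -> eqv M' M.
Proof. by rewrite /eqv => <- h; rewrite -opprB; apply: spannedN. Qed.

Lemma eqv_trans M M' M'' : vsum M = vsum M' -> eqv M M' -> eqv M' M'' -> eqv M M''.
Proof.
rewrite /eqv => <- h1 h2; rewrite -(subrK (cpoly M') (cpoly M)) -addrA.
exact: spannedD.
Qed.

Lemma good_perm A A' l l' s s' :
  perm_eq A A' -> perm_eq l l' -> perm_eq s s' ->
  good (Config A l s) -> good (Config A' l' s').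
Proof.
move=> hA hl hs; have hq : perm_eq (unzip1 A) (unzip1 A') by apply: perm_map.
have ht : perm_eq (unzip2 A) (unzip2 A') by apply: perm_map.
move=> G; have okA : all arc_ok A by case: G.
apply: good_mono G => /= [|p|c]; first by rewrite -(perm_all _ hA).
  by rewrite /qs /ts /= (seq.permP hq) (seq.permP ht) (seq.permP hl) (seq.permP hs).
by rewrite /qs /ts /= !(seq.permP hq) !(seq.permP ht) !(seq.permP hl); split.
Qed.

Lemma minor2_swap (a c d f : 'I_n) :
  minor2 (c, d) * minor2 (a, f) - minor2 (a, d) * minor2 (c, f)
  = - (minor2 (a, c) * minor2 (d, f)).
Proof. by rewrite /minor2 /=; ring. Qed.

Lemma minor2N (a c : 'I_n) : minor2 (c, a) = - minor2 (a, c).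
Proof. by rewrite /minor2 /=; ring. Qed.

Lemma vsum_cons a A l s : vsum (Config (a :: A) l s) = (a.2 + vsum (Config A l s))%N.
Proof. by rewrite /vsum /ts /= big_cons; lia. Qed.

Lemma vsum_consV A j l s : vsum (Config A l (j :: s)) = (j + vsum (Config A l s))%N.
Proof. by rewrite /vsum /ts /= big_cons addnA. Qed.

Lemma cpoly_cons a A l s : cpoly (Config (a :: A) l s) = minor2 a * cpoly (Config A l s).
Proof. by rewrite /cpoly /= big_cons !mulrA. Qed.

Lemma cpoly_consU A j l s : cpoly (Config A (j :: l) s) = U j * cpoly (Config A l s).
Proof. by rewrite /cpoly /= big_cons; ring. Qed.

Lemma cpoly_consV A j l s : cpoly (Config A l (j :: s)) = V j * cpoly (Config A l s).
Proof. by rewrite /cpoly /= big_cons; ring. Qed.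

Lemma swap_arcs (q q' t t' : 'I_n) A l s :
  good (Config [:: (q', t), (q, t') & A] l s) -> arc_ok (q, t) -> (t <= t')%N ->
  good (Config [:: (q, t), (q', t') & A] l s) /\
  eqv (Config [:: (q', t), (q, t') & A] l s) (Config [:: (q, t), (q', t') & A] l s).
Proof.
move=> G okqt le_tt'; have [/= /and3P[] ] := G.
rewrite /arc_ok /= => /andP[lt1 /eqP b1] /andP[lt2 /eqP b2] okA _ _.
have /andP[/= lt3 /eqP b3] := okqt.
split.
  apply: good_mono (G) => /= [|p|c].
  - by rewrite okqt okA /arc_ok /= andbT; apply/andP; split; [lia | apply/eqP; lia].
  - by rewrite /qs /ts /=; blia.
  - by rewrite /qs /ts /=; split; blia.
case: (eqVneq q q') => [->|nqq]; first exact: eqv_refl.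
case: (eqVneq t t') => [<-|ntt].
  rewrite /eqv (_ : _ - _ = 0); first exact: spanned0.
  by apply/eqP; rewrite subr_eq0; apply/eqP; apply: cpoly_perm => //; apply/seq.permP => p /=; blia.
have lt_tt' : (t < t')%N by rewrite ltn_neqAle ntt.
pose lo' := if (q < q')%N then q else q'; pose hi' := if (q < q')%N then q' else q.
have lt_lh : (lo' < hi')%N.
  by have : (q : nat) != q' := nqq; rewrite /lo' /hi'; case: ifP; lia.
have b4 : blk lo' = blk t by rewrite /lo'; case: ifP; lia.
have b5 : blk hi' = blk t by rewrite /hi'; case: ifP; lia.
have lt_ht : (hi' < t)%N by rewrite /hi'; case: ifP; lia.
pose M3 := Config [:: (lo', hi'), (t, t') & A] l s.
have cnt2 (p : pred 'I_n) : (p q + p q' = p lo' + p hi')%N by rewrite /lo' /hi'; case: ifP; lia.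
have G3 : good M3.
  apply: good_mono (G) => /= [|p|c].
  - by rewrite okA /arc_ok /= lt_lh lt_tt' b4 b5 -b2 b3 eqxx.
  - by rewrite /qs /ts /=; have := cnt2 p; blia.
  - have h1 := @upto_mono c hi' t (ltnW lt_ht) b5; have h2 := cnt2 (upto c).
    have h3 := cnt2 (inblk c); have h4 := congr1 nat_of_bool (inblk_eq c b5).
    by rewrite /qs /ts /=; split; move: h1 h2 h3 h4; blia.
have V3 : (vsum M3 < vsum (Config [:: (q', t), (q, t') & A] l s))%N.
  by rewrite !vsum_cons /=; lia.
rewrite /eqv; have [c ->] : exists c : K, cpoly (Config [:: (q', t), (q, t') & A] l s) -
   cpoly (Config [:: (q, t), (q', t') & A] l s) = c *: cpoly M3.
  exists (if (q < q')%N then -1 else 1).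
  rewrite /M3 !cpoly_cons; move: (cpoly (Config A l s)) => C; have := minor2_swap q q' t t'.
  rewrite /lo' /hi'; case: ifP => _ E; rewrite ?scaleN1r ?scale1r.
    by rewrite !mulrA -mulrBl E mulNr.
  by rewrite (minor2N q q') !mulrA -mulrBl E; ring.
by apply: spannedZ; apply: spanned_gen; exists M3.
Qed.

Lemma eqv_perm A A' l l' s s' :
  perm_eq A A' -> perm_eq l l' -> perm_eq s s' -> eqv (Config A l s) (Config A' l' s').
Proof.
by move=> hA hl hs; rewrite /eqv (cpoly_perm hA hl hs) subrr; apply: spanned0.
Qed.

Lemma same_content_perm A A' l s :
  perm_eq (unzip1 A) (unzip1 A') -> perm_eq (unzip2 A) (unzip2 A') ->
  same_content (Config A l s) (Config A' l s).
Proof. by move=> h1 h2; split; rewrite /= perm_cat2l. Qed.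

Lemma min_right_end A : A != [::] ->
  exists2 a, a \in A & forall a', a' \in A -> (a.2 <= a'.2)%N.
Proof.
elim: A => // a A IH _; case: (eqVneq A [::]) => [->|/IH[a1 a1A min1]].
  by exists a; rewrite ?mem_head // => a'; rewrite inE => /eqP->.
case: (leqP a.2 a1.2) => [le_a|/ltnW le_a]; [exists a | exists a1].
- by rewrite mem_head.
- by move=> a'; rewrite inE => /orP[/eqP->//|/min1]; apply: leq_trans.
- by rewrite inE a1A orbT.
- by move=> a'; rewrite inE => /orP[/eqP->//|/min1].
Qed.

Lemma arcs_indep A A' C l s :
  good (Config (A ++ C) l s) -> good (Config (A' ++ C) l s) ->
  perm_eq (unzip1 A) (unzip1 A') -> perm_eq (unzip2 A) (unzip2 A') ->
  eqv (Config (A ++ C) l s) (Config (A' ++ C) l s).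
Proof.
have [m] := ubnP (size A); elim: m A A' C => // m IH A A' C le_m G G' h1 h2.
case: (eqVneq A [::]) => [A0|/min_right_end[[q t] aA /= min_t]].
  have A'0 : A' = [::].
    by have := perm_size h1; rewrite A0 !size_map => /esym/size0nil.
  by rewrite A0 A'0; apply: eqv_refl.
have okqt : arc_ok (q, t).
  by case: G => /=; rewrite all_cat => /andP[/allP ok _] _ _; apply: ok.
have /mapP[[q' t'] aA' /= tt'] : t \in unzip2 A'.
  by rewrite -(perm_mem h2); apply/mapP; exists (q, t).
subst t'; have pA := perm_to_rem aA; have pA' := perm_to_rem aA'.
move: (rem _ A) pA => A1 pA; move: (rem _ A') pA' => A1' pA'.
have p2 : perm_eq (unzip2 A1) (unzip2 A1').
  have := perm_trans (perm_trans _ h2) (perm_map snd pA').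
  by move=> /(_ (t :: unzip2 A1)) /=; rewrite perm_cons; apply; rewrite perm_sym (perm_map snd pA).
have sA : (size A = (size A1).+1)%N by rewrite (perm_size pA).
case: (eqVneq q q') => [qq'|nqq'].
  subst q'; have p1 : perm_eq (unzip1 A1) (unzip1 A1').
    have := perm_trans (perm_trans _ h1) (perm_map fst pA').
    by move=> /(_ (q :: unzip1 A1)) /=; rewrite perm_cons; apply; rewrite perm_sym (perm_map fst pA).
  have mv B B1 : perm_eq B ((q, t) :: B1) -> perm_eq (B ++ C) (B1 ++ (q, t) :: C).
    by move=> pB; rewrite -cat_rcons perm_cat2r perm_sym perm_rcons perm_sym.
  have e1 := eqv_perm (mv _ _ pA) (perm_refl l) (perm_refl s).
  have e2 := eqv_perm (mv _ _ pA') (perm_refl l) (perm_refl s).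
  have v1 : vsum (Config (A ++ C) l s) = vsum (Config (A1 ++ (q, t) :: C) l s).
    apply: same_content_vsum; apply: same_content_perm; exact: perm_map (mv _ _ pA).
  have v2 : vsum (Config (A' ++ C) l s) = vsum (Config (A1' ++ (q, t) :: C) l s).
    apply: same_content_vsum; apply: same_content_perm; exact: perm_map (mv _ _ pA').
  have v3 : vsum (Config (A ++ C) l s) = vsum (Config (A' ++ C) l s).
    by apply: same_content_vsum; apply: same_content_perm; rewrite /unzip1 /unzip2 !map_cat perm_cat2r.
  apply: eqv_trans e1 _ => //; apply: (eqv_trans _ _ (eqv_sym v2 e2)).
    exact: etrans (esym v1) (etrans v3 v2).
  apply: IH => //; first by move: le_m; rewrite sA.
  - by apply: good_perm G; rewrite ?perm_refl // mv.
  - by apply: good_perm G'; rewrite ?perm_refl // mv.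
have /mapP[[q1 t'] aA1' /= qq1] : q \in unzip1 A1'.
  have : q \in unzip1 A' by rewrite -(perm_mem h1); apply/mapP; exists (q, t).
  by rewrite (perm_mem (perm_map fst pA')) inE (negbTE nqq').
subst q1; have pA1' := perm_to_rem aA1'; move: (rem _ A1') pA1' => A2 pA1'.
have pA2 : perm_eq A' [:: (q', t), (q, t') & A2].
  by apply: perm_trans pA' _; rewrite perm_cons.
have le_tt' : (t <= t')%N.
  have /mapP[[q2 t2] h /= ->] : t' \in unzip2 A.
    rewrite (perm_mem h2) (perm_mem (perm_map snd pA2)) /= !inE eqxx orbT //.
  exact: min_t h.
have pC B B' : perm_eq B B' -> perm_eq (B ++ C) (B' ++ C) by move=> ?; rewrite perm_cat2r.
have G2 : good (Config [:: (q', t), (q, t') & A2 ++ C] l s).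
  by apply: good_perm G' => //; exact: pC pA2.
have [G3 e3] := swap_arcs G2 okqt le_tt'.
have v2 : vsum (Config (A' ++ C) l s) = vsum (Config [:: (q', t), (q, t') & A2 ++ C] l s).
  by apply: same_content_vsum; apply: same_content_perm; apply: perm_map (pC _ _ pA2).
have v3 : vsum (Config [:: (q, t), (q', t') & A2 ++ C] l s) =
          vsum (Config [:: (q', t), (q, t') & A2 ++ C] l s).
  by rewrite !vsum_cons /=; blia.
have v4 : vsum (Config (A ++ C) l s) = vsum (Config (A' ++ C) l s).
  by apply: same_content_vsum; apply: same_content_perm; rewrite /unzip1 /unzip2 !map_cat perm_cat2r.
have e2 := eqv_perm (pC _ _ pA2) (perm_refl l) (perm_refl s).
have v6 : vsum (Config (A ++ C) l s) = vsum (Config [:: (q, t), (q', t') & A2 ++ C] l s).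
  exact: etrans v4 (etrans v2 (esym v3)).
apply: eqv_sym; first exact: esym v4.
apply: eqv_trans e2 _ => //; apply: eqv_trans e3 _; first exact: esym v3.
apply: eqv_sym; first exact: v6.
have mv B : perm_eq ((q, t) :: B ++ C) (B ++ (q, t) :: C).
  by rewrite -cat_rcons -cat_cons perm_cat2r perm_sym perm_rcons.
have mvA : perm_eq (A ++ C) (A1 ++ (q, t) :: C).
  by apply: perm_trans (pC _ _ pA) _; apply: mv.
have mvA' := mv ((q', t') :: A2).
have e1 := eqv_perm mvA (perm_refl l) (perm_refl s).
have e4 := eqv_perm mvA' (perm_refl l) (perm_refl s).
have v1 : vsum (Config (A ++ C) l s) = vsum (Config (A1 ++ (q, t) :: C) l s).
  by apply: same_content_vsum; apply: same_content_perm; apply: perm_map mvA.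
have v5 : vsum (Config [:: (q, t), (q', t') & A2 ++ C] l s) =
          vsum (Config (((q', t') :: A2) ++ (q, t) :: C) l s).
  by apply: same_content_vsum; apply: same_content_perm; apply: perm_map mvA'.
apply: eqv_trans e1 _ => //; apply: (eqv_trans _ _ (eqv_sym v5 e4)).
  exact: etrans (esym v1) (etrans v6 v5).
have q1 : perm_eq (unzip1 A1) (unzip1 ((q', t') :: A2)).
  have := perm_trans (perm_trans _ h1) (perm_map fst pA2).
  move=> /(_ (q :: unzip1 A1)) /=; rewrite (perm_sym (q :: _) (q' :: _)) => H.
  have {}H := H (_ : perm_eq (q :: unzip1 A1) (unzip1 A)).
  rewrite -(perm_cons q); apply: perm_trans (_ : perm_eq _ [:: q', q & unzip1 A2]) _.
    by rewrite perm_sym; apply: H; rewrite perm_sym (perm_map fst pA).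
  by apply/seq.permP => p /=; blia.
apply: IH => //; first by move: le_m; rewrite sA.
- by apply: good_perm G => //; exact: mvA.
- by apply: good_perm G3 => //; exact: mvA'.
- apply: perm_trans p2 _; apply: perm_trans (perm_map snd pA1') _.
  exact: perm_refl.
Qed.

Lemma shiftU (q t j : 'I_n) A l s :
  (q < j < t)%N -> good (Config ((q, t) :: A) (j :: l) s) ->
  good (Config ((j, t) :: A) (q :: l) s) /\
  eqv (Config ((q, t) :: A) (j :: l) s) (Config ((j, t) :: A) (q :: l) s).
Proof.
move=> /andP[lt_qj lt_jt] G; have [/= /andP[] ] := G.
rewrite /arc_ok /= => /andP[lt_qt /eqP bqt] okA _ _.
have bqj : blk j = blk q by apply: blk_between bqt; lia.
have bjt : blk j = blk t by lia.
have u1 c := @upto_mono c q j (ltnW lt_qj) (esym bqj).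
have u2 c := @upto_mono c j t (ltnW lt_jt) bjt.
have i1 c := congr1 nat_of_bool (inblk_eq c bqj).
have i2 c := congr1 nat_of_bool (inblk_eq c bjt).
split.
  apply: good_mono (G) => /= [|p|c]; rewrite /qs /ts /=.
  - by rewrite okA /arc_ok /= lt_jt bjt eqxx.
  - by blia.
  - by split; move: (u1 c) (i1 c); blia.
have G3 : good (Config ((q, j) :: A) (t :: l) s).
  apply: good_mono (G) => /= [|p|c]; rewrite /qs /ts /=.
  - by rewrite okA /arc_ok /= lt_qj bqj eqxx.
  - by blia.
  - by split; move: (u2 c) (i2 c); blia.
rewrite /eqv !cpoly_cons !cpoly_consU.
rewrite (_ : _ - _ = cpoly (Config ((q, j) :: A) (t :: l) s)).
  apply: spanned_gen; exists (Config ((q, j) :: A) (t :: l) s); split=> //.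
  by rewrite !vsum_cons /vsum /= ltn_add2r.
by rewrite cpoly_cons cpoly_consU /minor2 /=; ring.
Qed.

Lemma shiftV (q t j : 'I_n) A l s :
  (q < j < t)%N -> good (Config ((q, t) :: A) l (j :: s)) ->
  good (Config ((q, j) :: A) l (t :: s)) /\
  eqv (Config ((q, t) :: A) l (j :: s)) (Config ((q, j) :: A) l (t :: s)).
Proof.
move=> /andP[lt_qj lt_jt] G; have [/= /andP[] ] := G.
rewrite /arc_ok /= => /andP[lt_qt /eqP bqt] okA _ _.
have bqj : blk j = blk q by apply: blk_between bqt; lia.
have bjt : blk j = blk t by lia.
have u1 c := @upto_mono c q j (ltnW lt_qj) (esym bqj).
have u2 c := @upto_mono c j t (ltnW lt_jt) bjt.
have i1 c := congr1 nat_of_bool (inblk_eq c bqj).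
have i2 c := congr1 nat_of_bool (inblk_eq c bjt).
split.
  apply: good_mono (G) => /= [|p|c]; rewrite /qs /ts /=.
  - by rewrite okA /arc_ok /= lt_qj bqj eqxx.
  - by blia.
  - by split; move: (u2 c) (i2 c); blia.
have G3 : good (Config ((j, t) :: A) l (q :: s)).
  apply: good_mono (G) => /= [|p|c]; rewrite /qs /ts /=.
  - by rewrite okA /arc_ok /= lt_jt bjt eqxx.
  - by blia.
  - by split; move: (u1 c) (i1 c); blia.
rewrite /eqv !cpoly_cons !cpoly_consV.
rewrite (_ : _ - _ = cpoly (Config ((j, t) :: A) l (q :: s))).
  apply: spanned_gen; exists (Config ((j, t) :: A) l (q :: s)); split=> //.
  by rewrite !vsum_cons !vsum_consV /=; move: (vsum _) lt_qj lt_jt; clear; lia.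
by rewrite cpoly_cons cpoly_consV /minor2 /=; ring.
Qed.

Definition irreducible M :=
  forall a j, a \in arcs M -> (j \in us M) || (j \in vs M) -> ~~ (a.1 < j < a.2)%N.

Definition spread M := (\sum_(a <- arcs M) (a.2 - a.1))%N.

Lemma reduce M : good M ->
  exists M', [/\ good M', same_content M M', irreducible M' & eqv M M'].
Proof.
have [m] := ubnP (spread M); elim: m M => // m IH M le_m G.
pose bad (a : 'I_n * 'I_n) (j : 'I_n) := (a.1 < j < a.2)%N.
have step M1 : (spread M1 < spread M)%N -> good M1 -> same_content M M1 -> eqv M M1 ->
    exists M', [/\ good M', same_content M M', irreducible M' & eqv M M'].
  move=> lt1 G1 s1 e1; have [|M' [G' s' irr' e']] := IH M1 _ G1; first by lia.
  exists M'; split=> //; first exact: same_content_trans s1 s'.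
  by apply: eqv_trans e1 e'; apply: same_content_vsum.
case: (boolP (has (fun a => has (bad a) (us M)) (arcs M))) => [/hasP[[q t] aA /hasP[j jl bj]]|nU].
  case: M le_m G aA jl step => A l s /= le_m G aA jl step.
  have pA := perm_to_rem aA; have pl := perm_to_rem jl.
  move: (rem _ A) pA => A1 pA; move: (rem _ l) pl => l1 pl.
  have G1 := good_perm pA pl (perm_refl s) G; have [G2 e2] := shiftU bj G1.
  have c1 : same_content (Config A l s) (Config ((q, t) :: A1) (j :: l1) s).
    split; first by apply: perm_cat => //; apply: perm_map pA.
    by rewrite perm_cat2l; apply: perm_map pA.
  apply: step G2 _ _.
  - by rewrite /spread /= (perm_big _ pA) !big_cons /=; move: bj; rewrite /bad /=; clear; lia.
  - apply: same_content_trans c1 _; split; rewrite /qs /ts //=.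
    by apply/seq.permP => p; rewrite /= !count_cat /=; blia.
  - apply: eqv_trans (eqv_perm pA pl (perm_refl s)) e2.
    exact: same_content_vsum.
case: (boolP (has (fun a => has (bad a) (vs M)) (arcs M))) => [/hasP[[q t] aA /hasP[j jl bj]]|nV].
  case: M le_m G aA jl step {nU} => A l s /= le_m G aA jl step.
  have pA := perm_to_rem aA; have pl := perm_to_rem jl.
  move: (rem _ A) pA => A1 pA; move: (rem _ s) pl => l1 pl.
  have G1 := good_perm pA (perm_refl l) pl G; have [G2 e2] := shiftV bj G1.
  have c1 : same_content (Config A l s) (Config ((q, t) :: A1) l (j :: l1)).
    split; first by rewrite perm_cat2l; apply: perm_map pA.
    by apply: perm_cat => //; apply: perm_map pA.
  apply: step G2 _ _.
  - by rewrite /spread /= (perm_big _ pA) !big_cons /=; move: bj; rewrite /bad /=; clear; lia.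
  - apply: same_content_trans c1 _; split; rewrite /qs /ts //=.
    by apply/seq.permP => p; rewrite /= !count_cat /=; blia.
  - apply: eqv_trans (eqv_perm pA (perm_refl l) pl) e2.
    exact: same_content_vsum.
exists M; split=> //; last exact: eqv_refl.
move=> a j aA /orP[jl|jl]; apply/negP => bj.
  by move/hasPn: nU => /(_ a aA) /hasPn /(_ j jl); rewrite /bad bj.
by move/hasPn: nV => /(_ a aA) /hasPn /(_ j jl); rewrite /bad bj.
Qed.

Definition keyc (k : nat) : pred 'I_n := fun j => (j : nat) == k./2.

Definition mul M k := if odd k then count (keyc k) (qs M) else count (keyc k) (ts M).

Definition tot M k :=
  if odd k then count (keyc k) (us M ++ qs M) else count (keyc k) (vs M ++ ts M).

Definition bdk (i : nat) :=
  [|| i == 0%N, i == n.*2 | ~~ odd i && (blk (i./2).-1 != blk i./2)].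

Lemma bdk0 : bdk 0.
Proof. by []. Qed.

Lemma bdkN : bdk n.*2.
Proof. by rewrite /bdk eqxx orbT. Qed.

Local Notation height := (height odd).
Local Notation valid := (valid n.*2 odd bdk).
Local Notation tight := (tight n.*2 odd).

Lemma height_mul M i : height (mul M) i =
  (count (fun a : 'I_n * 'I_n => a.1.*2.+1 < i)%N (arcs M))%:Z -
  (count (fun a : 'I_n * 'I_n => a.2.*2 < i)%N (arcs M))%:Z.
Proof.
elim: i => [|i IH] /=.
  rewrite (@eq_count _ _ pred0) 1?(@eq_count _ (fun a => _ < 0)%N pred0) ?count_pred0 //.
rewrite {}IH /mul /qs /ts /keyc; have := odd_double_half i; case: (odd i) => /= hi.
  rewrite count_map; elim: (arcs M) => //= a A; lia.
rewrite count_map; elim: (arcs M) => //= a A; lia.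
Qed.

Lemma mul_le M k : (mul M k <= tot M k)%N.
Proof. by rewrite /mul /tot; case: ifP => _; rewrite count_cat leq_addl. Qed.

Lemma valid_mul M : all arc_ok (arcs M) -> valid (tot M) (mul M).
Proof.
move=> okA; split=> [k|i _|i le_i bi]; first exact: mul_le.
  rewrite height_mul subr_ge0 lez_nat; elim: (arcs M) okA => //= -[q t] A IH /andP[].
  by move=> /andP[/= lt_qt _] /IH; lia.
rewrite height_mul; apply/eqP; rewrite subr_eq0; apply/eqP; congr Posz.
apply: eq_in_count => -[q t] aA /=; have /andP[/= lt_qt /eqP bqt] := allP okA _ aA.
apply/idP/idP; last by lia.
move: bi => /or3P[/eqP->//|/eqP-> _|/andP[oi nb] lt_qi]; first by have := ltn_ord t; lia.
rewrite ltnNge; apply/negP => le_it; case/eqP: nb.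
have hi := odd_double_half i; rewrite (negbTE oi) in hi.
have := @blk_mono q (i./2).-1; have := @blk_mono (i./2).-1 i./2; have := @blk_mono i./2 t.
by lia.
Qed.

Lemma tight_mul M : all arc_ok (arcs M) -> irreducible M -> tight (tot M) (mul M).
Proof.
move=> okA irr k lt_k lt_m; have hk := odd_double_half k.
have kn : (k./2 < n)%N by lia.
pose x : 'I_n := Ordinal kn.
have keyE l : (0 < count (keyc k) l)%N -> x \in l.
  by rewrite -has_count => /hasP[j jl /eqP hj]; rewrite (_ : x = j) //; apply: val_inj.
have xin : (x \in us M) || (x \in vs M).
  move: lt_m; rewrite /mul /tot; case: ifP => _; rewrite !count_cat.
    by move=> h; rewrite (keyE (us M)) //; lia.
  by move=> h; rewrite (keyE (vs M)) ?orbT //; lia.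
case: ifP hk => ok hk; rewrite height_mul; apply/eqP; rewrite subr_eq0; apply/eqP;
  congr Posz; apply: eq_in_count => -[q t] aA /=; have /andP[/= lt_qt _] := allP okA _ aA;
  move: lt_qt hk (irr _ _ aA xin : ~~ (q < k./2 < t)%N); clear; lia.
Qed.

Lemma tight_ext a m m' : (forall k, (k < n.*2)%N -> m k = m' k) ->
  tight a m -> tight a m'.
Proof.
move=> E tm k lt_k lt_m; have := tm k lt_k; rewrite E // => /(_ lt_m).
rewrite (@height_eq odd m m' k) => [|i lt_i]; last by apply: E; lia.
by rewrite (@height_eq odd m m' k.+1) // => i lt_i; apply: E; lia.
Qed.

Lemma upto_height M c : all arc_ok (arcs M) -> (c < n)%N ->
  (count (upto c) (qs M))%:Z - (count (upto c) (ts M))%:Z = height (mul M) c.*2.+2.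
Proof.
move=> okA lt_c; rewrite height_mul /qs /ts !count_map.
elim: (arcs M) okA => //= -[q t] A IH /andP[/andP[/= lt_qt /eqP bqt] /IH].
rewrite /upto /=; have := @blk_mono q c; have := @blk_mono c q.
have := @blk_mono t c; have := @blk_mono c t.
by lia.
Qed.

Lemma height_closed m i : (forall k, (k < i)%N -> ~~ odd k -> m k = 0%N) ->
  height m i = (\sum_(0 <= k < i) m k)%N%:Z.
Proof.
elim: i => [|i IH] H /=; first by rewrite big_geq.
rewrite IH => [|k lt_k]; last by apply: H; lia.
rewrite big_nat_recr //= PoszD; case: ifP => oi //.
by rewrite H ?oi // oppr0.
Qed.

Lemma blk_nobd q t : (q./2 <= t./2)%N -> (t < n.*2)%N -> odd q -> 
  (forall i, (q < i <= t)%N -> ~~ bdk i) -> blk q./2 = blk t./2.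
Proof.
move=> le_qt lt_t oq nb; have hq := odd_double_half q; rewrite oq in hq.
have ht := odd_double_half t.
have H d : (q./2 + d <= t./2)%N -> blk q./2 = blk (q./2 + d).
  elim: d => [|d IH] le_d; first by rewrite addn0.
  rewrite IH; last lia; have := nb (q./2 + d.+1).*2; rewrite /bdk odd_double doubleK /=.
  rewrite addnS /= => h; have := h _; lia.
by rewrite (H (t./2 - q./2)%N) ?subnKC //; lia.
Qed.

Lemma arcs_of_marks a m : valid a m -> exists2 A, all arc_ok A &
  forall k, (k < n.*2)%N -> mul (Config A [::] [::]) k = m k.
Proof.
have [T] := ubnP (\sum_(0 <= k < n.*2) m k)%N; elim: T m => // T IH m le_T vm.
have [le_ma h0 hb] := vm.
have sum_le i k : (k < i)%N -> (m k <= \sum_(0 <= j < i) m j)%N.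
  by move=> lt_k; rewrite (bigD1_seq k) ?mem_index_iota ?iota_uniq //= leq_addr.
case: (boolP (has (fun t => ~~ odd t && (0 < m t)%N) (iota 0 n.*2))) => [|/hasPn nV]; last first.
  exists [::] => // k lt_k; rewrite /mul /=; rewrite if_same.
  have := hb n.*2 (leqnn _); rewrite /bdk eqxx orbT => /(_ isT).
  rewrite height_closed => [|j lt_j oj]; last first.
    by have := nV j; rewrite mem_iota oj /=; lia.
  by have := sum_le _ _ lt_k; lia.
move=> /hasP[t0]; rewrite mem_iota => lt_t0 Pt0.
have [t [/andP[ot mt] le_t mint]] := @first_such (fun t => ~~ odd t && (0 < m t)%N) t0 Pt0.
have lt_t : (t < n.*2)%N by lia.
have clos i : (i <= t)%N -> height m i = (\sum_(0 <= k < i) m k)%N%:Z.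
  by move=> le_i; apply: height_closed => k lt_k ok; have := mint k; rewrite ok /=; lia.
have ht1 : 0 < height m t by have := h0 t.+1 lt_t; rewrite /= (negbTE ot); lia.
have [q [/andP[oq mq] lt_q maxq]] : exists q, [/\ odd q && (0 < m q)%N, (q < t)%N &
    forall i, (q < i < t)%N -> ~~ (odd i && (0 < m i)%N)].
  case: (boolP (has (fun q => odd q && (0 < m q)%N) (iota 0 t))) => [|/hasPn nU].
    move=> /hasP[q0]; rewrite mem_iota => lt_q0 Pq0.
    have [|q [Pq hq maxq]] := @last_such (fun q => odd q && (0 < m q)%N) q0 t Pq0; first lia.
    by exists q; split=> //; lia.
  move: ht1; rewrite clos // big_nat big1 //= => k lt_k.
  have := nU k; rewrite mem_iota; have := mint k; case: (odd k) => /=; lia.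
have hpos i : (q < i <= t)%N -> 0 < height m i.
  by move=> hi; rewrite clos; last lia; have := sum_le i q; lia.
have vs := valid_sub bdk0 bdkN oq ot lt_q mq mt hpos vm.
have [|A okA HA] := IH _ _ vs.
  suff : (\sum_(0 <= k < n.*2) mark_sub m q t k < \sum_(0 <= k < n.*2) m k)%N by lia.
  have qI : q \in index_iota 0 n.*2 by rewrite mem_index_iota; lia.
  have mq1 : (mark_sub m q t q < m q)%N by rewrite /mark_sub eqxx; lia.
  rewrite !(bigD1_seq q qI) ?iota_uniq //= -addSn leq_add //.
  by apply: leq_sum => k _; rewrite /mark_sub; lia.
have qn : (q./2 < n)%N by lia.
have tn : (t./2 < n)%N by lia.
have hq := odd_double_half q; have ht := odd_double_half t.
rewrite oq in hq; rewrite (negbTE ot) in ht.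
exists ((Ordinal qn, Ordinal tn) :: A).
  rewrite /= okA andbT /arc_ok /=; apply/andP; split; first by lia.
  apply/eqP; apply: blk_nobd => //; first by lia.
  move=> i hi; apply/negP => bi; have := hb i; rewrite bi; have := hpos i hi; lia.
move=> k lt_k; have := HA k lt_k; rewrite /mul /qs /ts /= /keyc /mark_sub /=.
have hk := odd_double_half k.
case: (boolP (odd k)) hk => ok hk /= ->.
  have nkt : k != t by apply: contraNneq ot => <-.
  by move: hk hq ht oq ok mq nkt; case: (eqVneq k q) => [->|]; clear; lia.
have nkq : k != q by apply: contraNneq ok => ->.
by move: hk hq ht ot ok mt nkq; case: (eqVneq k t) => [->|]; clear; lia.
Qed.

Lemma count_letters (p : pred 'I_n) l :
  count p l = (\sum_(j : 'I_n | p j) count (pred1 j) l)%N.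
Proof.
elim: l => [|x l IH] /=; first by rewrite big1.
rewrite big_split /= -IH; congr addn; case: (boolP (p x)) => px.
  rewrite (bigD1 x) //= eqxx big1 // => j /andP[_ nj].
  by rewrite eq_sym (negbTE nj).
by rewrite big1 // => j pj; case: eqP => // E; rewrite E pj in px.
Qed.

Lemma perm_letters l l' :
  (forall j : 'I_n, count (pred1 j) l = count (pred1 j) l') -> perm_eq l l'.
Proof. by move=> H; apply/allP => x _; apply/eqP; apply: H. Qed.

Lemma count_keyc (j : 'I_n) k l : k./2 = j -> count (keyc k) l = count (pred1 j) l.
Proof. by rewrite /keyc => ->; apply: eq_count => x; rewrite /= -val_eqE. Qed.

Lemma mul_qs M (j : 'I_n) : count (pred1 j) (qs M) = mul M j.*2.+1.
Proof. by rewrite /mul /= odd_double (@count_keyc j) //= uphalf_double. Qed.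

Lemma mul_ts M (j : 'I_n) : count (pred1 j) (ts M) = mul M j.*2.
Proof. by rewrite /mul odd_double (@count_keyc j) //= doubleK. Qed.

Lemma tot_us M (j : 'I_n) : count (pred1 j) (us M ++ qs M) = tot M j.*2.+1.
Proof. by rewrite /tot /= odd_double (@count_keyc j) //= uphalf_double. Qed.

Lemma tot_vs M (j : 'I_n) : count (pred1 j) (vs M ++ ts M) = tot M j.*2.
Proof. by rewrite /tot odd_double (@count_keyc j) //= doubleK. Qed.

Lemma same_content_tot M M' :
  (forall k, (k < n.*2)%N -> tot M k = tot M' k) -> same_content M M'.
Proof.
move=> H; split; apply: perm_letters => j.
  by rewrite !tot_us H //; have := ltn_ord j; lia.
by rewrite !tot_vs H //; have := ltn_ord j; lia.
Qed.

Lemma tot_same_content M M' k : same_content M M' -> tot M k = tot M' k.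
Proof. by case=> h1 h2; rewrite /tot; case: ifP => _; apply: seq.permP. Qed.

Lemma perm_of_mul M M' : same_content M M' ->
  (forall k, (k < n.*2)%N -> mul M k = mul M' k) ->
  [/\ perm_eq (qs M) (qs M'), perm_eq (ts M) (ts M'), perm_eq (us M) (us M')
    & perm_eq (vs M) (vs M')].
Proof.
case=> h1 h2 H.
have hq : perm_eq (qs M) (qs M').
  by apply: perm_letters => j; rewrite !mul_qs H //; have := ltn_ord j; lia.
have ht : perm_eq (ts M) (ts M').
  by apply: perm_letters => j; rewrite !mul_ts H //; have := ltn_ord j; lia.
split=> //.
  by rewrite -(perm_cat2r (qs M)); apply: perm_trans h1 _; rewrite perm_cat2l perm_sym.
by rewrite -(perm_cat2r (ts M)); apply: perm_trans h2 _; rewrite perm_cat2l perm_sym.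
Qed.

Lemma good_same M M' : same_content M M' ->
  (forall k, (k < n.*2)%N -> mul M k = mul M' k) -> all arc_ok (arcs M') ->
  good M -> good M'.
Proof.
move=> sc H okA; have [/seq.permP hq /seq.permP ht /seq.permP hu /seq.permP hv] := perm_of_mul sc H.
by apply: good_mono => // [p|c]; rewrite ?hq ?ht ?hu ?hv.
Qed.

Lemma eqv_same M M' : good M -> good M' -> same_content M M' ->
  (forall k, (k < n.*2)%N -> mul M k = mul M' k) -> eqv M M'.
Proof.
move=> G G' sc H; have [hq ht hu hv] := perm_of_mul sc H.
case: M M' G G' sc H hq ht hu hv => A l s [A' l' s'] G G' sc _ hq ht hu hv.
apply: (@eqv_trans _ (Config A l' s')).
- by apply: same_content_vsum; split; rewrite perm_cat2r.
- exact: eqv_perm.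
have G1 := good_perm (perm_refl A) hu hv G.
by have := @arcs_indep A A' [::] l' s'; rewrite !cats0; apply.
Qed.

Definition letters (f : nat -> nat) : seq 'I_n :=
  flatten [seq nseq (f j) j | j : 'I_n <- enum 'I_n].

Lemma count_letters_of f (j : 'I_n) : count (pred1 j) (letters f) = f j.
Proof.
rewrite count_flatten -map_comp sumnE big_map big_enum /=.
rewrite (bigD1 j) //= count_nseq /= eqxx mul1n big1 ?addn0 // => i ni.
by rewrite count_nseq /= (negbTE ni).
Qed.

Lemma count_keyc_letters f k : (k < n.*2)%N -> count (keyc k) (letters f) = f k./2.
Proof.
move=> lt_k; have kn : (k./2 < n)%N by have := odd_double_half k; lia.
by rewrite (@count_keyc (Ordinal kn)) // count_letters_of.
Qed.

Lemma count_qs_sum M p :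
  count p (qs M) = (\sum_(j : 'I_n | p j) mul M (j : nat).*2.+1)%N.
Proof. by rewrite count_letters; apply: eq_bigr => j _; rewrite mul_qs. Qed.

Lemma marks_key k : (k < n.*2)%N -> (k./2 < n)%N.
Proof. by have := odd_double_half k; lia. Qed.

Definition dist (m m' : nat -> nat) := (\sum_(0 <= k < n.*2) ((m k - m' k) + (m' k - m k)))%N.

Lemma sum_eq_key q : (q < n.*2)%N -> (\sum_(0 <= k < n.*2) (k == q) = 1)%N.
Proof.
move=> lt_q; rewrite (bigD1_seq q) ?mem_index_iota ?iota_uniq //= eqxx big1 // => k.
by move/negbTE->.
Qed.

Lemma dist_lt (m m' m2 : nat -> nat) q t r :
  (q < n.*2)%N -> (t < n.*2)%N -> (r < n.*2)%N ->
  (forall k, (k < n.*2)%N ->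
    ((m2 k - m' k) + (m' k - m2 k) + ((k == q) + (k == t)) <=
     (m k - m' k) + (m' k - m k) + (k == r))%N) ->
  (dist m2 m' < dist m m')%N.
Proof.
move=> lt_q lt_t lt_r H.
suff : (dist m2 m' + (1 + 1) <= dist m m' + 1)%N by lia.
rewrite /dist -{1}(sum_eq_key lt_q) -{1}(sum_eq_key lt_t) -(sum_eq_key lt_r) -!big_split /=.
by rewrite !big_nat; apply: leq_sum => k /andP[_ lt_k]; apply: H.
Qed.

Lemma exchange_poly A l s (p r q t : 'I_n) :
  cpoly (Config ((p, r) :: A) (q :: l) (t :: s)) - cpoly (Config ((q, t) :: A) (p :: l) (r :: s))
  = cpoly (Config ((p, r) :: A) (t :: l) (q :: s)) - cpoly (Config ((q, t) :: A) (r :: l) (p :: s)).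
Proof. by rewrite !cpoly_cons !cpoly_consU !cpoly_consV /minor2 /=; ring. Qed.

Lemma break_poly A l s (q t : 'I_n) :
  cpoly (Config A (q :: l) (t :: s)) - cpoly (Config ((q, t) :: A) l s)
  = cpoly (Config A (t :: l) (q :: s)).
Proof. by rewrite !cpoly_cons !cpoly_consU !cpoly_consV /minor2 /=; ring. Qed.

Definition sing M k := if odd k then count (keyc k) (us M) else count (keyc k) (vs M).

Lemma tot_split M k : tot M k = (sing M k + mul M k)%N.
Proof. by rewrite /tot /sing /mul; case: ifP; rewrite count_cat. Qed.

Lemma mul_cons x y A l s l' s' k :
  mul (Config ((x, y) :: A) l s) k =
  ((if odd k then (x : nat) == k./2 else (y : nat) == k./2) + mul (Config A l' s') k)%N.
Proof. by rewrite /mul /qs /ts /= /keyc; case: (odd k). Qed.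

Lemma sing_cons x y A A' l s k :
  sing (Config A (x :: l) (y :: s)) k =
  ((if odd k then (x : nat) == k./2 else (y : nat) == k./2) + sing (Config A' l s) k)%N.
Proof. by rewrite /sing /= /keyc; case: (odd k). Qed.

Lemma key_eq q t k : odd q -> ~~ odd t ->
  (if odd k then q./2 == k./2 else t./2 == k./2) = ((k == q) + (k == t))%N :> nat.
Proof.
move=> oq ot; have := odd_double_half q; have := odd_double_half t.
have := odd_double_half k; rewrite oq (negbTE ot); case: (boolP (odd k)) => ok; lia.
Qed.

Section Exchange.
Variables (M M' : config n).
Hypotheses (G : good M) (G' : good M') (sc : same_content M M').
Hypotheses (tM : tight (tot M) (mul M)) (tM' : tight (tot M) (mul M')).
Variables (q t p : nat).
Hypotheses (oq : odd q) (ot : ~~ odd t) (lt_pq : (p <= q < t)%N) (lt_t : (t < n.*2)%N).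
Hypothesis eq_p : forall k, (k < p)%N -> mul M k = mul M' k.
Hypotheses (lt_mq : (mul M q < mul M' q)%N) (lt_mt : (mul M t < mul M' t)%N).
Hypothesis full : forall k, (q < k < t)%N -> mul M k = tot M k.
Hypothesis between : forall i, (p < i <= t)%N ->
  [/\ height (mul M) i + 1 <= height (mul M') i, ~~ bdk i & (i < t)%N -> mul M' i = tot M i].
Hypothesis lt_mp : (mul M p < mul M' p)%N.

Let vM : valid (tot M) (mul M).
Proof. by apply: valid_mul; case: G. Qed.

Let vM' : valid (tot M) (mul M').
Proof.
have [|le_ma h0 hb] := @valid_mul M'; first by case: G'.
by split=> // k; rewrite (tot_same_content k sc).
Qed.

Let qn : (q./2 < n)%N. Proof. by have := odd_double_half q; lia. Qed.
Let tn : (t./2 < n)%N. Proof. by have := odd_double_half t; lia. Qed.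
Let xq := Ordinal qn.
Let xt := Ordinal tn.

Let mq_a : (mul M q < tot M q)%N.
Proof. by have [H _ _] := vM'; have := H q; lia. Qed.
Let mt_a : (mul M t < tot M t)%N.
Proof. by have [H _ _] := vM'; have := H t; lia. Qed.

Let blk_qt : blk q./2 = blk t./2.
Proof.
apply: blk_nobd => //; first by lia.
by move=> i hi; have [|_ ? _] := between (i := i); first by lia.
Qed.

Let okqt : arc_ok (xq, xt).
Proof.
rewrite /arc_ok /= -blk_qt eqxx andbT.
by have := odd_double_half q; have := odd_double_half t; rewrite oq (negbTE ot); lia.
Qed.

Let m1 := mark_add (mul M) q t.
Let u1 := letters (fun j => tot M j.*2.+1 - m1 j.*2.+1)%N.
Let v1 := letters (fun j => tot M j.*2 - m1 j.*2)%N.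

Let m1_le k : (m1 k <= tot M k)%N.
Proof.
have [H _ _] := vM; have := H k; rewrite /m1 /mark_add.
case: (eqVneq k q) => [->|_]; case: (eqVneq _ t) => [E|_]; try lia.
by rewrite E; lia.
Qed.

Let sing1 A k : (k < n.*2)%N -> sing (Config A u1 v1) k = (tot M k - m1 k)%N.
Proof.
move=> lt_k; rewrite /sing /= !count_keyc_letters //; have := odd_double_half k.
by case: (odd k); rewrite ?add1n ?add0n => ->.
Qed.

Let under c : (c < n)%N -> upto c xq -> ~~ upto c xt ->
  (count (upto c) (qs M) + count (upto c) (ts M') + 1 <=
   count (upto c) (qs M') + count (upto c) (ts M))%N.
Proof.
move=> lt_c; rewrite {1}/upto /= => /andP[/eqP bc le_c]; rewrite {1}/upto /= => nt.
have okA : all arc_ok (arcs M) by case: G.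
have okA' : all arc_ok (arcs M') by case: G'.
have := upto_height okA lt_c; have := upto_height okA' lt_c.
have hq := odd_double_half q; have ht := odd_double_half t.
rewrite -blk_qt bc eqxx /= in nt; rewrite oq in hq; rewrite (negbTE ot) in ht.
have [|hh _ _] := between (i := c.*2.+2); first by lia.
by move: hh; clear; lia.
Qed.

Let before p2 c : (c < n)%N -> upto c xq ->
  (forall k, (k < n.*2)%N -> (k < p2)%N -> blk k./2 = blk q./2 -> (mul M k <= mul M' k)%N) ->
  (forall j : 'I_n, upto c j -> (j.*2.+1 < p2)%N) ->
  (count (upto c) (qs M) + 1 <= count (upto c) (qs M'))%N.
Proof.
move=> lt_c uq H Hj; rewrite !count_qs_sum (bigD1 xq) //= [X in (_ <= X)%N](bigD1 xq) //=.
have hq := odd_double_half q; rewrite oq add1n in hq; rewrite hq.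
rewrite addn1 -addSn; apply: leq_add; first exact: lt_mq.
apply: leq_sum => j /andP[uj _]; apply: H; [by have := ltn_ord j; lia | exact: Hj |].
move: uq uj; rewrite /upto /= uphalf_double => /andP[/eqP -> _] /andP[/eqP -> _] //.
Qed.

Lemma add_arc :
  (forall k, (k < n.*2)%N -> blk k./2 = blk q./2 -> (mul M k <= mul M' k)%N) ->
  exists M2, [/\ good M2, same_content M M2, tight (tot M) (mul M2), eqv M M2
    & (dist (mul M2) (mul M') < dist (mul M) (mul M'))%N].
Proof.
move=> noex; have [A okA HA] := arcs_of_marks vM.
pose MA := Config A (xq :: u1) (xt :: v1).
pose M2 := Config ((xq, xt) :: A) u1 v1.
pose T1 := Config A (xt :: u1) (xq :: v1).
have mA k : (k < n.*2)%N -> mul MA k = mul M k by move=> /HA <-.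
have m2E k : (k < n.*2)%N -> mul M2 k = m1 k.
  move=> lt_k; rewrite /M2 (mul_cons _ _ _ _ _ [::] [::]) (key_eq k oq ot) HA //.
  by rewrite /m1 /mark_add; lia.
have scA : same_content M MA.
  apply: same_content_tot => k lt_k; rewrite (tot_split MA) mA // /MA (sing_cons _ _ _ A).
  by rewrite (key_eq k oq ot) sing1 //; have := m1_le k; rewrite /m1 /mark_add; lia.
have mA' k : (k < n.*2)%N -> mul M k = mul MA k by move=> /mA.
have GA : good MA by apply: good_same G.
have eA : eqv M MA by apply: eqv_same.
have scA2 : same_content MA M2.
  by split; apply/seq.permP => f; rewrite !count_cat /qs /ts /=; blia.
have cmp c : (c < n)%N -> [/\ (upto c xt <= upto c xq)%N, inblk c xq = inblk c xt :> nat,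
    ((0 < upto c xq)%N -> count (upto c) (qs MA) + 1 <= count (upto c) (qs M'))%N,
    ((0 < upto c xq)%N -> upto c xt = 0 :> nat ->
       count (upto c) (qs MA) + count (upto c) (ts M') + 1 <=
       count (upto c) (qs M') + count (upto c) (ts MA))%N
    & (count (upto c) (us MA) + count (upto c) (qs MA) =
       count (upto c) (us M') + count (upto c) (qs M'))%N].
  move=> lt_c; have [/seq.permP pq /seq.permP pt /seq.permP pu _] := perm_of_mul scA mA'.
  split.
  - by move/andP: okqt => [/= lt_qt /eqP bqt]; apply: upto_mono => //; apply: ltnW.
  - by move/andP: okqt => [/= _ /eqP bqt]; congr nat_of_bool; apply: inblk_eq.
  - rewrite lt0b => uq; rewrite -pq; apply: (@before n.*2) => // [k lt_k _|j _]; first exact: noex.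
    by have := ltn_ord j; lia.
  - rewrite lt0b => uq ut; rewrite -pq -pt; apply: under => //.
    by move: ut; case: (upto c xt).
  - by rewrite -pq -pu -!count_cat; case: sc => /seq.permP.
have [okA' totA GcA] := GA; have [_ _ GcM'] := G'.
have G2 : good M2.
  split; first by rewrite /= okA okqt.
    by move=> f; rewrite -totA /qs /ts /=; blia.
  move=> c lt_c; have := cmp c lt_c; have := GcA c lt_c; have := GcM' c lt_c.
  rewrite /qs /ts /=; case=> a1 a2 a3 a4 a5 [b1 b2 b3 b4 b5] [c1 c2 c3 c4 c5].
  move: (leq_b1 (upto c xq)) a1 a2 a3 a4 a5 b1 b2 b3 b4 b5 c1 c2 c3 c4 c5.
  by natvars; split; lia.
have GT : good T1.
  split; first by rewrite /= okA.
    by move=> f; rewrite -totA /qs /ts /=; blia.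
  move=> c lt_c; have := cmp c lt_c; have := GcA c lt_c; have := GcM' c lt_c.
  rewrite /qs /ts /=; case=> a1 a2 a3 a4 a5 [b1 b2 b3 b4 b5] [c1 c2 c3 c4 c5].
  move: (leq_b1 (upto c xq)) a1 a2 a3 a4 a5 b1 b2 b3 b4 b5 c1 c2 c3 c4 c5.
  by natvars; split; lia.
exists M2; split=> //; first exact: same_content_trans scA scA2.
- apply: (tight_ext (m := m1)); first by move=> k /m2E.
  by apply: (tight_add bdk0 bdkN) => //; case/andP: lt_pq.
- apply: eqv_trans eA _; first exact: same_content_vsum.
  rewrite /eqv break_poly; apply: spanned_gen; exists T1; split=> //.
  by rewrite /T1 /MA !vsum_consV /vsum /= ltn_add2r; case/andP: okqt.
- apply: (@dist_lt _ _ _ q t q) => //; try lia.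
  move=> k lt_k; rewrite m2E // /m1 /mark_add.
  have [H _ _] := vM'; have := H k.
  case: (eqVneq k q) => [->|nq]; case: (eqVneq _ t) => [E|nt]; try lia.
  by rewrite E; lia.
Qed.

Lemma trade_arc p2 : (p < p2 < n.*2)%N -> blk p2./2 = blk q./2 ->
  (mul M' p2 < mul M p2)%N -> (forall k, (k < p2)%N -> (mul M k <= mul M' k)%N) ->
  exists M2, [/\ good M2, same_content M M2, tight (tot M) (mul M2), eqv M M2
    & (dist (mul M2) (mul M') < dist (mul M) (mul M'))%N].
Proof.
move=> /andP[lt_pp2 lt_p2] bp2 lt_m2 le_m2.
have [op2 [hp2 [r2 [or2 /andP[lt_pr lt_r2] mr2 hr2 hpos]]]] :=
  excess_arc bdk0 bdkN vM vM' tM tM' lt_p2 lt_m2 le_m2.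
have mp2 : (0 < mul M p2)%N by lia.
have lt_tp : (t < p2)%N.
  rewrite ltnNge; apply/negP => le_pt; have np2t : p2 != t by apply: contraNneq ot => <-.
  have [|_ _ H] := between (i := p2); first by lia.
  by have [/(_ p2) + _ _] := vM; rewrite -H; lia.
have p2n := marks_key lt_p2; have r2n := marks_key lt_r2.
pose xp := Ordinal p2n; pose xr := Ordinal r2n.
have okpr : arc_ok (xp, xr).
  rewrite /arc_ok /=; have hp := odd_double_half p2; have hr := odd_double_half r2.
  rewrite op2 in hp; rewrite (negbTE or2) in hr; apply/andP; split; first by lia.
  apply/eqP; apply: blk_nobd => //; first by lia.
  move=> i hi; apply/negP => bi; have [_ _ /(_ i) H] := vM.
  by have := hpos i hi; rewrite H //; lia.
have vs0 := valid_sub bdk0 bdkN op2 or2 lt_pr mp2 mr2 hpos vM.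
have [A okA HA] := arcs_of_marks vs0.
pose MA := Config ((xp, xr) :: A) (xq :: u1) (xt :: v1).
pose M2 := Config ((xq, xt) :: A) (xp :: u1) (xr :: v1).
pose T1 := Config ((xp, xr) :: A) (xt :: u1) (xq :: v1).
pose T2 := Config ((xq, xt) :: A) (xr :: u1) (xp :: v1).
have sub_add k : (mark_sub (mul M) p2 r2 k + ((k == p2) + (k == r2)) = mul M k)%N.
  rewrite /mark_sub; case: (eqVneq k p2) => [->|np]; case: (eqVneq _ r2) => [E|nr]; try lia.
  by rewrite E; lia.
have mA k : (k < n.*2)%N -> mul MA k = mul M k.
  by move=> lt_k; rewrite /MA (mul_cons _ _ _ _ _ [::] [::]) (key_eq k op2 or2) HA // addnC.
have m2E k : (k < n.*2)%N -> mul M2 k = mark_sub m1 p2 r2 k.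
  move=> lt_k; rewrite /M2 (mul_cons _ _ _ _ _ [::] [::]) (key_eq k oq ot) HA //.
  have := sub_add k; rewrite /mark_sub /m1 /mark_add.
  by case: (eqVneq k p2) => [->|np]; case: (eqVneq _ r2) => [E|nr]; lia.
have scA : same_content M MA.
  apply: same_content_tot => k lt_k; rewrite (tot_split MA) mA // /MA (sing_cons _ _ _ A).
  by rewrite (key_eq k oq ot) sing1 //; have := m1_le k; rewrite /m1 /mark_add; lia.
have mA' k : (k < n.*2)%N -> mul M k = mul MA k by move=> /mA.
have GA : good MA by apply: good_same G => //=; rewrite okpr.
have eA : eqv M MA by apply: eqv_same.
have scA2 : same_content MA M2.
  by split; apply/seq.permP => f; rewrite !count_cat /qs /ts /=; blia.
have [/= lt_qt /eqP bqt] := andP okqt; have [/= lt_pr' /eqP bpr] := andP okpr.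
have le_tp : (t./2 <= p2./2)%N by have := odd_double_half p2; have := odd_double_half t; lia.
have cmp c : (c < n)%N -> [/\ [/\ (upto c xt <= upto c xq)%N, (upto c xp <= upto c xt)%N &
      (upto c xr <= upto c xp)%N],
    [/\ inblk c xq = inblk c xt :> nat, inblk c xp = inblk c xt :> nat &
       inblk c xr = inblk c xp :> nat],
    ((0 < upto c xq)%N -> upto c xp = 0 :> nat ->
       count (upto c) (qs MA) + 1 <= count (upto c) (qs M'))%N,
    ((0 < upto c xq)%N -> upto c xt = 0 :> nat ->
       count (upto c) (qs MA) + count (upto c) (ts M') + 1 <=
       count (upto c) (qs M') + count (upto c) (ts MA))%N
    & (count (upto c) (us MA) + count (upto c) (qs MA) =
       count (upto c) (us M') + count (upto c) (qs M'))%N].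
  move=> lt_c; have [/seq.permP pq /seq.permP pt /seq.permP pu _] := perm_of_mul scA mA'.
  split.
  - by split; apply: upto_mono => //=; [apply: ltnW | rewrite -bqt | apply: ltnW].
  - by split; congr nat_of_bool; apply: inblk_eq => //=; rewrite bp2 -bqt.
  - rewrite lt0b => uq up0; rewrite -pq; apply: (@before p2) => // [k lt_k lt_kp _|j uj].
      exact: le_m2.
    have hp := odd_double_half p2; move: uq up0 uj; rewrite /upto /= bp2 => /andP[-> _] /=.
    by case/eqP: hp; rewrite op2; case: leqP => //= ? _ ? /andP[_ ?]; lia.
  - rewrite lt0b => uq ut; rewrite -pq -pt; apply: under => //.
    by move: ut; case: (upto c xt).
  - by rewrite -pq -pu -!count_cat; case: sc => /seq.permP.
have [okA' totA GcA] := GA; have [_ _ GcM'] := G'.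
have G2 : good M2.
  split; first by rewrite /= okA okqt.
    by move=> f; rewrite -totA /qs /ts /=; blia.
  move=> c lt_c; have := cmp c lt_c; have := GcA c lt_c; have := GcM' c lt_c.
  rewrite /qs /ts /=; case=> a1 a2 a3 a4 a5 [b1 b2 b3 b4 b5] [[c1 c2 c3] [d1 d2 d3] e1 e2 e3].
  move: (leq_b1 (upto c xq)) a1 a2 a3 a4 a5 b1 b2 b3 b4 b5 c1 c2 c3 d1 d2 d3 e1 e2 e3.
  by natvars; split; lia.
have GT1 : good T1.
  split; first by rewrite /= okA okpr.
    by move=> f; rewrite -totA /qs /ts /=; blia.
  move=> c lt_c; have := cmp c lt_c; have := GcA c lt_c; have := GcM' c lt_c.
  rewrite /qs /ts /=; case=> a1 a2 a3 a4 a5 [b1 b2 b3 b4 b5] [[c1 c2 c3] [d1 d2 d3] e1 e2 e3].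
  move: (leq_b1 (upto c xq)) a1 a2 a3 a4 a5 b1 b2 b3 b4 b5 c1 c2 c3 d1 d2 d3 e1 e2 e3.
  by natvars; split; lia.
have GT2 : good T2.
  split; first by rewrite /= okA okqt.
    by move=> f; rewrite -totA /qs /ts /=; blia.
  move=> c lt_c; have := cmp c lt_c; have := GcA c lt_c; have := GcM' c lt_c.
  rewrite /qs /ts /=; case=> a1 a2 a3 a4 a5 [b1 b2 b3 b4 b5] [[c1 c2 c3] [d1 d2 d3] e1 e2 e3].
  move: (leq_b1 (upto c xq)) a1 a2 a3 a4 a5 b1 b2 b3 b4 b5 c1 c2 c3 d1 d2 d3 e1 e2 e3.
  by natvars; split; lia.
have vA : vsum M = vsum MA by apply: same_content_vsum.
exists M2; split=> //; first exact: same_content_trans scA scA2.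
- apply: (tight_ext (m := mark_sub m1 p2 r2)); first by move=> k /m2E.
  have lt_qt' : (q < t)%N by case/andP: lt_pq.
  have hm1 i : (t < i)%N -> height m1 i = height (mul M) i.
    by move=> lt_i; rewrite height_add //; lia.
  have m1E k : (t < k)%N -> m1 k = mul M k.
    by move=> lt_k; rewrite /m1 /mark_add; lia.
  apply: (tight_sub bdk0 bdkN) => //; rewrite ?m1E ?hm1 ?lt_pr //; try lia.
  + by move=> i hi; rewrite hm1; [apply: hpos | lia].
  + by apply: (valid_add bdk0 bdkN) => // i hi; have [|_ ? _] := between (i := i); first lia.
  + exact: (tight_add bdk0 bdkN).
- apply: eqv_trans eA _; first exact: vA.
  rewrite /eqv exchange_poly; apply: spannedB; apply: spanned_gen.
    exists T1; split=> //; rewrite /T1 /MA !vsum_cons !vsum_consV /=.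
    by rewrite /vsum /ts /=; move: lt_qt; clear; lia.
  exists T2; split=> //; rewrite /T2 /MA !vsum_cons !vsum_consV /=.
  by rewrite /vsum /ts /=; move: lt_pr'; clear; lia.
- have lt_q : (q < n.*2)%N by lia.
  apply: (@dist_lt _ _ _ q t r2) => // k lt_k; rewrite m2E //.
  have [H _ _] := vM'; have Hk := H k; move: lt_mq lt_mt lt_m2 mr2 lt_pq lt_tp lt_pr Hk.
  rewrite /m1 /mark_sub /mark_add; case: (eqVneq k q) => [->|_]; last first.
    case: (eqVneq k t) => [->|_]; last first.
      by case: (eqVneq k p2) => [->|_]; last case: (eqVneq k r2) => [->|_]; clear; lia.
    by clear; lia.
  by clear; lia.
Qed.

End Exchange.

Lemma tight_exta a a' m : (forall k, a k = a' k) -> tight a m -> tight a' m.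
Proof. by move=> E tm k lt_k; rewrite -E; apply: tm. Qed.

Lemma dist_sym m m' : dist m m' = dist m' m.
Proof. by apply: eq_bigr => k _; rewrite addnC. Qed.

Lemma closer M M' p : good M -> good M' -> same_content M M' ->
  tight (tot M) (mul M) -> tight (tot M) (mul M') -> (p < n.*2)%N ->
  (forall k, (k < p)%N -> mul M k = mul M' k) -> (mul M p < mul M' p)%N ->
  exists M2, [/\ good M2, same_content M M2, tight (tot M) (mul M2), eqv M M2
    & (dist (mul M2) (mul M') < dist (mul M) (mul M'))%N].
Proof.
move=> G G' sc tM tM' lt_p eq_p lt_mp.
have vM : valid (tot M) (mul M) by apply: valid_mul; case: G.
have vM' : valid (tot M) (mul M').
  have [|le_ma h0 hb] := @valid_mul M'; first by case: G'.
  by split=> // k; rewrite (tot_same_content k sc).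
have [q [t [[oq ot lt_pq] [lt_t lt_mq lt_mt full btw]]]] :=
  missing_arc bdk0 bdkN vM vM' tM tM' lt_p eq_p lt_mp.
have bqt : blk q./2 = blk t./2.
  apply: blk_nobd => //; first by lia.
  by move=> i hi; have [|_ ? _] := btw i; first by lia.
have under_le k : (k <= t)%N -> (mul M k <= mul M' k)%N.
  move=> le_kt; case: (ltngtP k p) => [/eq_p->//|lt_pk|->]; last exact: ltnW.
  case: (eqVneq k t) => [->|nkt]; first exact: ltnW.
  have [|_ _ ->] := btw k; [by lia | exact: mul_le | by lia].
pose P k := [&& (p < k)%N, (k < n.*2)%N, blk k./2 == blk q./2 & (mul M' k < mul M k)%N].
case: (boolP (has P (iota 0 n.*2))) => [/hasP[k0 _ Pk0]|/hasPn noex].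
  have [p2 [/and4P[lt_pp2 lt_p2 /eqP bp2 lt_m2] _ minp2]] := first_such Pk0.
  apply: (trade_arc G G' sc tM tM' oq ot lt_pq lt_t lt_mq lt_mt full btw lt_mp
            (p2 := p2)) => // [|k lt_k]; first by rewrite lt_pp2.
  case: (leqP k t) => [/under_le //|lt_tk].
  have bk : blk k./2 = blk q./2.
    have := blk_mono (half_leq (ltnW lt_tk)); have := blk_mono (half_leq (ltnW lt_k)).
    by rewrite bp2 bqt => h1 h2; apply/eqP; rewrite eqn_leq h1.
  have := minp2 k lt_k; rewrite /P bk eqxx /=; lia.
apply: (add_arc G G' sc tM oq ot lt_pq lt_t lt_mq lt_mt full btw lt_mp) => k lt_k bk.
case: (leqP k t) => [/under_le //|lt_tk].
by have := noex k; rewrite mem_iota /P bk eqxx /=; lia.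
Qed.

Lemma tight_eqv M M' : good M -> good M' -> same_content M M' ->
  tight (tot M) (mul M) -> tight (tot M) (mul M') -> eqv M M'.
Proof.
have [d] := ubnP (dist (mul M) (mul M')); elim: d M M' => // d IH M M' le_d G G' sc tM tM'.
case: (boolP (has (fun k => mul M k != mul M' k) (iota 0 n.*2))) => [|/hasPn eqm]; last first.
  apply: eqv_same => // k lt_k; have := eqm k; rewrite mem_iota lt_k /= => /(_ isT).
  by rewrite negbK => /eqP.
move=> /hasP[k0]; rewrite mem_iota => lt_k0 nk0.
have [p [np le_p minp]] := @first_such (fun k => mul M k != mul M' k) k0 nk0.
have lt_p : (p < n.*2)%N by lia.
have eq_p k : (k < p)%N -> mul M k = mul M' k by move=> /minp; rewrite negbK => /eqP.
have sc' := same_content_sym sc.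
have tt' k := tot_same_content k sc.
case: (ltngtP (mul M p) (mul M' p)) np => [lt_mp _|lt_mp _|//].
  have [M2 [G2 sc2 t2 e2 lt2]] := closer G G' sc tM tM' lt_p eq_p lt_mp.
  apply: eqv_trans e2 _; first exact: same_content_vsum.
  have tt2 k := tot_same_content k sc2.
  apply: IH => //; first by lia.
  - exact: same_content_trans (same_content_sym sc2) sc.
  - exact: tight_exta t2.
  - exact: tight_exta tM'.
have eq_p' k : (k < p)%N -> mul M' k = mul M k by move=> /eq_p.
have [M2 [G2 sc2 t2 e2 lt2]] :=
  closer G' G sc' (tight_exta tt' tM') (tight_exta tt' tM) lt_p eq_p' lt_mp.
have scM2 := same_content_trans sc sc2.
apply: (eqv_trans (same_content_vsum scM2)); last first.
  by apply: eqv_sym e2; apply: same_content_vsum.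
apply: IH => //; first by rewrite dist_sym; rewrite dist_sym in le_d; lia.
by apply: tight_exta t2 => k; rewrite -tt'.
Qed.

Theorem straighten_two_rows M M' : good M -> good M' -> same_content M M' -> eqv M M'.
Proof.
move=> G G' sc; have [N [GN scN irrN eN]] := reduce G.
have [N' [GN' scN' irrN' eN']] := reduce G'.
have scNN : same_content N N'.
  exact: same_content_trans (same_content_sym scN) (same_content_trans sc scN').
have okN : all arc_ok (arcs N) by case: GN.
have okN' : all arc_ok (arcs N') by case: GN'.
apply: (eqv_trans (same_content_vsum scN) eN).
apply: (@eqv_trans _ N'); [exact: same_content_vsum | | ].
  apply: tight_eqv => //; first exact: tight_mul.
  apply: tight_exta (tight_mul okN' irrN') => k.
  by rewrite (tot_same_content k scNN).
by apply: eqv_sym eN'; apply: same_content_vsum.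
Qed.

End TwoRows.

(** * Crossing a wall *)

Section Rows.
Variables (r n : nat).
Local Notation mon := 'X_{1..r * n}.
Implicit Types (l m : mon) (i : 'I_r) (j : 'I_n) (s : seq 'I_n) (p : pred 'I_n).

Definition mrow i s : mon := (\sum_(j <- s) U_(mxvec_index i j))%MM.

Definition rcount l i p : nat := \sum_(j | p j) l (mxvec_index i j).

Lemma mrowE i s i' j : mrow i s (mxvec_index i' j) = ((i == i') * count (pred1 j) s)%N.
Proof.
rewrite mnm_sumE; elim: s => [|x s IH]; first by rewrite big_nil muln0.
rewrite big_cons IH mnm1E mxvec_index_inj /= mulnDr; congr addn.
by case: (i == i'); rewrite ?mul1n.
Qed.

Lemma mrow_cat i s s' : mrow i (s ++ s') = (mrow i s + mrow i s')%MM.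
Proof. by rewrite /mrow big_cat. Qed.

Lemma mrow_perm i s s' : perm_eq s s' -> mrow i s = mrow i s'.
Proof. by move=> h; rewrite /mrow (perm_big _ h). Qed.

Lemma monP l m : (forall i j, l (mxvec_index i j) = m (mxvec_index i j)) -> l = m.
Proof. by move=> H; apply/mnmP => k; case/mxvec_indexP: k => i j; apply: H. Qed.

Lemma rcountD l m i p : rcount (l + m)%MM i p = (rcount l i p + rcount m i p)%N.
Proof. by rewrite /rcount -big_split; apply: eq_bigr => j _; rewrite mnmDE. Qed.

Lemma rcount_mrow i i' s p : rcount (mrow i s) i' p = ((i == i') * count p s)%N.
Proof.
rewrite (count_letters p) big_distrr /=; apply: eq_bigr => j _; exact: mrowE.
Qed.

Definition antiweight (R : realType) : 'M[R]_(r, n) := \matrix_(i, j) (i * j)%:R.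

Definition posweight l : nat := \sum_(i < r) \sum_(j < n) (i * j * l (mxvec_index i j)).

Lemma posweightD l m : posweight (l + m)%MM = (posweight l + posweight m)%N.
Proof.
rewrite /posweight -big_split; apply: eq_bigr => i _; rewrite -big_split /=.
by apply: eq_bigr => j _; rewrite mnmDE mulnDr.
Qed.

Lemma posweight_mrow i s : posweight (mrow i s) = (i * \sum_(j <- s) j)%N.
Proof.
elim: s => [|x s IH].
  rewrite big_nil muln0 /posweight big1 // => i' _; rewrite big1 // => j _.
  by rewrite /mrow big_nil mnm0E muln0.
rewrite -cat1s mrow_cat posweightD IH big_cons mulnDr; congr addn.
rewrite /posweight (bigD1 i) //= (bigD1 x) //= mrowE !eqxx /= eqxx.
rewrite big1 => [|j nj]; last by rewrite mrowE /= eq_sym (negbTE nj) !muln0.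
rewrite big1 => [|i' ni]; first by lia.
by rewrite big1 // => j _; rewrite mrowE eq_sym (negbTE ni) muln0.
Qed.

Variables (K : fieldType) (u v : 'I_r) (lt_uv : (u < v)%N) (blk : nat -> nat).
Local Notation poly := {mpoly K[r * n]}.

Definition xvar i j : poly := 'X_(mxvec_index i j).

(* The two initial monomials of [mu] times a configuration, on the two sides of the wall. *)
Definition ulab (mu : mon) (M : config n) : mon :=
  (mu + (mrow u (us M ++ qs M) + mrow v (vs M ++ ts M)))%MM.
Definition vlab (mu : mon) (M : config n) : mon :=
  (mu + (mrow u (us M ++ ts M) + mrow v (vs M ++ qs M)))%MM.

Definition gpoly (mu : mon) (M : config n) : poly := 'X_[mu] * cpoly (xvar u) (xvar v) M.

Lemma lead_sides (R : realType) (W : 'M[R]_(r, n))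
    (f g : 'I_n * 'I_n -> 'I_n) (c : K) mu M :
  {in arcs M, forall a, has_lead W (minor2 (xvar u) (xvar v) a)
     (U_(mxvec_index u (f a)) + U_(mxvec_index v (g a)))%MM c} ->
  has_lead W (gpoly mu M)
    (mu + (mrow u (us M ++ map f (arcs M)) + mrow v (vs M ++ map g (arcs M))))%MM
    (c ^+ size (arcs M)).
Proof.
move=> H; have H1 := has_lead_prod_in H.
have H2 (w : 'I_r) s : has_lead W (\prod_(j <- s) xvar w j) (mrow w s) (1 : K).
  have := @has_lead_prod_in K R r n W _ s (xvar w) (fun j => U_(mxvec_index w j))%MM (fun=> 1).
  by rewrite big1_eq; apply => j _; apply: has_leadX.
have := has_leadM (has_leadX K W mu) (has_leadM (has_leadM H1 (H2 u (us M))) (H2 v (vs M))).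
rewrite !mulr1 mul1r big_const_seq count_predT iter_mulr_1 /gpoly /cpoly => HH.
have -> // : (mu + (mrow u (us M ++ map f (arcs M)) + mrow v (vs M ++ map g (arcs M))))%MM =
  (mu + (\sum_(a <- arcs M) (U_(mxvec_index u (f a)) + U_(mxvec_index v (g a))) +
    mrow u (us M) + mrow v (vs M)))%MM.
rewrite !mrow_cat big_split /= {2}/mrow {3}/mrow !big_map.
by apply/mnmP => k; rewrite !mnmDE; lia.
Qed.

Lemma lead_v (R : realType) mu M : all (arc_ok blk) (arcs M) ->
  has_lead (antiweight R) (gpoly mu M) (vlab mu M) ((-1) ^+ size (arcs M)).
Proof.
move=> okA; rewrite /vlab /qs /ts; apply: lead_sides => // -[q t] aA.
have /andP[/= lt_qt _] := allP okA _ aA.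
rewrite /minor2 /= addrC /xvar -!mpolyXD; exists ('X_[U_(mxvec_index u q) + U_(mxvec_index v t)] : poly).
  by rewrite scaleN1r.
move=> m; rewrite msuppX inE => /eqP->; rewrite !mweightD !mweightU !mxE.
by rewrite -!natrD ltr_nat; nia.
Qed.

Lemma lead_u (R : realType) mu M : all (arc_ok blk) (arcs M) ->
  has_lead (- antiweight R) (gpoly mu M) (ulab mu M) 1.
Proof.
move=> okA; rewrite /ulab /qs /ts.
have <- : (1 : K) ^+ size (arcs M) = 1 by rewrite expr1n.
apply: lead_sides => // -[q t] aA; have /andP[/= lt_qt _] := allP okA _ aA.
rewrite /minor2 /= /xvar -!mpolyXD; exists (- 'X_[U_(mxvec_index u t) + U_(mxvec_index v q)] : poly).
  by rewrite scale1r.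
move=> m; rewrite (perm_mem (msuppN _)) msuppX inE => /eqP->; rewrite !mweightD !mweightU !mxE.
by rewrite -!opprD ltrN2 -!natrD ltr_nat; nia.
Qed.

Hypothesis blk_mono : forall a b : nat, (a <= b)%N -> (blk a <= blk b)%N.
Variables (be bb blo bup : mon -> nat -> nat) (base : mon -> Prop).

Definition similar l l' :=
  [/\ forall i j, i != u -> i != v -> l (mxvec_index i j) = l' (mxvec_index i j),
      forall p, (rcount l u p + rcount l v p = rcount l' u p + rcount l' v p)%N
    & forall c, (c < n)%N -> rcount l u (inblk blk c) = rcount l' u (inblk blk c) ].

Hypothesis base_sim : forall l l', similar l l' -> base l -> base l'.
Hypothesis bounds_sim : forall l l' c, similar l l' -> (c < n)%N ->
  [/\ be l c = be l' c, bb l c = bb l' c, blo l c = blo l' c & bup l c = bup l' c].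

Definition clear_rows (mu : mon) :=
  forall j, mu (mxvec_index u j) = 0%N /\ mu (mxvec_index v j) = 0%N.

Definition goodl l := good blk (fun p => rcount l u p + rcount l v p)%N
  (fun c => rcount l u (inblk blk c)) (be l) (bb l) (blo l) (bup l).

Definition feas (mu : mon) (M : config n) :=
  [/\ clear_rows mu, base (ulab mu M) & goodl (ulab mu M) M].

Let neq_vu : (v == u) = false. Proof. by rewrite -val_eqE /= gtn_eqF. Qed.
Let neq_uv : (u == v) = false. Proof. by rewrite eq_sym neq_vu. Qed.

Lemma rcount_clear mu p : clear_rows mu -> rcount mu u p = 0%N /\ rcount mu v p = 0%N.
Proof. by move=> cm; split; rewrite /rcount big1 // => j _; case: (cm j). Qed.

Lemma rcount_ulab mu M p : clear_rows mu ->
  rcount (ulab mu M) u p = count p (us M ++ qs M) /\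
  rcount (ulab mu M) v p = count p (vs M ++ ts M).
Proof.
move=> cm; have [h1 h2] := rcount_clear p cm.
by rewrite /ulab !rcountD !rcount_mrow !eqxx neq_uv neq_vu h1 h2 !mul1n !mul0n addn0.
Qed.

Lemma ulab_entry mu M j : clear_rows mu ->
  ulab mu M (mxvec_index u j) = count (pred1 j) (us M ++ qs M) /\
  ulab mu M (mxvec_index v j) = count (pred1 j) (vs M ++ ts M).
Proof.
move=> cm; have [h1 h2] := cm j.
by rewrite /ulab !mnmDE !mrowE !eqxx neq_uv neq_vu h1 h2 !mul1n !mul0n addn0.
Qed.

Lemma ulab_other mu M i j : i != u -> i != v ->
  ulab mu M (mxvec_index i j) = mu (mxvec_index i j).
Proof.
move=> iu iv; rewrite /ulab !mnmDE !mrowE.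
by rewrite eq_sym (negbTE iu) eq_sym (negbTE iv) !mul0n !addn0.
Qed.

Lemma goodl_ext l l' M : similar l l' -> goodl l M -> goodl l' M.
Proof.
move=> sl [okA tot G]; split=> // [p|c lt_c]; first by case: sl => _ <- _.
have [e1 e2 e3 e4] := bounds_sim sl lt_c; have [_ _ e5] := sl.
by rewrite -e1 -e2 -e3 -e4 -e5 //; apply: G.
Qed.

Lemma letters_sum (s s' : seq 'I_n) :
  (forall p, count p s = count p s') -> (\sum_(j <- s) j = \sum_(j <- s') j)%N.
Proof. by move=> H; apply: perm_big; apply/seq.permP => p; apply: H. Qed.

Lemma posweight_lt mu M M' :
  (forall p, (count p (us M) + count p (vs M) + count p (qs M) + count p (ts M) =
     count p (us M') + count p (vs M') + count p (qs M') + count p (ts M'))%N) ->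
  (vsum M' < vsum M)%N -> (posweight (ulab mu M') < posweight (ulab mu M))%N.
Proof.
move=> tot; rewrite !vsum_cat /ulab !posweightD !posweight_mrow ltn_add2l.
have : (\sum_(j <- (us M ++ qs M) ++ (vs M ++ ts M)) j =
        \sum_(j <- (us M' ++ qs M') ++ (vs M' ++ ts M')) j)%N.
  by apply: letters_sum => p; have := tot p; rewrite !count_cat; lia.
rewrite big_cat [X in _ = X]big_cat /=.
move: (\sum_(j <- us M ++ qs M) _)%N (\sum_(j <- vs M ++ ts M) _)%N => a b.
move: (\sum_(j <- us M' ++ qs M') _)%N (\sum_(j <- vs M' ++ ts M') _)%N => a' b'.
move=> E lt_b; have := lt_uv; have -> : a' = (a + b - b')%N by lia.
by move: (nat_of_ord u) (nat_of_ord v) E lt_b; clear; nia.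
Qed.

Lemma gpoly_straight mu M mu' M' : feas mu M -> feas mu' M' -> ulab mu M = ulab mu' M' ->
  spanned (fun p : poly => exists k : mon * config n,
    [/\ feas k.1 k.2, (posweight (ulab k.1 k.2) < posweight (ulab mu M))%N & p = gpoly k.1 k.2])
    (gpoly mu M - gpoly mu' M').
Proof.
move=> [cm bM GM] [cm' bM' GM'] E.
have Emu : mu' = mu.
  apply: monP => i j; case: (eqVneq i u) => [->|iu].
    by case: (cm j) => ->; case: (cm' j) => ->.
  case: (eqVneq i v) => [->|iv]; first by case: (cm j) => _ ->; case: (cm' j) => _ ->.
  by rewrite -(ulab_other mu M j iu iv) E ulab_other.
subst mu'; have sc : same_content M M'.
  split; apply: perm_letters => j.
    by have [<- _] := ulab_entry M j cm; have [<- _] := ulab_entry M' j cm; rewrite E.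
  by have [_ <-] := ulab_entry M j cm; have [_ <-] := ulab_entry M' j cm; rewrite E.
have GM2 : goodl (ulab mu M) M' by rewrite E.
have := straighten_two_rows blk_mono (xvar u) (xvar v) GM GM2 sc.
rewrite /eqv /gpoly -mulrBr; elim=> [|c g w [M2 [G2 lt2 ->]] _ IH].
  by rewrite mulr0; apply: spanned0.
rewrite mulrDr -scalerAr; apply: spannedS => //; exists (mu, M2) => /=.
have tot p : (count p (us M) + count p (vs M) + count p (qs M) + count p (ts M) =
     count p (us M2) + count p (vs M2) + count p (qs M2) + count p (ts M2))%N.
  by case: GM => _ -> _; case: G2 => _ -> _.
have sim : similar (ulab mu M) (ulab mu M2).
  split=> [i j iu iv|p|c0 lt_c]; first by rewrite !ulab_other.
    have [-> ->] := rcount_ulab M p cm; have [-> ->] := rcount_ulab M2 p cm.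
    by rewrite !count_cat; have := tot p; lia.
  have [_ _ /(_ c0 lt_c)[_ _ _ _ <-]] := G2.
  by have [-> _] := rcount_ulab M2 (inblk blk c0) cm; rewrite count_cat.
split=> //; last exact: posweight_lt.
split=> //; first exact: base_sim bM.
exact: goodl_ext G2.
Qed.

Lemma representatives (T : Type) (L V : eqType) (G : T -> Prop) (P : T -> V) (lab : T -> L)
    (su : seq L) : exists2 w : seq V, (size w <= size su)%N &
  forall x, G x -> lab x \in su -> exists y, [/\ P y \in w, G y & lab y = lab x].
Proof.
elim: su => [|a su [w le_w Hw]]; first by exists [::].
case: (classic (exists y, G y /\ lab y = a)) => [[y [Gy ly]]|ny].
  exists (P y :: w) => // x Gx; rewrite inE => /orP[/eqP E|/(Hw x Gx)[z [zw Gz lz]]].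
    by exists y; split; rewrite ?mem_head // ly.
  by exists z; split=> //; rewrite inE zw orbT.
exists w => [|x Gx]; first exact: leqW.
rewrite inE => /orP[/eqP E|]; last exact: Hw.
by case: ny; exists x.
Qed.

(* The products attached to feasible configurations have distinct initial terms for one
   weight and straighten to one product per label for the other. *)
Theorem wall_crossing (R : realType) (sv su : seq mon) : uniq sv ->
  (forall m, m \in sv -> exists mu M, feas mu M /\ vlab mu M = m) ->
  (forall mu M, feas mu M -> ulab mu M \in su) ->
  (size sv <= size su)%N.
Proof.
move=> uniq_sv Hv Hu.
have [w le_w Hw] := @representatives (mon * config n) _ poly (fun k => feas k.1 k.2)
  (fun k => gpoly k.1 k.2) (fun k => ulab k.1 k.2) su.
apply: leq_trans le_w.
have Hv' (i : 'I_(size sv)) : exists k : mon * config n, feas k.1 k.2 /\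
    vlab k.1 k.2 = nth 0%MM sv i.
  by have [mu [M [fM vE]]] := Hv _ (mem_nth 0%MM (ltn_ord i)); exists (mu, M).
have [k Hk] := fin_all_exists Hv'.
have okA (i : 'I_(size sv)) : all (arc_ok blk) (arcs (k i).2) by have [[_ _ []]] := Hk i.
apply: (@independent_spanned_le _ _ _ _ (fun e : 'I_(size sv) => gpoly (k e).1 (k e).2)
  (fun e : 'I_(size w) => nth 0 w e)).
- apply: (@independent_leads K R r n (antiweight R) _ _ (fun e : 'I_(size sv) => nth 0%MM sv e)
           (fun e => (-1) ^+ size (arcs (k e).2))) => [e e' E|e|e].
  + by apply: val_inj; apply/eqP; rewrite -(nth_uniq 0%MM _ _ uniq_sv) ?ltn_ord // E.
  + by rewrite expf_neq0 // oppr_eq0 oner_neq0.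
  + by have [_ <-] := Hk e; apply: lead_v.
move=> e; have [fi _] := Hk e.
apply: spanned_sub (_ : spanned (fun g => exists2 j : mon * config n,
  gpoly j.1 j.2 \in w & g = gpoly j.1 j.2) _).
  move=> g [j jw ->]; have jl : (index (gpoly j.1 j.2) w < size w)%N by rewrite index_mem.
  by exists (Ordinal jl); rewrite /= nth_index.
have HH := @straighten _ _ (mon * config n) mon (fun k => feas k.1 k.2)
  (fun k => gpoly k.1 k.2) (fun k => ulab k.1 k.2) (@posweight)
  (fun k => gpoly k.1 k.2 \in w) _ _ (k e) fi.
apply: HH.
- by move=> [mu M] [mu' M'] /= f1 f2 E; apply: gpoly_straight.
- by move=> [mu M] f1; apply: Hw => //; apply: Hu.
Qed.

End Rows.

(** * Matchings *)

Lemma least_in (T : eqType) (f : T -> nat) (s : seq T) : s != [::] ->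
  exists2 x, x \in s & forall y, y \in s -> (f x <= f y)%N.
Proof.
elim: s => // a [|b s] IH _; first by exists a => [|y]; rewrite inE // => /eqP->.
have [//|x xs Hx] := IH; case: (leqP (f a) (f x)) => h.
  by exists a => [|y]; rewrite ?mem_head // inE => /orP[/eqP->//|/Hx]; apply: leq_trans.
exists x => [|y]; first by rewrite inE xs orbT.
by rewrite inE => /orP[/eqP->|/Hx //]; apply: ltnW.
Qed.

(* Hall's theorem for laminar neighbourhoods: a neighbour of an [o] least for [f] can be
   matched to it without spoiling the condition for the others. *)
Lemma matching (T1 T2 : eqType) (R : T1 -> T2 -> bool) (cls f : T1 -> nat)
    (O : seq T1) (X : seq T2) :
  (forall o o' x, R o x -> R o' x -> cls o = cls o') ->
  (forall o, o \in O ->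
     (count (fun o' => (cls o' == cls o) && (f o' <= f o)) O <= count (R o) X)%N) ->
  exists s X2, [/\ perm_eq (unzip1 s) O, perm_eq (unzip2 s ++ X2) X
    & all (fun p => R p.1 p.2) s].
Proof.
move=> lamR; have [k] := ubnP (size O); elim: k O X => // k IH O X le_k H.
case: (altP (O =P [::])) => [->|O0]; first by exists [::], X.
have [o oO min_o] := @least_in _ f _ O0.
have /hasP[x xX Rox] : has (R o) X.
  rewrite has_count; apply: leq_trans (H _ oO); rewrite -has_count.
  by apply/hasP; exists o => //; rewrite eqxx leqnn.
have pO := perm_to_rem oO; have pX := perm_to_rem xX.
have [||s [X2 [p1 p2 Rs]]] := IH (rem o O) (rem x X).
- by rewrite size_rem //; case: (O) O0 le_k.
- move=> o2 o2O; have := H o2 (mem_rem o2O).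
  rewrite (seq.permP pO) (seq.permP pX) /=; case: (boolP (R o2 x)) => [R2|_]; last first.
    by rewrite add0n => h; apply: leq_trans h; rewrite leq_addl.
  by rewrite (lamR _ _ _ Rox R2) eqxx min_o ?(mem_rem o2O).
exists ((o, x) :: s), X2; split=> /=; last by rewrite Rox.
  by rewrite perm_sym (perm_trans pO) // perm_cons perm_sym.
by rewrite perm_sym (perm_trans pX) // perm_cons perm_sym.
Qed.

Section Trim.
Variables (n : nat) (blk : nat -> nat).

(* In each block, [s1] consists of the [k] smallest letters of [s]. *)
Lemma trim (k : nat -> nat) (s : seq 'I_n) : exists s1 s2,
  [/\ perm_eq (s1 ++ s2) s, forall c : nat, (count (inblk blk c) s1 <= k (blk c))%N
    & forall c : nat, (count (upto blk c) s2 <= count (upto blk c) s - k (blk c))%N].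
Proof.
have [m] := ubnP (size s); elim: m s => // m IH s le_m.
case: (altP (s =P [::])) => [->|s0]; first by exists [::], [::]; split.
have [z zs max_z] := @least_in _ (fun j : 'I_n => n - j)%N _ s0.
have ps := perm_to_rem zs.
have [|s1 [s2 [p1 H1 H2]]] := IH (rem z s).
  by rewrite size_rem //; case: (s) s0 le_m.
have p2 : perm_eq (z :: (s1 ++ s2)) s by rewrite perm_sym (perm_trans ps) // perm_cons perm_sym.
case: (ltnP (count (inblk blk z) s1) (k (blk z))) => lt_k.
  exists (z :: s1), s2; split=> // c /=.
    case: (boolP (inblk blk c z)) => [/eqP E|_]; last by rewrite add0n.
    by rewrite -E add1n (eq_count (_ : inblk blk c =1 inblk blk z)) // => j; rewrite /inblk E.
  by apply: leq_trans (H2 c) _; apply: leq_sub2r; rewrite (seq.permP ps) leq_addl.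
exists s1, (z :: s2); split=> // [|c].
  by apply: perm_trans p2; rewrite perm_sym; exact/permPl/(perm_catCA [:: z]).
rewrite (seq.permP ps) /=; case: (boolP (upto blk c z)) => [/andP[/eqP E le_zc]|_]; last first.
  by rewrite !add0n; apply: H2.
have up_in : {in s, upto blk c =1 inblk blk c}.
  move=> j js; rewrite /upto /inblk; case: eqP => //= _; apply: leq_trans le_zc.
  by have := max_z j js; have := ltn_ord j; have := ltn_ord z; lia.
have sub t : {subset t <= s} -> count (upto blk c) t = count (inblk blk c) t.
  by move=> h; apply: eq_in_count => j jt; apply/up_in/h.
have e1 : count (upto blk c) (rem z s) = (count (upto blk c) s1 + count (upto blk c) s2)%N.
  by rewrite -(seq.permP p1) count_cat.
rewrite e1 [count _ s1]sub; last first.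
  by move=> j js1; rewrite -(perm_mem p2) inE mem_cat js1 orbT.
have : (k (blk c) <= count (inblk blk c) s1)%N.
  by rewrite -E (eq_count (_ : inblk blk c =1 inblk blk z)) // => j; rewrite /inblk E.
by clear; lia.
Qed.

End Trim.

Section Letters.
Variables (r n : nat).
Local Notation mon := 'X_{1..r * n}.
Implicit Types (l m : mon) (p : pred 'I_n).

Definition row_letters l (i : 'I_r) : seq 'I_n :=
  flatten [seq nseq (l (mxvec_index i j)) j | j <- enum 'I_n].

Lemma count_letters_row l i p : count p (row_letters l i) = rcount l i p.
Proof.
rewrite /rcount count_flatten -map_comp sumnE big_map big_enum /= [RHS]big_mkcond.
by apply: eq_bigr => j _; rewrite /= count_nseq; case: (p j); rewrite ?mul1n ?mul0n.
Qed.

Lemma rcount1 l i j : rcount l i (pred1 j) = l (mxvec_index i j).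
Proof. by rewrite /rcount big_pred1_eq. Qed.

Lemma count_letter l i j : count (pred1 j) (row_letters l i) = l (mxvec_index i j).
Proof. by rewrite count_letters_row rcount1. Qed.

Lemma rcount_eq l l' i p :
  (forall j, l (mxvec_index i j) = l' (mxvec_index i j)) -> rcount l i p = rcount l' i p.
Proof. by move=> H; apply: eq_bigr => j _; rewrite H. Qed.

Lemma size_letters l i : size (row_letters l i) = rcount l i predT.
Proof. by rewrite -count_predT count_letters_row. Qed.

Lemma eq_rcount l i p q : p =1 q -> rcount l i p = rcount l i q.
Proof. by move=> h; apply: eq_bigl. Qed.

End Letters.

(** * From the diagonal field to the block diagonal field *)

Lemma count_sum (T : Type) (p : pred T) (s : seq T) : count p s = (\sum_(x <- s) p x)%N.
Proof. by elim: s => [|x s IH]; rewrite ?big_nil // big_cons /= IH. Qed.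

Lemma leq_sum_in (T : eqType) (s : seq T) (F G : T -> nat) :
  (forall x, x \in s -> (F x <= G x)%N) -> (\sum_(x <- s) F x <= \sum_(x <- s) G x)%N.
Proof.
elim: s => [|x s IH] H; rewrite ?big_nil // !big_cons leq_add ?H ?mem_head // IH // => y ys.
by rewrite H // inE ys orbT.
Qed.

Lemma count_map_filter (T1 T2 : Type) (f : T1 -> T2) (p : pred T2) (a : pred T1) s :
  count p (map f (filter a s)) = count (fun x => p (f x) && a x) s.
Proof. by rewrite count_map count_filter. Qed.

Section Similar.
Variables (r n : nat) (u v : 'I_r) (blk : nat -> nat).
Local Notation mon := 'X_{1..r * n}.
Implicit Types (l m : mon).
Hypothesis neq_uv : u != v.

Lemma sum_blocks (f g : 'I_n -> nat) (p : pred nat) :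
  (forall c : 'I_n, \sum_(j | inblk blk c j) f j = \sum_(j | inblk blk c j) g j)%N ->
  (\sum_(j : 'I_n | p (blk j)) f j = \sum_(j : 'I_n | p (blk j)) g j)%N.
Proof.
move=> H; pose cl (j : 'I_n) := [set j' : 'I_n | blk j' == blk j].
rewrite (partition_big cl predT) // [RHS](partition_big cl predT) //=.
apply: eq_bigr => S _; case: (pickP (fun j : 'I_n => p (blk j) && (cl j == S))) => [c /andP[pc /eqP<-]|nS].
  have E : (fun j : 'I_n => p (blk j) && (cl j == cl c)) =1 inblk blk c.
    move=> j; rewrite /inblk; apply/andP/eqP => [[_ /eqP/setP/(_ j)]|E].
      by rewrite !inE eqxx => /esym/eqP.
    by rewrite E /cl E; split.
  by rewrite !(eq_bigl _ _ E) H.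
by rewrite !big_pred0.
Qed.

Lemma similar_other l l' i p : similar u v blk l l' -> i != u -> i != v ->
  rcount l i p = rcount l' i p.
Proof. by case=> h _ _ iu iv; apply: rcount_eq => j; apply: h. Qed.

Lemma similar_blk l l' (p : pred nat) : similar u v blk l l' ->
  rcount l u (fun j => p (blk j)) = rcount l' u (fun j => p (blk j)) /\
  rcount l v (fun j => p (blk j)) = rcount l' v (fun j => p (blk j)).
Proof.
case=> _ h1 h2; have hu : rcount l u (fun j => p (blk j)) = rcount l' u (fun j => p (blk j)).
  by apply: sum_blocks => c; apply: h2.
by split=> //; have := h1 (fun j => p (blk j)); rewrite hu => /addnI.
Qed.

Lemma similar_row l l' i (p : pred nat) : similar u v blk l l' ->
  rcount l i (fun j => p (blk j)) = rcount l' i (fun j => p (blk j)).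
Proof.
move=> sl; have [hu hv] := similar_blk p sl.
case: (eqVneq i u) => [->//|iu]; case: (eqVneq i v) => [->//|iv].
exact: similar_other iu iv.
Qed.

Lemma arcs_blk (A : seq ('I_n * 'I_n)) (p : pred nat) : all (arc_ok blk) A ->
  count (fun j : 'I_n => p (blk j)) (unzip1 A) = count (fun j : 'I_n => p (blk j)) (unzip2 A).
Proof. by elim: A => //= a A IH /andP[/andP[_ /eqP->] /IH->]. Qed.

End Similar.

Section Rebuild.
Variables (r n : nat) (u v : 'I_r) (blk : nat -> nat).
Hypothesis lt_uv : (u < v)%N.
Local Notation mon := 'X_{1..r * n}.
Implicit Types (l m : mon) (M : config n).

Definition cleared l : mon := (\sum_(i | (i != u) && (i != v)) mrow i (row_letters l i))%MM.

Lemma sum_mrow_row (P : pred 'I_r) (s : 'I_r -> seq 'I_n) i j :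
  (\sum_(k | P k) mrow k (s k))%MM (mxvec_index i j) = (P i * count (pred1 j) (s i))%N.
Proof.
rewrite mnm_sumE; case: (boolP (P i)) => Pi; last first.
  rewrite big1 // => k Pk; rewrite mrowE; case: eqP => // E.
  by rewrite -E Pk in Pi.
rewrite (bigD1 i) //= big1 => [|k /andP[_ ki]]; first by rewrite mrowE eqxx addn0 !mul1n.
by rewrite mrowE (negbTE ki).
Qed.

Lemma cleared_clear l : clear_rows u v (cleared l).
Proof. by move=> j; rewrite !sum_mrow_row !eqxx /= andbF. Qed.

Lemma cleared_other l i j : i != u -> i != v ->
  cleared l (mxvec_index i j) = l (mxvec_index i j).
Proof. by move=> iu iv; rewrite sum_mrow_row iu iv mul1n count_letter. Qed.

Lemma vlab_cleared l M :
  perm_eq (us M ++ ts M) (row_letters l u) -> perm_eq (vs M ++ qs M) (row_letters l v) ->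
  vlab u v (cleared l) M = l.
Proof.
move=> hu hv; have nuv : u != v by rewrite -val_eqE neq_ltn lt_uv.
apply: monP => i j; rewrite /vlab !mnmDE (mrow_perm _ hu) (mrow_perm _ hv) !mrowE !count_letter.
case: (eqVneq i u) => [->|iu].
  by have [-> _] := cleared_clear l j; rewrite mul1n eq_sym (negbTE nuv) addn0.
case: (eqVneq i v) => [->|iv].
  by have [_ ->] := cleared_clear l j; rewrite mul1n.
by rewrite cleared_other // !mul0n !addn0.
Qed.

Lemma ulab_row_other mu M i p : i != u -> i != v -> rcount (ulab u v mu M) i p = rcount mu i p.
Proof. by move=> iu iv; apply: rcount_eq => j; apply: ulab_other. Qed.

Lemma vlab_row_other mu M i p : i != u -> i != v -> rcount (vlab u v mu M) i p = rcount mu i p.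
Proof.
move=> iu iv; apply: rcount_eq => j; rewrite /vlab !mnmDE !mrowE.
by rewrite eq_sym (negbTE iu) eq_sym (negbTE iv) !mul0n !addn0.
Qed.

Lemma feas_intro (be bb blo bup : mon -> nat -> nat) (base : mon -> Prop) mu M :
  clear_rows u v mu -> base (ulab u v mu M) -> all (arc_ok blk) (arcs M) ->
  (forall c, (c < n)%N -> let l := ulab u v mu M in
      [/\ (count (upto blk c) (qs M) <= be l c)%N, (bb l c <= count (upto blk c) (ts M))%N,
          (blo l c <= count (upto blk c) (us M) + count (upto blk c) (ts M))%N
        & (count (upto blk c) (us M) + count (upto blk c) (qs M) <= bup l c)%N]) ->
  feas u v blk be bb blo bup base mu M.
Proof.
move=> cm bl ok H; split=> //; split=> // [p|c lt_c].
  by have [-> ->] := rcount_ulab lt_uv M p cm; rewrite !count_cat; lia.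
have [h1 h2 h3 h4] := H c lt_c; split=> //.
by have [-> _] := rcount_ulab lt_uv M (inblk blk c) cm; rewrite count_cat.
Qed.

Section Paired.
Variables (T : eqType) (s : seq T) (e : pred T) (fq ft : T -> 'I_n) (l : mon).

Definition paired : config n := Config [seq (fq t, ft t) | t <- s & e t]
  [seq ft t | t <- s & ~~ e t] [seq fq t | t <- s & ~~ e t].

Hypotheses (pu : perm_eq (map ft s) (row_letters l u)) (pv : perm_eq (map fq s) (row_letters l v)).
Hypothesis eP : forall t, t \in s -> e t -> (fq t < ft t)%N /\ blk (fq t) = blk (ft t).

Lemma paired_ok : all (arc_ok blk) (arcs paired).
Proof.
apply/allP => _ /mapP[t + ->]; rewrite mem_filter => /andP[et ts].
by have [lt_t E] := eP ts et; rewrite /arc_ok /= lt_t E eqxx.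
Qed.

Lemma paired_u : perm_eq (us paired ++ ts paired) (row_letters l u).
Proof.
apply: perm_trans pu; rewrite /ts /= /unzip2 -map_comp.
by rewrite -map_cat; apply: perm_map; rewrite perm_catC perm_filterC.
Qed.

Lemma paired_v : perm_eq (vs paired ++ qs paired) (row_letters l v).
Proof.
apply: perm_trans pv; rewrite /qs /= /unzip1 -map_comp.
by rewrite -map_cat; apply: perm_map; rewrite perm_catC perm_filterC.
Qed.

Lemma paired_label : vlab u v (cleared l) paired = l.
Proof. by apply: vlab_cleared; [apply: paired_u | apply: paired_v]. Qed.

Lemma paired_counts p :
  (((count p (us paired) = count (fun t => p (ft t) && ~~ e t) s) *
    (count p (vs paired) = count (fun t => p (fq t) && ~~ e t) s)) *
   ((count p (qs paired) = count (fun t => p (fq t) && e t) s) *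
    (count p (ts paired) = count (fun t => p (ft t) && e t) s)))%type.
Proof. by rewrite /qs /ts /= /unzip1 /unzip2 -!map_comp !count_map_filter. Qed.

Lemma paired_other i p : i != u -> i != v ->
  rcount (ulab u v (cleared l) paired) i p = rcount l i p.
Proof.
move=> iu iv; rewrite ulab_row_other //.
by apply: rcount_eq => j; apply: cleared_other.
Qed.

Lemma paired_blk i (p : pred nat) : rcount (ulab u v (cleared l) paired) i (fun j => p (blk j)) =
  rcount l i (fun j => p (blk j)).
Proof.
have [cU cV] := rcount_ulab lt_uv paired (fun j => p (blk j)) (cleared_clear l).
case: (eqVneq i u) => [->|iu].
  rewrite cU -[RHS]count_letters_row -(seq.permP paired_u) !count_cat; congr addn.
  exact: arcs_blk paired_ok.
case: (eqVneq i v) => [->|iv]; last exact: paired_other.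
rewrite cV -[RHS]count_letters_row -(seq.permP paired_v) !count_cat; congr addn.
by symmetry; exact: arcs_blk paired_ok.
Qed.

End Paired.

End Rebuild.

Section Steps.
Variables (r n d : nat) (hr : (3 <= r)%N) (blk : nat -> nat).
Hypothesis blk_mono : forall a b : nat, (a <= b)%N -> (blk a <= blk b)%N.
Local Notation mon := 'X_{1..r * n}.
Implicit Types (l m : mon) (i k : 'I_r) (j : 'I_n).

(* Rows 1, 2, 3 of the paper, where row 3 is the one with block weights. *)
Definition rx : 'I_r := Ordinal (leq_trans (isT : 0 < 3)%N hr).
Definition ry : 'I_r := Ordinal (leq_trans (isT : 1 < 3)%N hr).
Definition rz : 'I_r := Ordinal (leq_trans (isT : 2 < 3)%N hr).

Definition in_older (c : nat) j := (blk j < blk c)%N.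
Definition in_until (c : nat) j := (blk j <= blk c)%N.
Definition in_beyond (c : nat) j := (blk j == blk c) && (c < j)%N.
Definition in_before (c : nat) j := (blk j == blk c) && (j < c)%N.

Definition interlaced l i k :=
  forall c : nat, (rcount l k (fun j => j <= c)%N <= rcount l i (fun j => j < c)%N)%N.

Definition full l := forall i, rcount l i predT = d.

Definition tail_chain l := forall i k, (3 <= i)%N -> k = i.+1 :> nat -> interlaced l i k.

Definition above l i := forall k, k = 3 :> nat -> interlaced l i k.

(* The contents of the diagonal matching field for the row order z < x < y < 3 < ... *)
Definition V0 l := [/\ full l, interlaced l rz rx, interlaced l rx ry, above l ry & tail_chain l].

Definition both l i k (p : pred 'I_n) := (rcount l i p + rcount l k p)%N.

(* First wall (rows x and z): it leads from the diagonal field to the field whose columns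
   have z in an older block than x, or x < z in the same block, and y larger than both. *)
Definition base1 l :=
  [/\ full l, above l ry, tail_chain l & rcount l ry (fun j => j <= 0)%N = 0%N].
Definition cap1 l c := both l rx rz (upto blk c).
Definition arc_floor1 l c :=
  (rcount l rx (in_until c) - rcount l rz (in_older c) - both l rx rz (in_beyond c))%N.
Definition top_floor1 l c := (rcount l ry (fun j => j <= c.+1)%N - rcount l rx (in_older c))%N.

Lemma interlaced_sim (u v : 'I_r) l l' i k : similar u v blk l l' -> i != u -> i != v -> k != u -> k != v ->
  interlaced l i k -> interlaced l' i k.
Proof.
by move=> sl iu iv ku kv H c; rewrite -!(similar_other _ sl) // H.
Qed.

Lemma full_sim (u v : 'I_r) l l' : u != v -> similar u v blk l l' -> full l -> full l'.
Proof. by move=> uv sl F i; rewrite -(similar_row i predT sl) F. Qed.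

Lemma tail_sim (u v : 'I_r) l l' : (u < 3)%N -> (v < 3)%N -> similar u v blk l l' ->
  tail_chain l -> tail_chain l'.
Proof.
move=> u3 v3 sl H i k i3 ki; apply: (interlaced_sim sl); last exact: H.
all: by rewrite -val_eqE /=; lia.
Qed.

Lemma base1_sim l l' : similar rx rz blk l l' -> base1 l -> base1 l'.
Proof.
move=> sl [h1 h2 h3 h4]; split.
- exact: full_sim sl h1.
- by move=> k k3; apply: (interlaced_sim sl) (h2 k k3); rewrite // -val_eqE /= k3.
- exact: tail_sim sl h3.
- by rewrite -(similar_other _ sl).
Qed.

Lemma bounds1_sim l l' c : similar rx rz blk l l' -> (c < n)%N ->
  [/\ cap1 l c = cap1 l' c, arc_floor1 l c = arc_floor1 l' c, top_floor1 l c = top_floor1 l' c & cap1 l c = cap1 l' c].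
Proof.
move=> sl _; have [_ h _] := sl.
have E p : both l rx rz p = both l' rx rz p by apply: h.
rewrite /cap1 /arc_floor1 /top_floor1 !E (similar_other (i := ry) _ sl) //.
rewrite (similar_row rx (fun b => b <= blk c)%N sl) (similar_row rz (fun b => b < blk c)%N sl).
by rewrite (similar_row rx (fun b => b < blk c)%N sl).
Qed.

Lemma rx_rz : (rx < rz)%N. Proof. by []. Qed.
Lemma ry_rz : (ry < rz)%N. Proof. by []. Qed.

Lemma full_size l i : full l -> size (row_letters l i) = d.
Proof. by move=> F; rewrite size_letters F. Qed.

Lemma match_rows l i k : full l -> interlaced l i k ->
  exists s : seq ('I_n * 'I_n), [/\ perm_eq (unzip1 s) (row_letters l k),
    perm_eq (unzip2 s) (row_letters l i) & all (fun p : 'I_n * 'I_n => p.2 < p.1)%N s].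
Proof.
move=> F H; have [//||s [X2 [p1 p2 Rs]]] := @matching _ _ (fun o x : 'I_n => x < o)%N
   (fun=> 0%N) (fun o => o) (row_letters l k) (row_letters l i).
  move=> o _; have := H o; rewrite -!count_letters_row.
  by rewrite (eq_count (_ : (fun o' : 'I_n => (0 == 0) && (o' <= o)) =1 (fun j => j <= o)))%N.
exists s; split=> //; suff E : X2 = [::] by rewrite E cats0 in p2.
have := perm_size p2; have := perm_size p1; rewrite !full_size // size_cat !size_map => ->.
by case: (X2) => // ? ?; rewrite /=; lia.
Qed.

Definition feas1 := feas rx rz blk cap1 arc_floor1 top_floor1 cap1 base1.
Definition ulab1 := @ulab r n rx rz.
Definition vlab1 := @vlab r n rx rz.

Lemma older_upto c j : (j <= c)%N = in_older c j || upto blk c j :> bool.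
Proof.
rewrite /in_older /upto; case: (leqP j c) => [/blk_mono|/ltnW/blk_mono]; clear; lia.
Qed.

Lemma older_upto_count (c : nat) (s : seq 'I_n) :
  count (fun j => j <= c)%N s = (count (in_older c) s + count (upto blk c) s)%N.
Proof.
rewrite -count_predUI [X in (_ + X)%N](eq_count (a2 := pred0)) ?count_pred0 ?addn0.
  by apply: eq_count => j; rewrite /= older_upto.
by move=> j; rewrite /= /in_older /upto; case: ltngtP.
Qed.

Lemma V0_vlab l : V0 l -> exists mu M, feas1 mu M /\ vlab1 mu M = l.
Proof.
move=> [F zx xy ay tc]; have [s [px pz Rs]] := match_rows F zx.
pose e (p : 'I_n * 'I_n) := blk p.1 == blk p.2.
have Rs' p : p \in s -> (p.2 < p.1)%N by move=> ps; apply: (allP Rs).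
have eP t : t \in s -> e t -> (t.2 < t.1)%N /\ blk t.2 = blk t.1 by move=> /Rs' h /eqP.
pose M := paired s e (fun t => t.2) (fun t => t.1).
have pu := paired_u e (fun t => t.2) px; have pv := paired_v e (fun t => t.1) pz.
have oth := @paired_other r n rx rz _ s e (fun t => t.2) (fun t => t.1) l.
have pb := paired_blk rx_rz px pz eP.
have cm := @cleared_clear r n rx rz l.
exists (cleared rx rz l), M; split; last exact: paired_label.
apply: feas_intro => // [||c lt_c]; last first.
- cbv zeta; have cU1 p := proj1 (rcount_ulab rx_rz M p cm).
  have cU2 p := proj2 (rcount_ulab rx_rz M p cm).
  have E : rcount (ulab rx rz (cleared rx rz l) M) rx (in_older c) = rcount l rx (in_older c).
    exact: (pb rx (fun b => b < blk c)%N).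
  rewrite /cap1 /arc_floor1 /top_floor1 /both (oth ry) // E !cU1 !cU2 !count_cat.
  split; try by lia.
    rewrite !leq_subLR !(paired_counts s e (fun t => t.2) (fun t => t.1))  !(@count_sum ('I_n * 'I_n)%type) -!big_split; apply: leq_sum_in => -[x z] /Rs'.
    rewrite /e /= /in_until /in_older /in_beyond /upto => lt_zx; have := blk_mono (ltnW lt_zx).
    case: (ltngtP (blk z) (blk x)) => // [h _|h _]; rewrite ?h ?eqxx ?andbT ?andbF /=.
      by move: h; clear; lia.
    by move: lt_zx; clear; lia.
  rewrite leq_subLR -(count_cat (upto blk c)) (seq.permP pu) -!count_letters_row -older_upto_count.
  by rewrite !count_letters_row; apply: xy.
- exact: paired_ok eP.
split=> [i|k k3 c|i k i3 ki c|].
- by rewrite (pb i predT) F.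
- by rewrite !oth //; [apply: ay | rewrite -val_eqE /= k3..].
- by rewrite !oth //; [apply: tc | rewrite -val_eqE /=; move: i3 ki; clear; lia..].
- by rewrite oth //; apply/eqP; rewrite -leqn0; have := xy 0%N; rewrite [X in (_ <= X)%N]big_pred0.
Qed.

End Steps.

Section Steps2.
Variables (r n d : nat) (hr : (3 <= r)%N) (blk : nat -> nat).
Hypothesis blk_mono : forall a b : nat, (a <= b)%N -> (blk a <= blk b)%N.
Local Notation mon := 'X_{1..r * n}.
Implicit Types (l m : mon) (i k : 'I_r) (j : 'I_n).
Local Notation rx := (rx hr).
Local Notation ry := (ry hr).
Local Notation rz := (rz hr).
Local Notation older := (in_older blk).
Local Notation until := (in_until blk).
Local Notation before := (in_before blk).
Local Notation interlaced := (@interlaced r n).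
Local Notation full := (@full r n d).
Local Notation above := (@above r n).
Local Notation tail_chain := (@tail_chain r n).

Definition row3 l (c : nat) : nat :=
  (\sum_(k : 'I_r | k == 3 :> nat) rcount l k (fun j => j <= c))%N.

(* Second wall (rows y and z): each bound is the sum over the columns of an inequality
   valid for a single column of the intermediate field. *)
Definition base2 l :=
  [/\ full l, tail_chain l, row3 l 0 = 0%N,
     (forall c, (rcount l ry (older c) <= rcount l rx (older c))%N)
   & (forall c, (rcount l rx (until c) <= rcount l rz (until c))%N)].
Definition left_cap2 l c := rcount l rx (before c).
Definition row_cap2 l c := (rcount l rx (before c) + rcount l rx (older c) - rcount l ry (older c))%N.
Definition top_floor2 l c := maxn (row3 l c.+1 - rcount l ry (older c))
  (both l ry rz (upto blk c) + rcount l rx (until c) -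
    (rcount l rx (before c) + rcount l rz (until c))).
Definition arc_floor2 l c :=
  (both l ry rz (upto blk c) + rcount l rx (until c) + rcount l ry (older c) -
    (rcount l rx (before c) + rcount l rx (older c) + rcount l rz (until c)))%N.

Lemma row3_sim l l' c : similar ry rz blk l l' -> row3 l c = row3 l' c.
Proof.
move=> sl; apply: eq_bigr => k /eqP k3; apply: similar_other sl _ _.
all: by rewrite -val_eqE /= k3.
Qed.

Lemma base2_sim l l' : similar ry rz blk l l' -> base2 l -> base2 l'.
Proof.
move=> sl [h1 h2 h3 h4 h5]; split.
- exact: full_sim sl h1.
- exact: tail_sim sl h2.
- by rewrite -(row3_sim _ sl).
- move=> c; have := h4 c; rewrite (similar_row ry (fun b => b < blk c)%N sl) //.
  by rewrite (similar_row rx (fun b => b < blk c)%N sl).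
- move=> c; have := h5 c; rewrite (similar_row rz (fun b => b <= blk c)%N sl) //.
  by rewrite (similar_row rx (fun b => b <= blk c)%N sl).
Qed.

Lemma bounds2_sim l l' c : similar ry rz blk l l' -> (c < n)%N ->
  [/\ left_cap2 l c = left_cap2 l' c, arc_floor2 l c = arc_floor2 l' c, top_floor2 l c = top_floor2 l' c & row_cap2 l c = row_cap2 l' c].
Proof.
move=> sl _; have [_ h _] := sl.
have E p : both l ry rz p = both l' ry rz p by apply: h.
rewrite /left_cap2 /arc_floor2 /top_floor2 /row_cap2 !E (row3_sim _ sl) !(similar_other (i := rx) _ sl) //.
rewrite (similar_row ry (fun b => b < blk c)%N sl) //.
by rewrite (similar_row rz (fun b => b <= blk c)%N sl).
Qed.

Definition feas2 := feas ry rz blk left_cap2 arc_floor2 top_floor2 row_cap2 base2.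
Definition ulab2 := @ulab r n ry rz.
Definition vlab2 := @vlab r n ry rz.
Local Notation feas1 := (feas1 d hr blk).
Local Notation ulab1 := (@ulab1 r n hr).

Lemma last_of_block j : exists c : 'I_n, blk c = blk j /\ forall k : 'I_n, blk k = blk j -> (k <= c)%N.
Proof.
have [|c] := @least_in _ (fun k : 'I_n => n - k)%N [seq k : 'I_n <- enum 'I_n | blk k == blk j].
  by apply/eqP => E; have : j \in [::] by rewrite -E mem_filter eqxx mem_enum.
rewrite mem_filter => /andP[/eqP bc _] H; exists c; split=> // k bk.
have := H k; rewrite mem_filter bk eqxx mem_enum => /(_ isT).
by have := ltn_ord k; have := ltn_ord c; clear; lia.
Qed.

Lemma feas1_columns mu M : feas1 mu M -> let l := ulab1 mu M in
  exists C : seq ('I_n * 'I_n),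
   [/\ perm_eq (unzip1 C) (row_letters l rx), perm_eq (unzip2 C) (row_letters l rz),
       all (fun p : 'I_n * 'I_n => (blk p.2 < blk p.1) || ((p.1 < p.2) && (blk p.1 == blk p.2)))%N C
     & forall p, count p (map (fun t : 'I_n * 'I_n => if (t.1 < t.2)%N then t.2 else t.1) C) =
         count p (us M ++ ts M)].
Proof.
move=> [cm [F ay tc y0] [okA _ G]] l.
have cX p : rcount l rx p = count p (us M ++ qs M) by have [] := rcount_ulab (rx_rz hr) M p cm.
have cZ p : rcount l rz p = count p (vs M ++ ts M) by have [] := rcount_ulab (rx_rz hr) M p cm.
have szA : size (qs M) = size (ts M) by rewrite !size_map.
have sz : size (us M) = size (vs M).
  have := F rx; have := F rz; rewrite cX cZ !count_predT !size_cat; lia.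
have [//||s [X2 [p1 p2 Rs]]] := @matching _ _ (fun o x : 'I_n => blk x < blk o)%N
   (fun=> 0%N) (fun o => blk o) (us M) (vs M).
  move=> o _; rewrite (eq_count (_ : (fun o' : 'I_n => (0 == 0) && (blk o' <= blk o)) =1 until o))%N //.
  have [c [bc max_c]] := last_of_block o; have [_ + _ _ _] := G c (ltn_ord c).
  rewrite /arc_floor1 /both !cX !cZ !count_cat.
  have n0 (s : seq 'I_n) : count (in_beyond blk c) s = 0%N.
    apply/eqP; rewrite -leqn0 leqNgt -has_count; apply/hasPn => j _.
    rewrite /in_beyond negb_and -leqNgt; case: eqP => //= E.
    by apply: max_c; rewrite E bc.
  rewrite !n0 addn0 subn0.
  have e1 (s : seq 'I_n) : count (until c) s = (count (older c) s + count (inblk blk c) s)%N.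
    elim: s => //= j s ->; rewrite /in_until /in_older /inblk /in_until /in_older.
    by case: ltngtP; rewrite /=; clear; lia.
  have -> : count (until o) (us M) = count (until c) (us M).
    by apply: eq_count => j; rewrite /in_until bc.
  have -> : count (fun x : 'I_n => blk x < blk o)%N (vs M) = count (older c) (vs M).
    by apply: eq_count => j; rewrite /in_older bc.
  have := arcs_blk (fun b => b <= blk c)%N okA; have := e1 (ts M).
  have : (count (upto blk c) (ts M) <= count (inblk blk c) (ts M))%N.
    by apply: sub_count => j /andP[].
  rewrite -/(ts M) -/(qs M) -/(until c).
  move: (count (until c) (us M)) (count (until c) (qs M)) (count (until c) (ts M)) => A B C.
  clear; lia.
have X20 : X2 = [::].
  have := perm_size p2; have := perm_size p1; rewrite size_cat !size_map sz => -> .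
  by case: (X2) => // ? ?; rewrite /=; lia.
rewrite X20 cats0 in p2.
have okA' : all (fun p : 'I_n * 'I_n => p.1 < p.2)%N (arcs M).
  by apply: sub_all okA => p /andP[].
have Rs' : all (fun p : 'I_n * 'I_n => p.2 < p.1)%N s.
  apply: sub_all Rs => p /= h; rewrite ltnNge; apply/negP => /blk_mono.
  by move: h; clear; lia.
exists (s ++ arcs M); split.
- apply/seq.permP => p; rewrite count_letters_row cX /unzip1 map_cat !count_cat.
  by rewrite (seq.permP p1).
- apply/seq.permP => p; rewrite count_letters_row cZ /unzip2 map_cat !count_cat.
  by rewrite (seq.permP p2).
- rewrite all_cat; apply/andP; split; first by apply: sub_all Rs => p /= ->.
  by apply: sub_all okA => p; rewrite /arc_ok => ->; rewrite orbT.
move=> p; rewrite map_cat !count_cat -(seq.permP p1); congr addn; congr (count p _).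
  by apply/eq_in_map => t /(allP Rs') h; rewrite ltnNge ltnW.
by apply/eq_in_map => t /(allP okA') h; rewrite h.
Qed.

Lemma feas1_vlab2 mu M : feas1 mu M -> exists mu' M', feas2 mu' M' /\ vlab2 mu' M' = ulab1 mu M.
Proof.
move=> fM; have [C [pX pZ HC topC]] := feas1_columns fM.
case: fM => cm; rewrite -/(ulab1 mu M); set l := ulab1 mu M in pX pZ * => -[F ay tc y0] [okA _ G].
pose top (t : 'I_n * 'I_n) := if (t.1 < t.2)%N then t.2 else t.1.
have lo_y c : (c < n)%N -> (rcount l ry (fun j => j <= c.+1)%N <= count (fun j => j <= c)%N (map top C))%N.
  move=> lt_c; rewrite topC (older_upto_count blk_mono).
  have [_ _ + _ _] := G c lt_c; rewrite /top_floor1 leq_subLR => h; apply: leq_trans h _.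
  rewrite -count_cat leq_add2r.
  have [-> _] := rcount_ulab (rx_rz hr) M (older c) cm; rewrite !count_cat leq_add2l.
  by rewrite (arcs_blk (fun b => b < blk c)%N okA).
have [//||s [X2 [p1 p2 Rs]]] := @matching _ _ (fun (o : 'I_n) t => top t < o)%N
   (fun=> 0%N) (fun o => o) (row_letters l ry) C.
  move=> o _; rewrite count_letters_row.
  rewrite (eq_rcount _ _ (_ : (fun o' : 'I_n => (0 == 0) && (o' <= o)) =1 (fun j => j <= o)))%N //.
  case: (o : nat) (ltn_ord o) => [|c] lt_c; first by rewrite y0.
  by apply: leq_trans (lo_y c (ltnW lt_c)) _; rewrite count_map.
have X20 : X2 = [::].
  have := perm_size p2; have := perm_size p1; rewrite (full_size _ F) size_cat !size_map => ->.
  rewrite -[size C](size_map fst) (perm_size pX) (full_size _ F).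
  by case: (X2) => // ? ?; rewrite /=; clear; lia.
rewrite X20 cats0 in p2; clear X20 X2.
have pXs : perm_eq [seq t.2.1 | t <- s] (row_letters l rx).
  by apply: perm_trans pX; have := perm_map fst p2; rewrite /unzip2 -map_comp.
have pZs : perm_eq [seq t.2.2 | t <- s] (row_letters l rz).
  by apply: perm_trans pZ; have := perm_map snd p2; rewrite /unzip2 -map_comp.
have sP t : t \in s -> [/\ (t.2.1 < t.1)%N, (t.2.2 < t.1)%N &
    (blk t.2.2 < blk t.2.1)%N \/ (t.2.1 < t.2.2)%N /\ blk t.2.1 = blk t.2.2].
  move=> ts; have := allP Rs _ ts; have := allP HC t.2.
  rewrite -(perm_mem p2) => /(_ (map_f _ ts)) /orP h; rewrite /top.
  have {h}h : (blk t.2.2 < blk t.2.1)%N \/ (t.2.1 < t.2.2)%N /\ blk t.2.1 = blk t.2.2.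
    by case: h => [h|/andP[h1 /eqP h2]]; [left | right].
  move=> h'; suff [? ?] : (t.2.1 < t.1)%N /\ (t.2.2 < t.1)%N by split.
  move: h'; clear; rewrite /=; case: t => y [x z] /=; case: (ltnP x z) => h1 h2.
    by split=> //; exact: leq_trans h1 (ltnW h2).
  by split=> //; exact: leq_ltn_trans h1 h2.
pose e (t : 'I_n * ('I_n * 'I_n)) := (blk t.2.1 == blk t.2.2) && (blk t.2.2 == blk t.1).
pose fq (t : 'I_n * ('I_n * 'I_n)) := t.2.2; pose ft (t : 'I_n * ('I_n * 'I_n)) := t.1.
have eP t : t \in s -> e t -> (fq t < ft t)%N /\ blk (fq t) = blk (ft t).
  by move=> /sP[_ h _] /andP[_ /eqP].
have oth := @paired_other r n ry rz _ s e fq ft l.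
have pb := paired_blk (ry_rz hr) p1 pZs eP.
have cm2 := @cleared_clear r n ry rz l.
set M2 := paired s e fq ft in oth pb *.
exists (cleared ry rz l), M2; split; last exact: paired_label p1 pZs.
set l2 := ulab _ _ _ _ in oth pb.
have RX p : rcount l2 rx p = count (fun t => p t.2.1) s.
  by rewrite oth // -count_letters_row -(seq.permP pXs) count_map.
have RYo c : rcount l2 ry (older c) = count (fun t => older c t.1) s.
  by rewrite (pb ry (fun b => b < blk c)%N) -count_letters_row -(seq.permP p1) count_map.
have RZu c : rcount l2 rz (until c) = count (fun t => until c t.2.2) s.
  by rewrite (pb rz (fun b => b <= blk c)%N) -count_letters_row -(seq.permP pZs) count_map.
have R3 c : row3 l2 c = row3 l c.
  by apply: eq_bigr => k /eqP k3; apply: oth; rewrite -val_eqE /= k3.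
have monoP t : t \in s -> (blk t.2.1 <= blk t.1)%N /\ (blk t.2.2 <= blk t.1)%N.
  by case/sP => /ltnW/blk_mono ? /ltnW/blk_mono ? _.
apply: feas_intro => //.
- split=> [i|i k i3 ki c||c|c].
  + by rewrite (pb i predT) F.
  + by rewrite !oth //; [apply: tc | rewrite -val_eqE /=; move: i3 ki; clear; lia..].
  + rewrite R3 /row3 big1 // => k /eqP k3; apply/eqP; rewrite -leqn0.
    by have := ay k k3 0%N; rewrite [X in (_ <= X)%N]big_pred0.
  + rewrite RX RYo !(@count_sum ('I_n * ('I_n * 'I_n))%type); apply: leq_sum_in => -[y [x z]] ts.
    by have [/= h _] := monoP _ ts; rewrite /in_older /=; move: h; clear; lia.
  + rewrite RX RZu !(@count_sum ('I_n * ('I_n * 'I_n))%type); apply: leq_sum_in => -[y [x z]] ts.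
    have [_ _ /= h] := sP _ ts; have : (blk z <= blk x)%N by case: h => [/ltnW|[_ ->]].
    by rewrite /in_until /=; clear; lia.
- exact: paired_ok eP.
move=> c lt_c; rewrite -/l2 /=.
have cY p := proj1 (rcount_ulab (ry_rz hr) M2 p cm2).
have cZ p := proj2 (rcount_ulab (ry_rz hr) M2 p cm2).
have pc := paired_counts s e fq ft.
have ex6 : forall t, t \in s -> exists y x z, [/\ t = (y, (x, z)), (x < y)%N, (z < y)%N,
    (blk x <= blk y)%N & ((blk z < blk x)%N /\ e t = false) \/
      [/\ (x < z)%N, blk x = blk z & e t = (blk z == blk y)]].
  move=> [y [x z]] ts; exists y, x, z; have [/= h1 h2 h3] := sP _ ts.
  split=> //; first by have [] := monoP _ ts.
  case: h3 => [h|[h1' h2']]; [left | right]; rewrite /e /=.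
    by rewrite gtn_eqF.
  by split=> //; rewrite h2' eqxx.
have C1 : (count (upto blk c) (qs M2) <= left_cap2 l2 c)%N.
  rewrite /left_cap2 RX pc !(@count_sum ('I_n * ('I_n * 'I_n))%type); apply: leq_sum_in => t ts.
  have [y [x [z [-> h1 h2 h3 []]]]] := ex6 t ts; rewrite /fq /in_before /upto /=.
    by case=> _ ->; rewrite andbF.
  by case=> h4 h5 _; move: h1 h2 h3 h4 h5; clear; lia.
have leBR (a b e0 : nat) : (a + b <= e0)%N -> (a <= e0 - b)%N by clear; lia.
have cT p : (count p (us M2) + count p (ts M2))%N = count p (row_letters l ry).
  by rewrite -(count_cat p (us M2)); exact: (seq.permP (paired_u e fq p1)).
split=> //.
- rewrite /arc_floor2 leq_subLR /both cY cZ !count_cat RYo RZu !RX !pc.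
  rewrite !(@count_sum ('I_n * ('I_n * 'I_n))%type) -!big_split; apply: leq_sum_in => t ts.
  have [y [x [z [-> h1 h2 h3 h4]]]] := ex6 t ts; rewrite /fq /ft /in_before /in_until /in_older /upto /=.
  case: h4 => [[h4 ->]|[h4 h5 ->]]; first by rewrite !andbF !andbT; move: h1 h2 h3 h4; clear; lia.
  rewrite h5 in h3 *; case: (altP (blk z =P blk y)) => [<-|h6]; rewrite ?andbF ?andbT.
    by move: h1 h2 h4; clear; lia.
  by move: h1 h2 h3 h4 h6; clear; lia.
- rewrite /top_floor2 geq_max; apply/andP; split.
    rewrite leq_subLR R3 cT (pb ry (fun b => b < blk c)%N) -count_letters_row.
    rewrite -(older_upto_count blk_mono) count_letters_row /row3.
    case: (pickP (fun k : 'I_r => k == 3 :> nat)) => [k /eqP k3|no3]; last by rewrite big_pred0.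
    rewrite (big_pred1 k) => [|k']; last by rewrite [RHS]/= -val_eqE [in RHS]/= k3.
    exact: ay.
  rewrite leq_subLR /both cY cZ !count_cat RZu !RX !pc.
  rewrite !(@count_sum ('I_n * ('I_n * 'I_n))%type) -!big_split; apply: leq_sum_in => t ts.
  have [y [x [z [-> h1 h2 h3 h4]]]] := ex6 t ts; rewrite /fq /ft /in_before /in_until /upto /=.
  case: h4 => [[h4 ->]|[h4 h5 ->]]; first by rewrite !andbF !andbT; move: h1 h2 h3 h4; clear; lia.
  rewrite h5 in h3 *; case: (altP (blk z =P blk y)) => [<-|h6]; rewrite ?andbF ?andbT.
    by move: h1 h2 h4; clear; lia.
  by move: h1 h2 h3 h4 h6; clear; lia.
rewrite /row_cap2; apply: leBR; rewrite RYo !RX !pc.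
rewrite !(@count_sum ('I_n * ('I_n * 'I_n))%type) -!big_split; apply: leq_sum_in => t ts.
have [y [x [z [-> h1 h2 h3 h4]]]] := ex6 t ts; rewrite /fq /ft /in_before /in_older /upto /=.
case: h4 => [[h4 ->]|[h4 h5 ->]]; first by rewrite !andbF !andbT; move: h1 h2 h3 h4; clear; lia.
rewrite h5 in h3 *; case: (altP (blk z =P blk y)) => [<-|h6]; rewrite ?andbF ?andbT.
  by move: h1 h2 h4; clear; lia.
by move: h1 h2 h3 h4 h6; clear; lia.
Qed.

End Steps2.

Lemma split_sum (A B C : eqType) (s : seq ((A + B) * C)) (a : seq A) (b : seq B) :
  perm_eq (unzip1 s) (map inl a ++ map inr b) ->
  exists (sa : seq (A * C)) (sb : seq (B * C)),
    [/\ perm_eq s (map (fun p => (inl p.1, p.2)) sa ++ map (fun p => (inr p.1, p.2)) sb),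
        perm_eq (unzip1 sa) a & perm_eq (unzip1 sb) b].
Proof.
move=> ps; have [sa [sb E]] : exists (sa : seq (A * C)) (sb : seq (B * C)),
    perm_eq s (map (fun p => (inl p.1, p.2)) sa ++ map (fun p => (inr p.1, p.2)) sb).
  elim: s {ps} => [|[[x|x] y] s [sa [sb E]]]; first by exists [::], [::].
    by exists ((x, y) :: sa), sb; rewrite /= perm_cons.
  exists sa, ((x, y) :: sb); apply: perm_trans (_ : perm_eq _ ((inr x, y) :: _)) _.
    by rewrite perm_cons; exact: E.
  exact/permPl/(perm_catCA [:: _]).
pose gl (o : A + B) := if o is inl x then Some x else None.
pose gr (o : A + B) := if o is inr y then Some y else None.
have glE (u : seq A) (v : seq B) : pmap gl (map inl u ++ map inr v) = u.
  by elim: u => [|x u IH]; [elim: v | rewrite /= IH].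
have grE (u : seq A) (v : seq B) : pmap gr (map inl u ++ map inr v) = v.
  by elim: u => [|x u IH] //=; elim: v => //= y v ->.
have E1 : perm_eq (map inl (unzip1 sa) ++ map inr (unzip1 sb)) (map inl a ++ map inr b).
  apply: perm_trans ps; rewrite perm_sym; apply: perm_trans (perm_map fst E) _.
  by rewrite map_cat -!map_comp.
exists sa, sb; split=> //.
  by have := perm_pmap gl E1; rewrite !glE.
by have := perm_pmap gr E1; rewrite !grE.
Qed.

Section Target.
Variables (r n d : nat) (hr : (3 <= r)%N) (blk : nat -> nat).
Hypothesis blk_mono : forall a b : nat, (a <= b)%N -> (blk a <= blk b)%N.
Local Notation mon := 'X_{1..r * n}.
Implicit Types (l m : mon) (i k : 'I_r) (j : 'I_n).
Local Notation rx := (rx hr).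
Local Notation ry := (ry hr).
Local Notation rz := (rz hr).
Local Notation older := (in_older blk).
Local Notation until := (in_until blk).
Local Notation before := (in_before blk).
Local Notation feas2 := (feas2 d hr blk).
Local Notation ulab2 := (@ulab2 r n hr).

Definition precedes (z x : nat) := (blk z < blk x)%N || ((blk z == blk x) && (x < z)%N).

Definition triple_ok (t : 'I_n * ('I_n * 'I_n)) :=
  [&& (t.1 < t.2.1)%N, precedes t.2.2 t.1 & precedes t.2.2 t.2.1].

Definition top3 (t : 'I_n * ('I_n * 'I_n)) := if (t.2.1 < t.2.2)%N then t.2.2 else t.2.1.

Lemma until_older c (s : seq 'I_n) :
  count (until c) s = (count (older c) s + count (inblk blk c) s)%N.
Proof.
elim: s => //= j s ->; rewrite /inblk /in_until /in_older.
by case: ltngtP; rewrite /=; clear; lia.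
Qed.

Lemma same_blk (T : eqType) (s : seq T) (f g : T -> 'I_n) (p : pred nat) :
  {in s, forall t, blk (f t) = blk (g t)} ->
  count (fun j : 'I_n => p (blk j)) (map f s) = count (fun j : 'I_n => p (blk j)) (map g s).
Proof.
by move=> H; rewrite !count_map; apply: eq_in_count => t /H /= ->.
Qed.

Lemma feas2_triples mu M : feas2 mu M -> let l := ulab2 mu M in
  exists s : seq ('I_n * ('I_n * 'I_n)),
   [/\ perm_eq [seq t.1 | t <- s] (row_letters l rx), perm_eq [seq t.2.1 | t <- s] (row_letters l ry),
       perm_eq [seq t.2.2 | t <- s] (row_letters l rz), all triple_ok s
     & forall p, count p (map top3 s) = count p (us M ++ ts M)].
Proof.
move=> [cm [F tc r30 leYX leXZ] [okA _ G]] l.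
have cY p : rcount l ry p = count p (us M ++ qs M) by have [] := rcount_ulab (ry_rz hr) M p cm.
have cZ p : rcount l rz p = count p (vs M ++ ts M) by have [] := rcount_ulab (ry_rz hr) M p cm.
pose Uz b := (rcount l rz (fun j => blk j <= b)%N - rcount l rx (fun j => blk j <= b)%N)%N.
pose Uy b := (rcount l rx (fun j => blk j < b)%N - rcount l ry (fun j => blk j < b)%N)%N.
have [Z1 [Z2 [pZ HZ1 HZ2]]] := trim blk Uz (vs M).
have [Y1 [Y2 [pY HY1 HY2]]] := trim blk Uy (us M).
pose key (o : ('I_n * 'I_n) + 'I_n + 'I_n) : 'I_n :=
  match o with inl (inl a) => a.1 | inl (inr z) => z | inr y => y end.
have [o o' x|o _|s1 [W [p1 p2 Rs]]] := @matching _ _ (fun o (x : 'I_n) => (blk x == blk (key o)) && (x < key o)%N)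
    (fun o => blk (key o)) key (map inl (map inl (arcs M) ++ map inr Z2) ++ map inr Y2) (row_letters l rx).
- by move=> /andP[/eqP<- _] /andP[/eqP<-].
- set c := key o; rewrite count_letters_row.
  rewrite -/(upto blk c) -[rcount _ _ _]/(rcount l rx (before c)).
  have -> : count (fun o' => (blk (key o') == blk c) && (key o' <= c)%N)
      (map inl (map inl (arcs M) ++ map inr Z2) ++ map inr Y2) =
      (count (upto blk c) (qs M) + count (upto blk c) Z2 + count (upto blk c) Y2)%N.
    by rewrite !map_cat -!map_comp !count_cat !count_map.
  have [+ + + + _] := G c (ltn_ord c).
  rewrite /left_cap2 /arc_floor2 /top_floor2 /row_cap2 /both geq_max -/(ulab2 mu M) -/l cY cZ !count_cat => g1 g2 /andP[_ g3] g4.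
  have := HZ2 c; have := HY2 c; have := leYX c; have := leXZ c.
  rewrite -/(ulab2 mu M) -/l /Uy /Uz -/(until c) -/(older c); move: g1 g2 g3 g4.
  move: (count _ (qs M)) (count _ (us M)) (count _ (vs M)) (count _ (ts M)) (count _ Z2) (count _ Y2).
  move: (rcount l rx _) (rcount l rx _) (rcount l rx _) (rcount l ry _) (rcount l rz _); clear; lia.
have [sAB [sC [q1 q2 pC]]] := split_sum p1.
have [sA [sB [q3 pA pB]]] := split_sum q2.
move: Rs; rewrite (perm_all _ q1) all_cat !all_map (perm_all _ q3) all_cat !all_map => /andP[/andP[RA RB] RC].
have cX p : rcount l rx p =
   (count p (unzip2 sA) + count p (unzip2 sB) + count p (unzip2 sC) + count p W)%N.
  rewrite -count_letters_row -(seq.permP p2) count_cat /unzip2 (seq.permP (perm_map snd q1)).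
  rewrite map_cat count_cat -!map_comp (eq_map (g := snd)) // (seq.permP (perm_map snd q3)).
  by rewrite map_cat count_cat -!map_comp.
have bA p : count (fun j : 'I_n => p (blk j)) (unzip2 sA) = count (fun j : 'I_n => p (blk j)) (qs M).
  rewrite /qs /unzip1 -(seq.permP (perm_map fst pA)) -map_comp.
  by apply: same_blk => t /(allP RA) /andP[/eqP].
have bB p : count (fun j : 'I_n => p (blk j)) (unzip2 sB) = count (fun j : 'I_n => p (blk j)) Z2.
  by rewrite -(seq.permP pB); apply: same_blk => t /(allP RB) /andP[/eqP].
have bC p : count (fun j : 'I_n => p (blk j)) (unzip2 sC) = count (fun j : 'I_n => p (blk j)) Y2.
  by rewrite -(seq.permP pC); apply: same_blk => t /(allP RC) /andP[/eqP].
have bT p : count (fun j : 'I_n => p (blk j)) (qs M) = count (fun j : 'I_n => p (blk j)) (ts M).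
  exact: arcs_blk okA.
have cY' p : rcount l ry p = (count p Y1 + count p Y2 + count p (qs M))%N.
  by rewrite cY count_cat -(seq.permP pY) count_cat.
have cZ' p : rcount l rz p = (count p Z1 + count p Z2 + count p (ts M))%N.
  by rewrite cZ count_cat -(seq.permP pZ) count_cat.
pose xk (o : ('I_n * 'I_n) + 'I_n) : 'I_n := match o with inl t => t.2 | inr x => x end.
have [//|o _|s2 [V2 [p3 p4 R2]]] := @matching _ _ (fun o (z : 'I_n) => blk z < blk (xk o))%N
    (fun=> 0%N) (fun o => blk (xk o)) (map inl sC ++ map inr W) Z1.
  set c := xk o; have -> : count (fun o' => (0 == 0)%N && (blk (xk o') <= blk c)%N)
      (map inl sC ++ map inr W) = (count (until c) (unzip2 sC) + count (until c) W)%N.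
    by rewrite count_cat !count_map.
  have h1 := leXZ c; have h2 := HZ1 c; rewrite -/(ulab2 mu M) -/l cX cZ' in h1.
  rewrite /Uz -[rcount l rz _]/(rcount l rz (until c)) -[rcount l rx _]/(rcount l rx (until c)) cX cZ' in h2; rewrite -/(older c).
  have h3 := until_older c Z1; have h4 : count (until c) (qs M) = count (until c) (ts M) := bT (fun b => b <= blk c)%N.
  have h5 : count (until c) (unzip2 sA) = count (until c) (qs M) := bA (fun b => b <= blk c)%N.
  have h6 : count (until c) (unzip2 sB) = count (until c) Z2 := bB (fun b => b <= blk c)%N.
  move: h1 h2; rewrite h5 h6 h4 h3.
  move: (count (until c) (unzip2 sC)) (count (until c) W) (count (until c) (ts M)).
  by move: (count (until c) Z2) (count (older c) Z1) (count (inblk blk c) Z1); clear; lia.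
have szA := perm_size pA; have szB := perm_size pB; have szC := perm_size pC.
rewrite !size_map in szA szB szC.
have szZ : (size sC + size W = size Z1)%N.
  have := F rz; have := F rx; rewrite -/(ulab2 mu M) -/l cX cZ'.
  rewrite !count_predT !size_map szA szB.
  by move: (size (arcs M)) (size Z2) (size sC) (size W) (size Z1); clear; lia.
have V20 : V2 = [::].
  have := perm_size p4; have := perm_size p3; rewrite !size_cat !size_map szZ => ->.
  by case: (V2) => // ? ?; rewrite /=; clear; lia.
rewrite {V2}V20 cats0 in p4; have [sCz [sW [q4 pCz pW]]] := split_sum p3.
move: R2; rewrite (perm_all _ q4) all_cat !all_map => /andP[RCz RW].
pose Wc : seq ('I_n * 'I_n) := map (fun t => (t.2, t.1)) sB ++ sW.
have [//|y _|s3 [V3 [p5 p6 R3]]] := @matching _ _ (fun (y : 'I_n) (t : 'I_n * 'I_n) => blk t.1 < blk y)%N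
    (fun=> 0%N) (fun y => blk y) Y1 Wc.
  have -> : count (fun o' : 'I_n => (0 == 0)%N && (blk o' <= blk y)%N) Y1 = count (until y) Y1 by [].
  have -> : count (fun t : 'I_n * 'I_n => blk t.1 < blk y)%N Wc =
     (count (older y) (unzip2 sB) + count (older y) W)%N.
    by rewrite /Wc count_cat -(seq.permP pW) !count_map.
  have h1 := leYX y; have h2 := HY1 y; rewrite -/(ulab2 mu M) -/l cX cY' in h1.
  rewrite /Uy -[rcount l ry _]/(rcount l ry (older y)) -[rcount l rx _]/(rcount l rx (older y)) cX cY' in h2.
  have h3 := until_older y Y1; have h5 : count (older y) (unzip2 sA) = count (older y) (qs M) := bA (fun b => b < blk y)%N.
  have h6 : count (older y) (unzip2 sC) = count (older y) Y2 := bC (fun b => b < blk y)%N.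
  move: h1 h2; rewrite h3 h5 h6.
  move: (count (older y) (unzip2 sB)) (count (older y) W) (count (older y) (qs M)).
  by move: (count (older y) Y2) (count (older y) Y1) (count (inblk blk y) Y1); clear; lia.
have V30 : V3 = [::].
  have := perm_size p6; have := perm_size p5; rewrite /Wc !size_cat !size_map => ->.
  have := perm_size pW; rewrite size_map => ->.
  have := F ry; have := F rx; rewrite -/(ulab2 mu M) -/l cX cY'.
  rewrite !count_predT !size_map szA szC.
  move: (size (arcs M)) (size Y2) (size sB) (size W) (size Y1).
  by case: (V3) => // ? ?; rewrite /=; clear; lia.
rewrite {V3}V30 cats0 in p6.
exists ([seq (t.2, t.1) | t <- sA] ++ [seq (t.1.2, (t.1.1, t.2)) | t <- sCz] ++
        [seq (t.2.1, (t.1, t.2.2)) | t <- s3]).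
have pW' p : (count p (unzip2 sCz) + count p (unzip2 sW) = count p Z1)%N.
  rewrite -(seq.permP p4) /unzip2 (seq.permP (perm_map snd q4)) map_cat count_cat -!map_comp.
  by [].
have eA1 p : count p (map (fun t => t.1.1) sA) = count p (qs M).
  by rewrite -(seq.permP (perm_map fst pA)) -map_comp.
have eA2 p : count p (map (fun t => t.1.2) sA) = count p (ts M).
  by rewrite -(seq.permP (perm_map snd pA)) -map_comp.
have eC1 p : count p (map (fun t => t.1.1) sCz) = count p Y2.
  by rewrite -(seq.permP pC) -(seq.permP (perm_map fst pCz)) -map_comp.
have eC2 p : count p (map (fun t => t.1.2) sCz) = count p (unzip2 sC).
  by rewrite -(seq.permP (perm_map snd pCz)) -map_comp.
have e31 p : count p (map (fun t => t.2.1) s3) = (count p (unzip2 sB) + count p W)%N.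
  rewrite (map_comp fst snd) (seq.permP (perm_map fst p6)) map_cat count_cat -map_comp.
  by rewrite -(seq.permP pW).
have e32 p : count p (map (fun t => t.2.2) s3) = (count p Z2 + count p (unzip2 sW))%N.
  rewrite (map_comp snd snd) (seq.permP (perm_map snd p6)) map_cat count_cat -map_comp.
  by rewrite -(seq.permP pB).
have wcP t : t \in Wc -> (blk t.2 < blk t.1)%N || ((blk t.2 == blk t.1) && (t.1 < t.2)%N).
  rewrite mem_cat => /orP[/mapP[t' /(allP RB)/andP[/eqP /= h1 h2] ->]|tW]; last by have /= -> := allP RW t tW.
  by rewrite /= h1 eqxx h2 orbT.
have R3' t : t \in s3 -> (t.2.1 < t.1)%N /\ (t.2.2 < t.1)%N /\ triple_ok (t.2.1, (t.1, t.2.2)).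
  move=> ts; have h1 := allP R3 t ts; have : t.2 \in Wc by rewrite -(perm_mem p6) map_f.
  move/wcP; move: h1 {ts}; case: t => y [x z] /= h1 h2.
  have h3 : (blk z <= blk x)%N by move: h2; clear; lia.
  have h4 : (x < y)%N by rewrite ltnNge; apply/negP => /blk_mono; move: h1; clear; lia.
  have h5 : (z < y)%N by rewrite ltnNge; apply/negP => /blk_mono; move: h1 h3; clear; lia.
  split=> //; split=> //; rewrite /triple_ok /= h4 /precedes h2 /=.
  by move: h1 h3; clear; lia.
have RCz' t : t \in sCz -> (t.2 < t.1.1)%N /\ triple_ok (t.1.2, (t.1.1, t.2)).
  move=> ts; have h1 := allP RCz t ts; have : t.1 \in sC by rewrite -(perm_mem pCz) map_f.
  move/(allP RC); move: h1 {ts}; case: t => [[y x] z] /= h1 /andP[/eqP h2 h3].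
  have h4 : (z < y)%N by rewrite ltnNge; apply/negP => /blk_mono; move: h1 h2; clear; lia.
  by split=> //; rewrite /triple_ok /precedes /= h3 -h2 h1.
have RA' t : t \in sA -> (t.1.1 < t.1.2)%N /\ triple_ok (t.2, t.1).
  move=> ts; have h1 := allP RA t ts; have : t.1 \in arcs M by rewrite -(perm_mem pA) map_f.
  move/(allP okA); move: h1 {ts}; case: t => [[q t] x] /= /andP[/eqP h1 h2] /andP[/= h3 /eqP h4].
  by split=> //; rewrite /triple_ok /precedes /= h2 h1 h4 eqxx h3 (ltn_trans h2 h3) !orbT.
split.
- apply/seq.permP => p; rewrite count_letters_row cX.
  apply: (@etrans _ _ (count p (unzip2 sA) + (count p (map (fun t => t.1.2) sCz) +
     count p (map (fun t => t.2.1) s3)))%N); first by rewrite !map_cat !count_cat -!map_comp.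
  rewrite eC2 e31.
  by move: (count p (unzip2 sA)) (count p (unzip2 sB)) (count p (unzip2 sC)) (count p W); clear; lia.
- apply/seq.permP => p; rewrite count_letters_row cY'.
  apply: (@etrans _ _ (count p (map (fun t => t.1.1) sA) + (count p (map (fun t => t.1.1) sCz) +
     count p (unzip1 s3)))%N); first by rewrite !map_cat !count_cat -!map_comp.
  rewrite eA1 eC1 (seq.permP p5).
  by move: (count p Y1) (count p Y2) (count p (qs M)); clear; lia.
- apply/seq.permP => p; rewrite count_letters_row cZ'.
  apply: (@etrans _ _ (count p (map (fun t => t.1.2) sA) + (count p (unzip2 sCz) +
     count p (map (fun t => t.2.2) s3)))%N); first by rewrite !map_cat !count_cat -!map_comp.
  rewrite eA2 e32 -pW'.
  by move: (count p Z2) (count p (ts M)) (count p (unzip2 sCz)) (count p (unzip2 sW)); clear; lia.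
- rewrite !all_cat !all_map; apply/and3P; split; apply/allP => t ts /=.
  + by case: (RA' t ts).
  + by case: (RCz' t ts).
  + by case: (R3' t ts) => _ [].
move=> p; apply: (@etrans _ _ (count p (map (fun t => t.1.2) sA) + (count p (map (fun t => t.1.1) sCz) +
     count p (unzip1 s3)))%N).
  rewrite !map_cat !count_cat -!map_comp; congr (count p _ + (count p _ + count p _))%N; apply/eq_in_map => t ts.
  - by have [h _] := RA' t ts; rewrite /top3 /= h.
  - by have [h _] := RCz' t ts; rewrite /top3 /= ltnNge ltnW.
  - by have [_ [h _]] := R3' t ts; rewrite /top3 /= ltnNge ltnW.
rewrite eA2 eC1 (seq.permP p5) count_cat -(seq.permP pY) count_cat.
by move: (count p Y1) (count p Y2) (count p (ts M)); clear; lia.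
Qed.

Definition col_upto (m : nat) (c : {ffun 'I_r -> 'I_n}) :=
  triple_ok (c rx, (c ry, c rz)) /\
  forall i k, (3 <= i < m)%N -> (k < i)%N -> (c k < c i)%N.

Lemma feas2_tail3 mu M k : feas2 mu M -> k = 3 :> nat -> forall o : 'I_n,
  (rcount (ulab2 mu M) k (fun j => j <= o)%N <= count (fun j : 'I_n => j < o)%N (us M ++ ts M))%N.
Proof.
move=> [cm [F tc r30 leYX leXZ] [okA _ G]] k3 o.
have E c : row3 (ulab2 mu M) c = rcount (ulab2 mu M) k (fun j => j <= c)%N.
  by rewrite /row3 (big_pred1 k) => [//|k']; rewrite [RHS]/= -val_eqE [in RHS]/= k3.
case: (o : nat) (ltn_ord o) => [|c] lt_c; first by rewrite -E [row3 _ _]r30.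
have [_ _ + _ _] := G c (ltnW lt_c); rewrite /top_floor2 geq_max leq_subLR -/(ulab2 mu M) E => /andP[h _].
apply: leq_trans h _; rewrite -/(upto blk c).
have -> : count (fun j : 'I_n => j < c.+1)%N (us M ++ ts M) = count (fun j => j <= c)%N (us M ++ ts M) by [].
rewrite (older_upto_count blk_mono) -count_cat leq_add2r.
have [-> _] := rcount_ulab (ry_rz hr) M (older c) cm; rewrite !count_cat leq_add2l.
by rewrite (arcs_blk (fun b => b < blk c)%N okA).
Qed.

Lemma feas2_columns mu M : feas2 mu M -> exists s : seq {ffun 'I_r -> 'I_n},
  (forall i, perm_eq [seq c i | c : {ffun 'I_r -> 'I_n} <- s] (row_letters (ulab2 mu M) i)) /\
  forall c, c \in s -> col_upto r c.
Proof.
move=> fM; have [t [px py pz okt topt]] := feas2_triples fM.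
have F3 := feas2_tail3 fM; case: fM => cm; rewrite -/(ulab2 mu M).
set l := ulab2 mu M in px py pz F3 * => -[F tc _ _ _] _.
suff /(_ r (leqnn r) hr)[s [Hs okS _]] : forall m : nat, (m <= r)%N -> (3 <= m)%N ->
    exists s : seq ({ffun 'I_r -> 'I_n} * 'I_n),
    [/\ forall i, (i < m)%N -> perm_eq [seq c.1 i | c : {ffun 'I_r -> 'I_n} * 'I_n <- s] (row_letters l i),
       forall c, c \in s -> col_upto m c.1 /\ forall i, (i < m)%N -> (c.1 i <= c.2)%N
     & forall k, k = m :> nat -> forall o : 'I_n, (count (fun j : 'I_n => j <= o)%N (row_letters l k) <=
         count (fun c : {ffun 'I_r -> 'I_n} * 'I_n => c.2 < o)%N s)%N].
  exists (unzip1 s); split=> [i|c /mapP[c' /okS [h _] ->] //].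
  by rewrite /unzip1 -map_comp; apply: Hs.
elim=> // m IH le_m; rewrite leq_eqVlt => /orP[/eqP[m2]|m3].
  pose col (t : 'I_n * ('I_n * 'I_n)) : {ffun 'I_r -> 'I_n} :=
    [ffun i : 'I_r => if i == rx then t.1 else if i == ry then t.2.1 else t.2.2].
  have colx u : col u rx = u.1 by rewrite ffunE eqxx.
  have coly u : col u ry = u.2.1 by rewrite ffunE.
  have colz u : col u rz = u.2.2 by rewrite ffunE.
  have row3P i : (i < m.+1)%N -> [\/ i = rx, i = ry | i = rz].
    rewrite -m2; case: i => [[|[|[|//]]] hi] _; [constructor 1|constructor 2|constructor 3]; exact: val_inj.
  exists [seq (col u, top3 u) | u <- t]; split.
  - move=> i /row3P[] ->; rewrite -map_comp.
    + by rewrite (eq_map (g := fun u => u.1)) // => u /=.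
    + by rewrite (eq_map (g := fun u => u.2.1)) // => u /=.
    + by rewrite (eq_map (g := fun u => u.2.2)) // => u /=.
  - move=> _ /mapP[u ut ->] /=; have ok := allP okt u ut; split.
      rewrite /col_upto colx coly colz; split=> // i k; rewrite -m2; lia.
    move=> i /row3P; have /andP[h _] := ok; rewrite /top3; case: ltnP => h2 [] ->; rewrite ?colx ?coly ?colz.
    + by apply: leq_trans (ltnW h) (ltnW h2).
    + exact: ltnW.
    + by [].
    + exact: ltnW.
    + by [].
    + by [].
  - move=> k km o; have := F3 k; rewrite km -m2 => /(_ erefl o); rewrite count_letters_row => h.
    by apply: leq_trans h _; rewrite -topt !count_map.
have [s [Hs okS tops]] := IH (ltnW le_m) m3.
pose k : 'I_r := Ordinal le_m.
have [//|o _|s2 [V [p1 p2 Rs]]] := @matching _ _ (fun (o : 'I_n) (c : {ffun 'I_r -> 'I_n} * 'I_n) => c.2 < o)%N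
   (fun=> 0%N) (fun o => o) (row_letters l k) s; first exact: tops.
have V0 : V = [::].
  have := perm_size p2; have := perm_size p1; rewrite (full_size _ F) size_cat !size_map => ->.
  have lt_0 : (0 < m)%N by move: m3; clear; lia.
  have := perm_size (Hs (Ordinal (leq_trans lt_0 (ltnW le_m))) lt_0); rewrite size_map (full_size _ F) => ->.
  by case: (V) => // ? ?; rewrite /=; clear; lia.
rewrite {V}V0 cats0 in p2.
pose upd (q : 'I_n * ({ffun 'I_r -> 'I_n} * 'I_n)) : {ffun 'I_r -> 'I_n} :=
  [ffun i : 'I_r => if i == k then q.1 else q.2.1 i].
have upk q : upd q k = q.1 by rewrite ffunE eqxx.
have upi q i : (i < m)%N -> upd q i = q.2.1 i.
  by move=> im; rewrite ffunE -val_eqE /= ltn_eqF.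
exists [seq (upd q, q.1) | q <- s2]; split.
- move=> i; rewrite ltnS leq_eqVlt => /orP[/eqP ik|im]; rewrite -map_comp.
    have -> : i = k by apply: val_inj.
    by rewrite (eq_map (g := fst)) // => q /=.
  rewrite (eq_map (g := (fun c : {ffun 'I_r -> 'I_n} * 'I_n => c.1 i) \o snd)) => [|q]; last exact: upi.
  by rewrite map_comp; apply: perm_trans (Hs i im); apply: perm_map.
- move=> _ /mapP[q qs ->] /=; have lt_q := allP Rs q qs.
  have [[tri tl] up] : col_upto m q.2.1 /\ forall i, (i < m)%N -> (q.2.1 i <= q.2.2)%N.
    by apply: okS; rewrite -(perm_mem p2) map_f.
  have lt_up i : (i < m)%N -> (upd q i < q.1)%N.
    by move=> im; rewrite upi //; apply: leq_ltn_trans (up i im) lt_q.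
  split; first split.
  + by rewrite !upi //=; move: m3; clear; lia.
  + move=> i k' /andP[i3]; rewrite ltnS leq_eqVlt => /orP[/eqP ik|im] ki.
      have -> : i = k by apply: val_inj.
      by rewrite upk; apply: lt_up; rewrite -ik.
    by rewrite !upi ?(ltn_trans ki im) //; apply: tl => //; rewrite i3.
  + move=> i; rewrite ltnS leq_eqVlt => /orP[/eqP ik|im]; last by apply/ltnW/lt_up.
    have -> : i = k by apply: val_inj.
    by rewrite upk.
move=> k' kE o; rewrite count_letters_row; apply: leq_trans (tc k k' m3 kE o) _.
by rewrite -count_letters_row -(seq.permP p1) !count_map.
Qed.

End Target.

(** * Block weights *)

Section Subsets.
Variables (r n : nat).

Lemma enum_val_lt (A : {set 'I_n}) (i j : 'I_#|A|) : (i < j)%N -> (enum_val i < enum_val j)%N.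
Proof.
move=> ij; have x0 := enum_val i; rewrite !(enum_val_nth x0).
have srt : sorted ltn [seq val x | x <- enum A].
  apply: (subseq_sorted ltn_trans (s2 := iota 0 n)); last exact: iota_ltn_sorted.
  rewrite -val_enum_ord; apply: map_subseq; rewrite [X in subseq _ X]enumT.
  exact: filter_subseq.
have sz k : (k < #|A|)%N -> (k < size (enum A))%N by rewrite cardE.
rewrite -!(nth_map x0 0%N val) ?sz //.
by apply: (sorted_ltn_nth ltn_trans) => //; rewrite inE size_map sz.
Qed.

Lemma rsubset_col_lt (I : rsubset r n) (i j : 'I_r) :
  (i < j)%N -> (rsubset_col I i < rsubset_col I j)%N.
Proof. by move=> ij; apply: enum_val_lt. Qed.

Lemma rsubset_col_inj (I : rsubset r n) : injective (rsubset_col I).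
Proof.
move=> i j E; apply/eqP; rewrite -val_eqE; case: ltngtP => // /(rsubset_col_lt I).
  by rewrite E ltnn.
by rewrite E ltnn.
Qed.

Lemma rsubset_of (c : {ffun 'I_r -> 'I_n}) : injective c ->
  exists (I : rsubset r n) (s : 'S_r), forall i, c i = rsubset_col I (s i).
Proof.
move=> cI; have cA : #|[set c i | i in 'I_r]| == r by rewrite card_imset ?card_ord.
pose I : rsubset r n := exist _ [set c i | i in 'I_r] cA; exists I.
have ex (i : 'I_r) : exists k : 'I_r, rsubset_col I k = c i.
  have ci : c i \in sval I by apply: imset_f.
  exists (cast_ord (eqP (valP I)) (enum_rank_in ci (c i))).
  rewrite /rsubset_col cast_ord_comp cast_ord_id.
  exact: (enum_rankK_in ci).
have [f fE] := fin_all_exists ex.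
have fI : injective f by move=> i j E; apply: cI; rewrite -!fE E.
by exists (perm fI) => i; rewrite permE fE.
Qed.

End Subsets.

Section BlockWeights.
Variables (R : realType) (r n : nat) (a : seq nat).
Hypotheses (hr : (3 <= r)%N) (sum_a : sumn a = n).

Definition col_block (j : nat) : nat := block_index a j.+1.

Lemma col_block_mono (i j : nat) : (i <= j)%N -> (col_block i <= col_block j)%N.
Proof.
by move=> ij; apply: sub_find => k /=; apply: leq_ltn_trans.
Qed.

Definition wnat (i j : nat) : nat :=
  if i == 2 then (alpha a (col_block j).-1 + alpha a (col_block j) + 1 - j.+1)%N
  else (n - j)%N.

Lemma col_blockP (j : 'I_n) : (alpha a (col_block j).-1 <= j < alpha a (col_block j))%N.
Proof. by have [|_ h1 h2] := @block_indexP a j.+1; rewrite ?sum_a ?ltn_ord // -ltnS h1. Qed.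

Lemma alpha_mono (i j : nat) : (i <= j)%N -> (alpha a i <= alpha a j)%N.
Proof.
move=> ij; rewrite /alpha -[take j a](cat_take_drop i) sumn_cat take_takel //.
exact: leq_addr.
Qed.

Lemma alpha_le (i : nat) : (alpha a i <= n)%N.
Proof. by rewrite -sum_a -{2}(cat_take_drop i a) sumn_cat leq_addr. Qed.

Lemma wnat_le (i : nat) (j : 'I_n) : (wnat i j <= n)%N.
Proof.
rewrite /wnat; case: eqP => _; last exact: leq_subr.
have := col_blockP j; have := alpha_le (col_block j).
by move: (alpha a (col_block j)) (alpha a _.-1); clear; lia.
Qed.

Lemma wnat_other (i : nat) (j k : 'I_n) : i != 2 -> (j < k)%N -> (wnat i k < wnat i j)%N.
Proof. by rewrite /wnat => /negbTE-> jk; have := ltn_ord k; move: jk; clear; lia. Qed.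

Lemma wnat_row2 (z x : 'I_n) : precedes col_block z x -> (wnat 2 z < wnat 2 x)%N.
Proof.
rewrite /wnat /precedes eqxx; have := col_blockP z; have := col_blockP x.
move=> /andP[h1 h2] /andP[h3 h4] /orP[lt_zx|/andP[/eqP e lt_xz]]; last first.
  rewrite e in h3 h4 *; move: h1 h2 h3 h4 lt_xz.
  by move: (alpha a _) (alpha a _.-1); clear; lia.
have h5 : (alpha a (col_block z) <= alpha a (col_block x).-1)%N.
  by apply: alpha_mono; move: lt_zx; clear; lia.
move: h1 h2 h3 h4 h5; move: (alpha a (col_block x)) (alpha a (col_block x).-1).
by move: (alpha a (col_block z)) (alpha a (col_block z).-1); clear; lia.
Qed.

Lemma wnat_inj (i : nat) (j k : 'I_n) : wnat i j = wnat i k -> j = k.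
Proof.
move=> E; apply: val_inj => /=; case: (eqVneq i 2) => [i2|ni].
  rewrite i2 in E; case: (ltngtP j k) => // jk.
    have [] : precedes col_block j k \/ precedes col_block k j.
    - by rewrite /precedes; case: (ltngtP (col_block j) (col_block k)) => h; rewrite ?jk; [left | right | right].
    - by move/wnat_row2; rewrite E ltnn.
    by move/wnat_row2; rewrite E ltnn.
  have [] : precedes col_block j k \/ precedes col_block k j.
  - by rewrite /precedes; case: (ltngtP (col_block j) (col_block k)) => h; rewrite ?jk; [left | right | left].
  - by move/wnat_row2; rewrite E ltnn.
  by move/wnat_row2; rewrite E ltnn.
by case: (ltngtP j k) => // /(wnat_other ni); rewrite E ltnn.
Qed.

Section Beta.
Variables (beta : R) (ge_beta : n.+1%:R <= beta).
Local Notation M := (block_weight_mx r n a 3 beta).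

Lemma block_weightE (i : 'I_r) (j : 'I_n) :
  M i j = if i == 0 :> nat then 0 else (wnat i j)%:R * beta ^+ i.-1.
Proof.
rewrite mxE /block_weight /wnat eqSS; case: eqP => // /eqP i0.
rewrite eqSS; case: eqP => [->|_] //=.
have -> : (n - j.+1 + 1 = n - j)%N by have := ltn_ord j; clear; lia.
by rewrite subSS subn1.
Qed.

Let beta1 : 1 <= beta.
Proof. by apply: le_trans ge_beta; rewrite ler1n. Qed.

Let beta0 : 0 <= beta. Proof. exact: le_trans beta1. Qed.

Definition wt (c : 'I_r -> 'I_n) : R := \sum_i M i (c i).

Lemma wt_lt (c c' : 'I_r -> 'I_n) (i0 : 'I_r) : (0 < i0)%N ->
  (forall i : 'I_r, (i0 < i)%N -> c i = c' i) ->
  (wnat i0 (c i0) < wnat i0 (c' i0))%N -> wt c < wt c'.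
Proof.
move=> i0_gt0 eq_c lt_w; rewrite /wt.
have pos (d : 'I_r -> 'I_n) i : 0 <= M i (d i).
  by rewrite block_weightE; case: ifP => // _; rewrite mulr_ge0 ?exprn_ge0.
pose h (i : nat) : R := if i == 0 then 0 else (beta - 1) * beta ^+ i.-1.
have le_h (i : 'I_r) : M i (c i) <= h i.
  rewrite block_weightE /h; case: ifP => // _; apply: ler_wpM2r; first exact: exprn_ge0.
  rewrite lerBrDr; apply: le_trans ge_beta; rewrite -natr1 lerD2r ler_nat; exact: wnat_le.
have lt1 : \sum_(i < r | (i < i0)%N) M i (c i) < beta ^+ i0.-1.
  apply: (@le_lt_trans _ _ (\sum_(i < r | (i < i0)%N) h i)); first exact: ler_sum.
  rewrite -(big_ord_widen r h) ?(ltnW (ltn_ord i0)) //.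
  case: (i0 : nat) i0_gt0 => // k _; rewrite big_ord_recl /h /= add0r.
  by rewrite -big_distrr /= -subrX1 ltrBlDr ltrDl ltr01.
have split_sum d : \sum_i M i (d i) = \sum_(i < r | (i < i0)%N) M i (d i) +
    (M i0 (d i0) + \sum_(i < r | ~~ (i < i0)%N && (i != i0)) M i (d i)).
  rewrite (bigID (fun i : 'I_r => (i < i0)%N)) /=; congr (_ + _).
  by rewrite (bigD1 i0) ?ltnn.
rewrite !split_sum.
have -> : \sum_(i < r | ~~ (i < i0)%N && (i != i0)) M i (c i) =
          \sum_(i < r | ~~ (i < i0)%N && (i != i0)) M i (c' i).
  apply: eq_bigr => i /andP[]; rewrite -leqNgt => h1 h2; rewrite eq_c //.
  by rewrite ltn_neqAle h1 eq_sym val_eqE h2.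
rewrite !addrA ltrD2r.
have h2 : M i0 (c i0) + beta ^+ i0.-1 <= M i0 (c' i0).
  rewrite !block_weightE gtn_eqF // -[X in _ + X]mul1r -mulrDl.
  apply: ler_wpM2r; first exact: exprn_ge0.
  by rewrite natr1 ler_nat.
have h3 : 0 <= \sum_(i < r | (i < i0)%N) M i (c' i) by apply: sumr_ge0 => i _; apply: pos.
by move: lt1 h2 h3; lra.
Qed.

End Beta.

Definition aligned (c : 'I_r -> 'I_n) :=
  forall i k : 'I_r, (k < i)%N -> (wnat i (c i) < wnat i (c k))%N.

Lemma col_upto_aligned (c : {ffun 'I_r -> 'I_n}) :
  col_upto hr col_block r c -> aligned c /\ injective c.
Proof.
case=> /and3P[/= h1 h2 h3] h4; have al : aligned c.
  move=> i k ki; case: (ltngtP 2 i) => i2.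
  - by apply: wnat_other; [rewrite gtn_eqF | apply: h4; rewrite ?i2 /=].
  - apply: wnat_other; first by rewrite ltn_eqF.
    have -> : i = ry hr by apply: val_inj => /=; move: ki i2; clear; lia.
    by have -> : k = rx hr by apply: val_inj => /=; move: ki i2; clear; lia.
  have -> : i = rz hr by apply: val_inj.
  have [k0|k1] : k = rx hr \/ k = ry hr.
    by case: (posnP k) => k0; [left | right]; apply: val_inj => /=; move: ki i2 k0; clear; lia.
    by rewrite k0; apply: wnat_row2.
  by rewrite k1; apply: wnat_row2.
split=> // i k E; apply: val_inj => /=; case: (ltngtP i k) => // /al; rewrite E ltnn //.
Qed.

Lemma aligned_lt (c : 'I_r -> 'I_n) (s : 'S_r) (beta : R) : aligned c -> n.+1%:R <= beta -> s != 1%g ->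
  wt beta c < wt beta (fun i => c (s i)).
Proof.
move=> al ge_beta s1.
have /existsP[k0 k0P] : [exists k : 'I_r, s k != k].
  rewrite -negb_forall; apply: contra s1 => /forallP H; apply/eqP/permP => k.
  by rewrite perm1; apply/eqP.
case: (@arg_maxnP _ k0 (fun k => s k != k) val k0P) => i0 si0 max_i0.
have fix_s (i : 'I_r) : (i0 < i)%N -> s i = i.
  by move=> lt_i; apply/eqP; rewrite -[_ == _]negbK; apply/negP => /max_i0 /= h; move: lt_i; rewrite ltnNge => /negP[]; exact: h.
have lt_s : (s i0 < i0)%N.
  rewrite ltn_neqAle val_eqE si0 leqNgt; apply/negP => /fix_s /perm_inj E.
  by rewrite E eqxx in si0.
apply: (@wt_lt beta ge_beta _ _ i0); first exact: leq_ltn_trans lt_s.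
  by move=> i /fix_s ->.
exact: al.
Qed.

(* Minimality at one weight gives [aligned], which no longer depends on beta. *)
Lemma block_field : exists L : matching_field r n, forall I, aligned (fun i => rsubset_col I (L I i)).
Proof.
pose W I (s : 'S_r) : R := wt n.+1%:R (fun i => rsubset_col I (s i)).
exists (fun I => [arg min_(s < 1%g) W I s]%O) => I.
case: arg_minP => // s _ min_s i k ki; rewrite ltnNge leq_eqVlt; apply/negP => /orP[/eqP/wnat_inj|lt_w].
  by move/rsubset_col_inj/perm_inj => E; rewrite E ltnn in ki.
have := min_s (tperm i k * s)%g isT; rewrite leNgt => /negP; apply.
apply: (@wt_lt _ _ _ _ i); first exact: lexx; first exact: leq_ltn_trans ki.
  move=> j ij; rewrite permM tpermD // -val_eqE; first by rewrite ltn_eqF.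
  by rewrite ltn_eqF // (ltn_trans ki).
by rewrite permM tpermL.
Qed.

End BlockWeights.

(** * Initial monomials of a straightened span *)

Lemma filter_prop (T : eqType) (P : T -> Prop) (U : seq T) :
  exists2 s, uniq s & forall x, x \in s <-> x \in U /\ P x.
Proof.
elim: U => [|y U [s us Hs]]; first by exists [::] => // x; rewrite in_nil; split=> [|[]].
case: (classic (P y)) => Py; last first.
  exists s => // x; rewrite Hs inE; split=> [[xU Px]|[/orP[/eqP->|xU] Px] //].
  by rewrite xU orbT.
exists (undup (y :: s)) => [|x]; first exact: undup_uniq.
rewrite mem_undup !inE; split=> [/orP[/eqP->|/Hs[xU Px]]|[/orP[->//|xU] Px]].
- by rewrite eqxx.
- by rewrite xU orbT.
by apply/orP; right; apply/Hs.
Qed.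

Section SpanMul.
Variables (K : fieldType) (A : algType K).
Implicit Types (G : A -> Prop).

Lemma spanned_mul G G' G'' (p q : A) : (forall g h, G g -> G' h -> G'' (g * h)) ->
  spanned G p -> spanned G' q -> spanned G'' (p * q).
Proof.
move=> GG; elim=> [|c g v Gg _ IH] sq; first by rewrite mul0r; apply: spanned0.
rewrite mulrDl; apply: spannedD; last exact: IH.
rewrite -scalerAl; apply: spannedZ; elim: sq => [|c' h w Gh _ IH'].
  by rewrite mulr0; apply: spanned0.
by rewrite mulrDr -scalerAr; apply: spannedS => //; apply: GG.
Qed.

Lemma spanned_prod (I : Type) (G : A -> Prop) (H : nat -> A -> Prop) (F : I -> A) (s : seq I) :
  H 0%N 1 -> (forall k g h, G g -> H k h -> H k.+1 (g * h)) -> (forall i, spanned G (F i)) ->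
  spanned (H (size s)) (\prod_(i <- s) F i).
Proof.
move=> H1 HM GF; elim: s => [|i s IH]; first by rewrite big_nil; apply: spanned_gen.
by rewrite big_cons; apply: spanned_mul (GF i) IH; apply: HM.
Qed.

Lemma independent_extend (V : lmodType K) (N : nat) (g : 'I_N -> V) (f : V) : independent g ->
  ~ spanned (fun w => exists j, w = g j) f ->
  independent (fun i : 'I_N.+1 => if unlift ord0 i is Some j then g j else f).
Proof.
move=> ig nf c; rewrite big_ord_recl unlift_none => E.
have c0 : c 0 ord0 = 0.
  apply/eqP/negPn/negP => c0; apply: nf.
  have -> : f = - (c 0 ord0)^-1 *: (\sum_(i < N) c 0 (lift ord0 i) *: g i).
    move/eqP: E; rewrite addr_eq0 => /eqP E.
    have E' : \sum_(i < N) c 0 (lift ord0 i) *: g i = - (c 0 ord0 *: f).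
      rewrite E opprK; apply: eq_bigr => i _; by rewrite liftK.
    by rewrite E' scalerN scaleNr opprK scalerA mulVf // scale1r.
  apply: spannedZ; apply: spanned_sum => i _; apply: spannedZ; apply: spanned_gen.
  by exists i.
have Eg : \sum_(i < N) (\row_i c 0 (lift ord0 i)) 0 i *: g i = 0.
  rewrite c0 scale0r add0r in E; rewrite -[RHS]E; apply: eq_bigr => i _.
  by rewrite mxE liftK.
have /rowP cg := ig _ Eg; apply/rowP => i; rewrite mxE.
by case: (unliftP ord0 i) => [j ->|-> //]; have := cg j; rewrite !mxE.
Qed.

End SpanMul.

Section Minimal.
Variables (K : fieldType) (R : realType) (r n : nat) (M : 'M[R]_(r, n)).
Local Notation mon := 'X_{1..r * n}.
Local Notation poly := {mpoly K[r * n]}.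
Local Notation w := (Defs.mweight M).

Lemma spanned_labels (Gd : mon -> Prop) (g : mon -> poly) f :
  spanned (fun p => exists2 m, Gd m & p = g m) f ->
  exists (s : seq mon) (k : mon -> K), [/\ uniq s, forall m, m \in s -> Gd m
    & f = \sum_(m <- s) k m *: g m].
Proof.
elim=> [|c p v [m0 Gm0 ->] _ [s [k [us Gs ->]]]].
  by exists [::], (fun=> 0); rewrite big_nil.
case: (boolP (m0 \in s)) => sm0.
  exists s, (fun m => k m + (if m == m0 then c else 0)); split=> //.
  under [RHS]eq_bigr do rewrite scalerDl; rewrite big_split addrC /=; congr (_ + _).
  rewrite (bigD1_seq m0) //= eqxx big1 ?addr0 // => m /negbTE->.
  by rewrite scale0r.
exists (m0 :: s), (fun m => if m == m0 then c else k m); split=> [|m|].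
- by rewrite /= sm0.
- by rewrite inE => /orP[/eqP->|/Gs].
rewrite big_cons eqxx; congr (_ + _); apply: eq_big_seq => m ms.
by case: eqP => // E; rewrite -E ms in sm0.
Qed.

Lemma min_label (Gd : mon -> Prop) (g : mon -> poly) (c : mon -> K) f m :
  (forall m, Gd m -> c m != 0 /\ has_lead M (g m) m (c m)) ->
  spanned (fun p => exists2 m, Gd m & p = g m) f -> m \in msupp f ->
  (forall m', m' \in msupp f -> w m <= w m') -> Gd m.
Proof.
move=> Hg /spanned_labels[s [k [us Gs ->]]] mf min_m.
set h := \sum_(_ <- _) _ in mf min_m.
have [m1 m1s [k1 m1g]] : exists2 m1, m1 \in s & k m1 != 0 /\ m \in msupp (g m1).
  apply: NNPP => H; move: mf; rewrite mcoeff_msupp /h raddf_sum /= big_seq big1 ?eqxx // => m1 m1s.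
  rewrite mcoeffZ; apply/eqP; rewrite mulf_eq0 -[_ == 0]negbK -[(g m1)@_m == 0]negbK -mcoeff_msupp -negb_and.
  by apply/negP => /andP[k1 m1g]; apply: H; exists m1.
case: (eqVneq m m1) => [->|nm]; first exact: Gs.
have [c1 l1] := Hg m1 (Gs _ m1s); have lt1 := has_lead_lt l1 m1g nm.
pose T := {i : 'I_(size s) | k (nth 0%MM s i) != 0}.
have im1 : (index m1 s < size s)%N by rewrite index_mem.
have P1 : k (nth 0%MM s (Ordinal im1)) != 0 by rewrite /= nth_index.
case: (@arg_minP _ _ _ (Ordinal im1) (fun i : 'I_(size s) => k (nth 0%MM s i) != 0)
  (fun i => w (nth 0%MM s i)) P1) => i0 ki0 min_i0.
set m0 := nth 0%MM s i0 in ki0 min_i0.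
have m0s : m0 \in s by apply: mem_nth.
have le0 m' : m' \in s -> k m' != 0 -> w m0 <= w m'.
  move=> m's km'; have im' : (index m' s < size s)%N by rewrite index_mem.
  by have := min_i0 (Ordinal im'); rewrite /= nth_index // => /(_ km').
have m0f : m0 \in msupp h.
  rewrite mcoeff_msupp /h raddf_sum /= (bigD1_seq m0) //= big_seq_cond big1 ?addr0.
    by have [c0 l0] := Hg m0 (Gs _ m0s); rewrite mcoeffZ (has_lead_coef l0) mulf_neq0.
  move=> m' /andP[m's nm']; rewrite mcoeffZ; apply/eqP; rewrite mulf_eq0.
  case: eqP => //= /eqP km'; rewrite -[_ == 0]negbK -mcoeff_msupp; apply/negP => m'g.
  have [_ l'] := Hg m' (Gs _ m's); have := has_lead_lt l' m'g.
  by rewrite eq_sym nm' ltNge le0 // => /(_ isT).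
by have := min_m _ m0f; rewrite leNgt (le_lt_trans (le0 _ m1s k1) lt1).
Qed.

Lemma straight_min (T : Type) (t0 : T) (good : T -> Prop) (P : T -> poly) (lab : T -> mon)
    (om : mon -> nat) (c : T -> K) f m :
  (forall i j, good i -> good j -> lab i = lab j ->
     spanned (fun v => exists k, [/\ good k, (om (lab k) < om (lab i))%N & v = P k])
       (P i - P j)) ->
  (forall i, good i -> c i != 0 /\ has_lead M (P i) (lab i) (c i)) ->
  spanned (fun p => exists2 t, good t & p = P t) f -> m \in msupp f ->
  (forall m', m' \in msupp f -> w m <= w m') -> exists2 t, good t & lab t = m.
Proof.
move=> Hstr Hlead sf mf min_m.
pose e (l : mon) : T := epsilon (inhabits t0) (fun t => good t /\ lab t = l).
pose Gd (l : mon) := exists2 t, good t & lab t = l.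
have eP l : Gd l -> good (e l) /\ lab (e l) = l.
  by move=> [t gt lt]; apply: (epsilon_spec (inhabits t0) (fun t => good t /\ lab t = l)); exists t.
have sf' : spanned (fun p => exists2 l, Gd l & p = P (e l)) f.
  apply: spanned_trans sf => p [t gt ->].
  have sP := @straighten _ _ _ _ good P lab om (fun j => exists2 l, Gd l & j = e l) Hstr _ t gt.
  apply: spanned_sub (sP _) => [v [j [l Gl ->] ->]|i gi]; first by exists l.
  have Gl : Gd (lab i) by exists i.
  by exists (e (lab i)); have [h1 h2] := eP _ Gl; split=> //; exists (lab i).
apply: (@min_label Gd (fun l => P (e l)) (fun l => c (e l)) f) => // l Gl.
by have [h1 h2] := eP l Gl; have := Hlead _ h1; rewrite h2.
Qed.

Lemma min_support (f : poly) : f != 0 ->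
  exists2 m, m \in msupp f & forall m', m' \in msupp f -> w m <= w m'.
Proof.
rewrite -msupp_eq0; set s := msupp f => s0.
have i0P : (0 < size s)%N by case: (s) s0.
case: (@arg_minP _ _ _ (Ordinal i0P) predT (fun i : 'I_(size s) => w (nth 0%MM s i)) isT) => i _ min_i.
exists (nth 0%MM s i) => [|m' ms]; first exact: mem_nth.
have im : (index m' s < size s)%N by rewrite index_mem.
by have := min_i (Ordinal im) isT; rewrite /= nth_index.
Qed.

End Minimal.

(** * The dimension of the graded pieces *)

Section Laplace.
Variables (K : fieldType) (r n : nat) (u v : 'I_r).
Hypothesis neq_uv : u != v.
Local Notation mon := 'X_{1..r * n}.
Local Notation poly := {mpoly K[r * n]}.

Lemma det_two_rows (A : 'M[poly]_r) :
  \det A = \sum_(s : 'S_r | (s u < s v)%N) (-1) ^+ s *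
    ((A u (s u) * A v (s v) - A u (s v) * A v (s u)) *
      \prod_(i | (i != u) && (i != v)) A i (s i)).
Proof.
rewrite /determinant (bigID (fun s : 'S_r => (s u < s v)%N)) /=.
rewrite [X in _ + X](reindex_inj (mulgI (tperm u v))) /=.
rewrite [X in _ + X](eq_bigl (fun s : 'S_r => (s u < s v)%N)) => [|s]; last first.
  rewrite !permM tpermL tpermR -leqNgt ltn_neqAle; case: leqP; rewrite ?andbF // andbT.
  by rewrite val_eqE (inj_eq perm_inj) neq_uv.
rewrite -big_split /=; apply: eq_bigr => s _.
have split_prod (F : 'I_r -> poly) :
    \prod_i F i = F u * F v * \prod_(i | (i != u) && (i != v)) F i.
  by rewrite (bigD1 u) //= (bigD1 v) /= ?mulrA // eq_sym.
rewrite odd_permM odd_tperm neq_uv !split_prod !permM tpermL tpermR.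
have -> : \prod_(i | (i != u) && (i != v)) A i ((tperm u v * s)%g i) =
          \prod_(i | (i != u) && (i != v)) A i (s i).
  by apply: eq_bigr => i /andP[iu iv]; rewrite permM tpermD // eq_sym.
by rewrite signr_addb expr1; move: ((-1) ^+ s) (\prod_(_ | _) _) => x y; ring.
Qed.

Definition two_row_unit (p : poly) := exists (mu : mon) (a : 'I_n * 'I_n),
  [/\ (a.1 < a.2)%N, clear_rows u v mu,
     forall i, i != u -> i != v -> rcount mu i predT = 1%N
   & p = gpoly K u v mu (Config [:: a] [::] [::])].

Lemma mpolyX_sum (I : Type) (s : seq I) (P : pred I) (F : I -> mon) :
  'X_[\sum_(i <- s | P i) F i] = \prod_(i <- s | P i) 'X_[F i] :> poly.
Proof.
by elim/big_rec2: _ => [|i x y _ <-]; rewrite ?mpolyX0 // mpolyXD.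
Qed.

Lemma det_spanned (I : rsubset r n) : spanned two_row_unit (plucker_det K I).
Proof.
rewrite /plucker_det det_two_rows; apply: spanned_sum => s lt_s.
have sgn (b : bool) (p : poly) : spanned two_row_unit p -> spanned two_row_unit ((-1) ^+ b * p).
  by case: b => sp; rewrite ?expr1 ?mulN1r ?mul1r //; apply: spannedN.
apply: sgn; apply: spanned_gen; set e := rsubset_col I.
pose mu : mon := (\sum_(i | (i != u) && (i != v)) U_(mxvec_index i (e (s i))))%MM.
have mu_row i p : rcount mu i p = (((i != u) && (i != v)) * p (e (s i)))%N.
  rewrite /mu; have -> : (\sum_(i | (i != u) && (i != v)) U_(mxvec_index i (e (s i))))%MM =
     (\sum_(i | (i != u) && (i != v)) mrow i [:: e (s i)])%MM.
    by apply: eq_bigr => k _; rewrite /mrow big_seq1.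
  have -> : nat_of_bool (p (e (s i))) = count p [:: e (s i)] by rewrite /= addn0.
  rewrite (count_letters p) big_distrr /=; apply: eq_bigr => j _.
  by rewrite sum_mrow_row.
exists mu, (e (s u), e (s v)); split=> /=.
- exact: rsubset_col_lt.
- move=> j; rewrite -!rcount1 !mu_row !eqxx /= andbF; split=> //.
- by move=> i iu iv; rewrite mu_row iu iv.
rewrite /gpoly /cpoly /= big_seq1 !big_nil !mulr1 /minor2 /xvar /= mpolyX_sum mulrC !mxE.
by congr (_ * _); apply: eq_bigr => i _; rewrite !mxE.
Qed.

Definition two_row_product (d : nat) (p : poly) := exists (mu : mon) (A : seq ('I_n * 'I_n)),
  [/\ all (arc_ok (fun=> 0%N)) A, size A = d, clear_rows u v mu,
     forall i, i != u -> i != v -> rcount mu i predT = d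
   & p = gpoly K u v mu (Config A [::] [::])].

Lemma dets_spanned (Is : seq (rsubset r n)) :
  spanned (two_row_product (size Is)) (\prod_(I <- Is) plucker_det K I).
Proof.
apply: spanned_prod det_spanned.
  exists 0%MM, [::]; split=> //.
  - by move=> j; rewrite !mnm0E.
  - by move=> i _ _; rewrite /rcount big1 // => j _; rewrite mnm0E.
  - by rewrite /gpoly /cpoly !big_nil mpolyX0 !mulr1.
move=> k g h [mu [a [lt_a cm rm ->]]] [mu' [A [okA szA cm' rm' ->]]].
exists (mu + mu')%MM, (a :: A); split=> /=.
- by rewrite /arc_ok lt_a eqxx.
- by rewrite szA.
- by move=> j; rewrite !mnmDE; have [-> ->] := cm j; have [-> ->] := cm' j.
- by move=> i iu iv; rewrite rcountD rm // rm' // add1n.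
rewrite /gpoly /cpoly /= mpolyXD big_seq1 !big_nil !mulr1 big_cons.
by rewrite mulrACA.
Qed.

End Laplace.

Section Natural.
Variables (K : fieldType) (R : realType) (r n d : nat).
Local Notation mon := 'X_{1..r * n}.
Local Notation poly := {mpoly K[r * n]}.
Local Notation full := (@full r n d).

Lemma full_labels (P : mon -> Prop) : (0 < r)%N -> (forall m, P m -> full m) ->
  exists2 s : seq mon, uniq s & forall m, m \in s <-> P m.
Proof.
move=> r0 PF; pose U := [seq [multinom (f k : nat) | k < r * n] | f : {ffun 'I_(r * n) -> 'I_d.+1}].
have [s us Hs] := filter_prop P U; exists s => // m; rewrite Hs; split=> [[]|Pm] //; split=> //.
apply/imageP; exists [ffun k => inord (m k)] => //.
apply: monP => i j; rewrite mnmE ffunE inordK // ltnS -(PF m Pm i) -rcount1.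
by rewrite /rcount [X in (_ <= X)%N](bigID (pred1 j)) /= leq_addr.
Qed.

Definition degree_product (p : poly) := exists2 Is : seq (rsubset r n), size Is = d &
  p = \prod_(I <- Is) plucker_det K I.

(* The bound [bb] forces the configurations to consist of arcs only. *)
Lemma min_interlaced (f : poly) (m : mon) (u v : 'I_r) : (0 < n)%N -> (u < v)%N ->
  spanned degree_product f -> m \in msupp f ->
  (forall m', m' \in msupp f ->
     Defs.mweight (- antiweight r n R) m <= Defs.mweight (- antiweight r n R) m') ->
  full m /\ interlaced m u v.
Proof.
move=> n0 lt_uv sf mf min_m; have nuv : u != v by rewrite -val_eqE ltn_eqF.
pose blk := fun _ : nat => 0%N.
have blk_mono : forall a b : nat, (a <= b)%N -> (blk a <= blk b)%N by [].
pose e (l : mon) (c : nat) := both l u v (upto blk c).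
pose bb (l : mon) (c : nat) := if c.+1 == n then d else 0%N.
pose lo (l : mon) (c : nat) := 0%N.
have base_sim l l' : similar u v blk l l' -> full l -> full l'.
  exact: full_sim.
have bounds_sim l l' c : similar u v blk l l' -> (c < n)%N ->
    [/\ e l c = e l' c, bb l c = bb l' c, lo l c = lo l' c & e l c = e l' c].
  by case=> _ h _ _; split=> //; apply: h.
have sf' : spanned (fun p => exists2 t : mon * config n, feas u v blk e bb lo e full t.1 t.2 &
    p = gpoly K u v t.1 t.2) f.
  apply: spanned_trans sf => _ [Is szI ->].
  apply: spanned_sub (dets_spanned K nuv Is) => _ [mu [A [okA szA cm rm ->]]].
  rewrite szI in szA rm; exists (mu, Config A [::] [::]) => //=.
  apply: feas_intro => // [|c lt_c].
    move=> i; case: (eqVneq i u) => [->|iu].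
      by have [-> _] := rcount_ulab lt_uv (Config A [::] [::]) predT cm; rewrite count_predT size_map.
    case: (eqVneq i v) => [->|iv].
      by have [_ ->] := rcount_ulab lt_uv (Config A [::] [::]) predT cm; rewrite count_predT size_map.
    by rewrite ulab_row_other // rm.
  cbv zeta; rewrite /e /both.
  have [-> ->] := rcount_ulab lt_uv (Config A [::] [::]) (upto blk c) cm; rewrite !count_cat /=.
  split; try by (clear; lia).
  all: try by rewrite ?leq_addr ?leq_addl.
  rewrite /bb; case: eqP => // cn; rewrite -szA -(size_map snd) -count_predT.
  apply: sub_count => j _; rewrite /upto eqxx /=; have := ltn_ord j; move: cn; clear; lia.
have [t [cm ft [okA _ G]] <-] := @straight_min K R r n (- antiweight r n R) _ (0%MM, Config [::] [::] [::])
  (fun t => feas u v blk e bb lo e full t.1 t.2)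
  (fun t => gpoly K u v t.1 t.2) (fun t => ulab u v t.1 t.2) (@posweight r n) (fun=> 1) f m
  (fun i j fi fj E => gpoly_straight K lt_uv blk_mono base_sim bounds_sim fi fj E)
  (fun i fi => conj (oner_neq0 K) (lead_u K lt_uv R i.1 (let: And3 _ _ (And3 ok _ _) := fi in ok)))
  sf' mf min_m.
split=> // c; have [cU cV] : (forall p, rcount (ulab u v t.1 t.2) u p = count p (us t.2 ++ qs t.2)) /\
    (forall p, rcount (ulab u v t.1 t.2) v p = count p (vs t.2 ++ ts t.2)).
  by split=> p; have [] := rcount_ulab lt_uv t.2 p cm.
have pn : (n.-1 < n)%N by rewrite prednK.
have [_ + _ _ _] := G n.-1 pn; rewrite /bb prednK // eqxx => le_d.
have le_d' : (d <= size (ts t.2))%N by apply: leq_trans le_d _; apply: count_size.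
have szq : size (qs t.2) = size (ts t.2) by rewrite !size_map.
have u0 : us t.2 = [::].
  have := ft u; rewrite cU count_predT size_cat szq.
  by case: (us t.2) => //= ? ?; move: le_d'; clear; lia.
have v0 : vs t.2 = [::].
  have := ft v; rewrite cV count_predT size_cat.
  by case: (vs t.2) => //= ? ?; move: le_d'; clear; lia.
rewrite cU cV u0 v0 /= /qs /ts !count_map.
rewrite !(@count_sum ('I_n * 'I_n)%type); apply: leq_sum_in => a /(allP okA)/andP[lt_a _] /=.
by case: (leqP a.2 c) => // h; rewrite (leq_trans lt_a h).
Qed.

Definition natural (m : mon) := full m /\ forall u v : 'I_r, (u < v)%N -> interlaced m u v.

Lemma degree_bound (s : seq mon) (N : nat) (g : 'I_N -> poly) : (0 < n)%N -> (1 < r)%N ->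
  (forall m, natural m -> m \in s) -> independent g ->
  (forall i, spanned degree_product (g i)) -> (N <= size s)%N.
Proof.
move=> n0 r1 Hs ig sg; rewrite leqNgt; apply/negP => lt_N.
pose A : 'M[K]_(N, size s) := \matrix_(i, k) (g i)@_(nth 0%MM s k).
have : kermx A != 0.
  rewrite kermx_eq0 /row_free; apply/negP => /eqP E.
  by have := rank_leq_col A; rewrite E leqNgt lt_N.
case/rowV0Pn => c /sub_kermxP cA c0.
pose f := \sum_i c 0 i *: g i.
have f0 : f != 0 by apply: contra c0 => /eqP /ig ->.
have sf : spanned degree_product f by apply: spanned_sum => i _; apply: spannedZ.
have [m mf min_m] := min_support (- antiweight r n R) f0.
have nm : m \in s.
  apply: Hs; split=> [|u v lt_uv]; last by have [] := min_interlaced n0 lt_uv sf mf min_m.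
  have lt01 : (Ordinal (ltnW r1) < Ordinal r1)%N by [].
  by have [] := min_interlaced n0 lt01 sf mf min_m.
have im : (index m s < size s)%N by rewrite index_mem.
have := congr1 (fun B : 'rV_(size s) => B 0 (Ordinal im)) cA; rewrite !mxE => E.
move: mf; rewrite mcoeff_msupp => /negP; apply; apply/eqP.
rewrite raddf_sum /= -[RHS]E; apply: eq_bigr => i _.
by rewrite mcoeffZ mxE /= nth_index.
Qed.

End Natural.

(** * The SAGBI property *)

Section Rotation.
Variables (r n d : nat) (hr : (3 <= r)%N).
Local Notation mon := 'X_{1..r * n}.

Definition rotated_row (i : 'I_r) : 'I_r :=
  if i == rz hr then rx hr else if i == rx hr then ry hr else if i == ry hr then rz hr else i.

Definition rotate (m : mon) : mon := (\sum_i mrow i (row_letters m (rotated_row i)))%MM.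

Lemma rotateE m i j : rotate m (mxvec_index i j) = m (mxvec_index (rotated_row i) j).
Proof. by rewrite /rotate (sum_mrow_row xpredT) mul1n count_letter. Qed.

Lemma rcount_rotate m i p : rcount (rotate m) i p = rcount m (rotated_row i) p.
Proof. by apply: eq_bigr => j _; rewrite rotateE. Qed.

Lemma rotated_row_id (i : 'I_r) : (3 <= i)%N -> rotated_row i = i.
Proof. by rewrite /rotated_row -!val_eqE /=; case: (i : nat) => [|[|[|]]]. Qed.

Lemma rotate_inj : injective rotate.
Proof.
move=> m m' E; apply: monP => i j.
have [i' <-] : exists i', rotated_row i' = i.
  case: (ltnP i 3) => i3; last by exists i; apply: rotated_row_id.
  have [->|[->|->]] : i = rx hr \/ i = ry hr \/ i = rz hr.
    case: i i3 => [[|[|[|//]]] hi] _; [left | right; left | right; right]; exact: val_inj.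
  - by exists (rz hr); rewrite /rotated_row eqxx.
  - by exists (rx hr).
  - by exists (ry hr).
by rewrite -!rotateE E.
Qed.

Lemma natural_rotate m : natural d m -> V0 d hr (rotate m).
Proof.
move=> [F H]; split.
- by move=> i; rewrite rcount_rotate.
- by move=> c; rewrite !rcount_rotate; apply: (H (rx hr) (ry hr)).
- by move=> c; rewrite !rcount_rotate; apply: (H (ry hr) (rz hr)).
- move=> k k3 c; rewrite !rcount_rotate (rotated_row_id (i := k)) ?k3 //.
  by apply: (H (rz hr) k); rewrite k3.
move=> i k i3 ki c; rewrite !rcount_rotate !rotated_row_id ?ki ?(leq_trans i3) //.
by apply: H; rewrite ki.
Qed.

End Rotation.

Section Sagbi.
Variables (K : fieldType) (R : realType) (r n : nat) (a : seq nat).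
Hypotheses (hr : (3 <= r)%N) (lt_rn : (r < n)%N) (sum_a : sumn a = n).
Variable L : matching_field r n.
Hypothesis L_aligned : forall I, aligned a (fun i => rsubset_col I (L I i)).
Local Notation mon := 'X_{1..r * n}.
Local Notation poly := {mpoly K[r * n]}.
Local Notation blk := (col_block a).
Local Notation full := (@full r n).

Definition lmon (Is : seq (rsubset r n)) : mon :=
  (\sum_(i < r) mrow i [seq rsubset_col J (L J i) | J : rsubset r n <- Is])%MM.

Lemma lmonE Is (i : 'I_r) (j : 'I_n) :
  lmon Is (mxvec_index i j) = count (pred1 j) [seq rsubset_col J (L J i) | J : rsubset r n <- Is].
Proof.
by rewrite /lmon (sum_mrow_row xpredT (fun i : 'I_r => [seq rsubset_col J (L J i) | J : rsubset r n <- Is])) mul1n.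
Qed.

Lemma rcount_lmon Is i : rcount (lmon Is) i predT = size Is.
Proof.
rewrite -(size_map (fun I : rsubset r n => rsubset_col I (L I i))) -count_predT (count_letters predT).
by apply: eq_bigr => j _; rewrite lmonE.
Qed.

Lemma lmon_cons I Is : lmon (I :: Is) = (lmon [:: I] + lmon Is)%MM.
Proof. by apply: monP => i j; rewrite mnmDE !lmonE /= addn0. Qed.

Lemma lmon_sum Is : (\sum_(I <- Is) lmon [:: I])%MM = lmon Is.
Proof.
elim: Is => [|I Is IH]; last by rewrite big_cons IH -lmon_cons.
by rewrite big_nil; apply: monP => i j; rewrite mnm0E lmonE.
Qed.

Lemma feas2_lmon d mu M : feas2 d hr blk mu M ->
  exists2 Is, size Is = d & lmon Is = ulab2 hr mu M.
Proof.
move=> fM; have [s [Hs cs]] := feas2_columns (@col_block_mono a) fM.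
have [Is [szI HI]] : exists Is : seq (rsubset r n), size Is = size s /\
    forall i, [seq rsubset_col J (L J i) | J : rsubset r n <- Is] = [seq c i | c : {ffun 'I_r -> 'I_n} <- s].
  elim: s cs {Hs} => [|c s IH] cs; first by exists [::].
  have [|Is [szI HI]] := IH; first by move=> c' c's; apply: cs; rewrite inE c's orbT.
  have [al cI] := col_upto_aligned sum_a (cs c (mem_head _ _)).
  have [I [sg cE]] := rsubset_of cI; exists (I :: Is); split=> [|i] /=; first by rewrite szI.
  rewrite HI; congr (_ :: _); rewrite cE; congr (rsubset_col I _).
  case: (eqVneq sg (L I)) => [->//|neq]; exfalso.
  have al' : aligned a (fun i => rsubset_col I (sg i)).
    by move=> x y xy; rewrite -!cE; apply: al.
  have n1 : (sg * (L I)^-1)%g != 1%g by apply: contra neq; rewrite -eq_mulgV1.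
  have n2 : ((L I) * sg^-1)%g != 1%g by apply: contra neq; rewrite -eq_mulgV1 => /eqP->.
  have := @aligned_lt R r n a sum_a _ _ n.+1%:R (L_aligned I) (lexx _) n1.
  have := @aligned_lt R r n a sum_a _ _ n.+1%:R al' (lexx _) n2.
  have wtE (s1 s2 : 'S_r) : wt a n.+1%:R (fun i => rsubset_col I (s2 ((s1 * s2^-1)%g i))) =
     wt a n.+1%:R (fun i => rsubset_col I (s1 i)) :> R.
    by apply: eq_bigr => i0 _; rewrite permM permKV.
  by rewrite !wtE => h1 /(lt_trans h1); rewrite ltxx.
have Hl : lmon Is = ulab2 hr mu M.
  apply: monP => i j; rewrite lmonE HI -count_letter.
  by apply/seq.permP: (pred1 j); apply: Hs.
exists Is => //; rewrite -(rcount_lmon Is (rx hr)) Hl.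
by case: fM => _ [F _ _ _ _] _; apply: F.
Qed.

Definition in_field (d : nat) (m : mon) := exists2 Is, size Is = d & lmon Is = m.

Lemma dim_bound (d N : nat) (s : seq mon) (g : 'I_N -> poly) :
  (forall m, in_field d m -> m \in s) -> independent g ->
  (forall i, spanned (@degree_product K r n d) (g i)) -> (N <= size s)%N.
Proof.
move=> Hs ig sg; have r0 : (0 < r)%N by apply: leq_trans hr.
have n0 : (0 < n)%N by apply: leq_trans lt_rn.
have [s0 us0 Hs0] := @full_labels r n d (@natural r n d) r0 (fun m h => proj1 h).
have Hvf m : (exists mu M, feas2 d hr blk mu M /\ vlab2 hr mu M = m) -> full d m.
  move=> [mu [M [fM <-]]] i; case: (fM) => cm [F _ _ _ _] [okA _ _].
  rewrite -(F i); case: (eqVneq i (ry hr)) => [->|iy].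
    have [-> _] := rcount_ulab (ry_rz hr) M predT cm.
    have [h _] := rcount_clear predT cm.
    by rewrite /vlab2 /vlab !rcountD !rcount_mrow h eqxx !count_cat !count_predT !size_map /= mul1n mul0n addn0.
  case: (eqVneq i (rz hr)) => [->|iz].
    have [_ ->] := rcount_ulab (ry_rz hr) M predT cm.
    have [_ h] := rcount_clear predT cm.
    by rewrite /vlab2 /vlab !rcountD !rcount_mrow h eqxx !count_cat !count_predT !size_map /= mul1n mul0n.
  by rewrite ulab_row_other ?vlab_row_other.
have [s1 us1 Hs1] := full_labels r0 Hvf.
have le0 : (N <= size s0)%N.
  by apply: (@degree_bound K R r n d s0 N g) => //; [apply: leq_trans hr | move=> m /Hs0].
apply: leq_trans le0 _; rewrite -(size_map (rotate hr)).
apply: (@leq_trans (size s1)).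
  apply: (@wall_crossing r n K _ _ (rx_rz hr) blk (@col_block_mono a) _ _ _ _ _
    (@base1_sim r n d hr blk) (@bounds1_sim r n hr blk) R).
  - by rewrite map_inj_uniq //; apply: rotate_inj.
  - move=> m /mapP[m0 /Hs0 nm ->]; apply: (V0_vlab (@col_block_mono a)).
    exact: natural_rotate.
  - by move=> mu M fM; apply/Hs1; apply: (feas1_vlab2 (@col_block_mono a) fM).
apply: (@wall_crossing r n K _ _ (ry_rz hr) blk (@col_block_mono a) _ _ _ _ _
    (@base2_sim r n d hr blk) (@bounds2_sim r n hr blk) R s1 s us1).
  by move=> m /Hs1.
by move=> mu M fM; apply: Hs; apply: feas2_lmon fM.
Qed.

Section Weight.
Variables (beta : R) (ge_beta : n.+1%:R <= beta).
Local Notation W := (block_weight_mx r n a 3 beta).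

Definition dets (Is : seq (rsubset r n)) : poly := \prod_(I <- Is) plucker_det K I.

Lemma lmon1 I : lmon [:: I] = (\sum_i U_(mxvec_index i (rsubset_col I (L I i))))%MM.
Proof. by apply: eq_bigr => i _; rewrite /mrow big_seq1. Qed.

Lemma det_lead I : has_lead W (plucker_det K I) (lmon [:: I]) ((-1) ^+ L I).
Proof.
set e := rsubset_col I.
pose ms (s : 'S_r) : mon := (\sum_i U_(mxvec_index i (e (s i))))%MM.
have detE : plucker_det K I = \sum_(s : 'S_r) (-1) ^+ s *: 'X_[ms s].
  apply: eq_bigr => s _; rewrite /ms mpolyX_sum -mul_mpolyC rmorphXn rmorphN1; congr (_ * _).
  by apply: eq_bigr => i _; rewrite !mxE.
have wE s : Defs.mweight W (ms s) = wt a beta (fun i => e (s i)).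
  by rewrite mweight_sum; apply: eq_bigr => i _; rewrite mweightU.
rewrite lmon1 detE (bigD1 (L I)) //=; eexists; first reflexivity.
apply: (big_ind (heavier W _)) => [m|p q hp hq|s ns m /msuppZ_le].
- by rewrite msupp0.
- exact: heavierD.
rewrite msuppX inE => /eqP->; rewrite -/(ms (L I)) !wE.
have n1 : (s * (L I)^-1)%g != 1%g by apply: contra ns; rewrite -eq_mulgV1.
have := @aligned_lt R r n a sum_a _ _ beta (L_aligned I) ge_beta n1.
rewrite [X in _ < X](_ : _ = wt a beta (fun i => e (s i))) //.
by apply: eq_bigr => i _; rewrite permM permKV.
Qed.

Lemma sign_neq0 (b : bool) : ((-1) ^+ b : K) != 0.
Proof. by rewrite expf_neq0 // oppr_eq0 oner_neq0. Qed.

Lemma det_initial I : initial_form W (plucker_det K I) =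
  (-1) ^+ (L I : bool) *: \prod_(i < r) varmx K r n i (rsubset_col I (L I i)).
Proof.
rewrite (initial_form_lead (sign_neq0 _) (det_lead I)) lmon1 mpolyX_sum.
by congr (_ *: _); apply: eq_bigr => i _; rewrite mxE.
Qed.

Lemma dets_lead Is : exists2 c : K, c != 0 & has_lead W (dets Is) (lmon Is) c.
Proof.
exists (\prod_(I <- Is) (-1) ^+ L I).
  by rewrite prodf_seq_neq0; apply/allP => I _; rewrite sign_neq0.
by rewrite -lmon_sum; apply: has_lead_prod => I; apply: det_lead.
Qed.

Definition repr_of (m : mon) : seq (rsubset r n) := epsilon (inhabits [::]) (fun Is => lmon Is = m).

Definition in_image (m : mon) := exists Is, lmon Is = m.

Lemma repr_ofP m : in_image m -> lmon (repr_of m) = m.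
Proof. by move=> h; apply: (epsilon_spec (inhabits [::]) (fun Is => lmon Is = m)). Qed.

Definition standard (p : poly) := exists2 m, in_image m & p = dets (repr_of m).

Lemma dets_standard Is : spanned standard (dets Is).
Proof.
pose d := size Is; have r0 : (0 < r)%N by apply: leq_trans hr.
have HP m : in_field d m -> full d m by move=> [Js szJ <-] i; rewrite rcount_lmon.
have [s us Hs] := full_labels r0 HP.
have sP (k : 'I_(size s)) : lmon (repr_of (nth 0%MM s k)) = nth 0%MM s k /\
    size (repr_of (nth 0%MM s k)) = d.
  have /Hs[Js szJ JE] : nth 0%MM s k \in s by apply: mem_nth.
  have E : lmon (repr_of (nth 0%MM s k)) = nth 0%MM s k by apply: repr_ofP; exists Js.
  by split=> //; rewrite -(rcount_lmon _ (rx hr)) E -JE rcount_lmon.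
pose g (k : 'I_(size s)) := dets (repr_of (nth 0%MM s k)).
have [c Hc] : exists c : 'I_(size s) -> K, forall k, c k != 0 /\ has_lead W (g k) (nth 0%MM s k) (c k).
  apply: (fin_all_exists (P := fun k c => c != 0 /\ has_lead W (g k) (nth 0%MM s k) c)) => k.
  by have [c c0 lc] := dets_lead (repr_of (nth 0%MM s k)); exists c; rewrite (proj1 (sP k)) in lc.
have ig : independent g.
  apply: (independent_leads (u := fun k : 'I_(size s) => nth 0%MM s k) (c := c) (M := W)) => [i j E|i|i].
  - by apply: val_inj; apply/eqP; rewrite -(nth_uniq 0%MM _ _ us) ?ltn_ord // E.
  - by case: (Hc i).
  - by case: (Hc i).
apply: (@spanned_sub _ _ (fun w => exists j, w = g j)) => [_ [j ->]|].
  by exists (nth 0%MM s j) => //; exists (repr_of (nth 0%MM s j)); case: (sP j).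
apply: NNPP => nsp; have ie := independent_extend ig nsp.
have : ((size s).+1 <= size s)%N.
  apply: (@dim_bound d _ s _ _ ie) => [m /Hs //|i].
  case: unliftP => [j _|_]; apply: spanned_gen; last by exists Is.
  by exists (repr_of (nth 0%MM s j)) => //; case: (sP j).
by rewrite ltnn.
Qed.

Lemma plucker_standard f : @plucker_algebra K r n f -> spanned standard f.
Proof.
move=> Af; suff : spanned (fun p => exists Is, p = dets Is) f.
  by apply: spanned_trans => _ [Is ->]; apply: dets_standard.
elim: Af => {f} [_ [I ->]|c|p q _ IHp _ IHq|p q _ IHp _ IHq].
- by apply: spanned_gen; exists [:: I]; rewrite /dets big_seq1.
- by apply: spannedZ; apply: spanned_gen; exists [::]; rewrite /dets big_nil.
- exact: spannedD.
- apply: spanned_mul IHp IHq => _ _ [Is ->] [Js ->]; exists (Is ++ Js).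
  by rewrite /dets big_cat.
Qed.

Lemma sagbi : plucker_sagbi K W.
Proof.
have Sdet I : @plucker_algebra K r n (plucker_det K I) by apply: subalgebra_gen_mem; exists I.
move=> p; split; elim=> {p} [p|c|p q _ IHp _ IHq|p q _ IHp _ IHq].
- move=> [f Af ->]; set S := subalgebra_gen _.
  have Sscale c q : S q -> S (c *: q).
    by move=> Sq; rewrite -mulr_algl; apply: subalgebra_gen_mul => //; apply: subalgebra_gen_scalar.
  have S1 : S 1 by rewrite -[1]scale1r; apply: subalgebra_gen_scalar.
  have S0 : S 0 by rewrite -(scale0r 1); apply: Sscale.
  have SX Is : S 'X_[lmon Is].
    elim: Is => [|I Is IH]; first by rewrite -lmon_sum big_nil mpolyX0.
    rewrite lmon_cons mpolyXD; apply: subalgebra_gen_mul => //.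
    have := initial_form_lead (sign_neq0 _) (det_lead I) => E.
    have -> : 'X_[lmon [:: I]] = ((-1) ^+ L I)^-1 *: initial_form W (plucker_det K I) :> poly.
      by rewrite E scalerA mulVf ?sign_neq0 // scale1r.
    by apply: Sscale; apply: subalgebra_gen_mem; exists I.
  rewrite /initial_form big_seq_cond.
  apply: (big_ind S) => [//|x y|m /andP[mf /allP min_m]]; first exact: subalgebra_gen_add.
  apply: Sscale; have [Is <-] : in_image m; last exact: SX.
  have lead_ex m' : exists c : K, in_image m' -> c != 0 /\ has_lead W (dets (repr_of m')) m' c.
    have [c c0 lc] := dets_lead (repr_of m'); exists c => im.
    by rewrite repr_ofP in lc.
  pose cf m' := epsilon (inhabits (0 : K)) (fun c => in_image m' -> c != 0 /\ has_lead W (dets (repr_of m')) m' c).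
  apply: (@min_label K R r n W in_image (fun m => dets (repr_of m)) cf f m) => //; last exact: plucker_standard.
  move=> m'; exact: (epsilon_spec (inhabits (0 : K)) _ (lead_ex m')).
- exact: subalgebra_gen_scalar.
- exact: subalgebra_gen_add.
- exact: subalgebra_gen_mul.
- by move=> [I ->]; apply: subalgebra_gen_mem; exists (plucker_det K I).
- exact: subalgebra_gen_scalar.
- exact: subalgebra_gen_add.
- exact: subalgebra_gen_mul.
Qed.

End Weight.
End Sagbi.

Theorem theorem1p2 (K : fieldType) (R : realType) (r n s : nat)
    (a : s.-tuple nat) (hr : (3 <= r)%N) (hrn : (r < n)%N) (hs : (1 <= s)%N)
    (ha_pos : forall k : 'I_s, (0 < tnth a k)%N)
    (ha_sum : (\sum_(k < s) tnth a k)%N = n) :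
  exists (L : matching_field r n) (beta0 : R), forall beta : R, beta0 <= beta ->
    [/\ induces_matching_field K (block_weight_mx r n a 3 beta) L,
        plucker_sagbi K (block_weight_mx r n a 3 beta)
      & toric_degeneration K (block_weight_mx r n a 3 beta) L].
Proof.
have sum_a : sumn a = n by rewrite sumnE big_tuple.
have [L alL] := @block_field R r n a sum_a.
exists L, n.+1%:R => beta ge_beta.
have ind : induces_matching_field K (block_weight_mx r n a 3 beta) L.
  by move=> I; apply: (det_initial K sum_a alL ge_beta).
have sag : plucker_sagbi K (block_weight_mx r n a 3 beta).
  exact: (sagbi hr hrn sum_a alL ge_beta).
by split.
Qed.
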